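(* For the transient sets of the skew-periodic interval maps $F_{\mathbb Z}$ and $F_{\mathbb N}$ (as in the context) we have $$\dim_H\big(T^{+}(F_{\mathbb N})\big)=\dim_H\big(T^{+}(F_{\mathbb Z})\big)\quad\text{and}\quad \dim_H\big(T^{-}(F_{\mathbb N})\big)=0 .$$ Moreover, for each choice of sign, $$\dim_H\big(T^{\pm}(F_{\mathbb Z})\big)=\begin{cases}\delta_0, & \pm\alpha_{\max}\ge 0,\\ \delta_{\mathbb Z}, & \pm\alpha_{\max}<0.\end{cases}$$
   Context: Conventions: $\mathbb N=\{0,1,2,\dots\}$; $\dim_H$ is Hausdorff dimension, with $\dim_H\emptyset=0$. Base map. $I\subset\mathbb N$ with $\mathrm{card}(I)\ge 2$ (finite or countably infinite), $(J_i)_{i\in I}$ are non-empty pairwise disjoint open subintervals of $(0,1)$, $\Delta_0=\bigcup_{i\in I}J_i$, and $F_0:\Delta_0\to(0,1)$ satisfies: $F_0(J_i)=(0,1)$ for every $i$; each $F_0|_{J_i}$ has a $C^2$-extension to a neighbourhood of $\overline{J_i}$; $\inf_{\Delta_0}|F_0'|>1$; $\sup_{\Delta_0}|F_0''|/(F_0')^2<\infty$. Step functions. $\psi:\Delta_0\to\mathbb Z$ is constant on each $J_i$, with $\inf\psi=-1<0<\sup\psi\le\infty$. $\psi_1:\Delta_0\to\mathbb N$ (reflexion rule) is constant on each $J_i$ with $\psi\le\psi_1\le\psi+M$ for some $M>0$. Extensions. $F_{\mathbb Z}:\Delta_0+\mathbb Z\to\mathbb R$, $F_{\mathbb Z}(x)=F_0(x-\lfloor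 x\rfloor)+\psi(x-\lfloor x\rfloor)+\lfloor x\rfloor$. $F_{\mathbb N}:\Delta_0+\mathbb N\to\mathbb R$, $F_{\mathbb N}(x)=F_0(x)+\psi_1(x)$ if $x\in(0,1)$ and $F_{\mathbb N}(x)=F_0(x-\lfloor x\rfloor)+\psi(x-\lfloor x\rfloor)+\lfloor x\rfloor$ if $x>1$. For a map $f$ with domain $\Delta\subset\mathbb R$: the repeller is $\mathfrak R(f)=\bigcap_{n\ge0}f^{-n}(\Delta)$; $\mathrm{Per}_n(f)=\{x\in\mathfrak R(f):f^n(x)=x\}$; $T^+(f)=\{x\in\mathfrak R(f):\liminf_{n\to\infty}f^n(x)=+\infty\}$; $T^-(f)=\{x\in\mathfrak R(f):\limsup_{n\to\infty}f^n(x)=-\infty\}$. It is assumed that $F_{\mathbb Z}$ and $F_{\mathbb N}$ are topologically transitive on their repellers (for all non-empty relatively open $U,V$ there is $n\in\mathbb N$ with $f^n(U)\cap V\ne\emptyset$). Critical exponents. For $f\in\{F_0,F_{\mathbb N},F_{\mathbb Z}\}$ and a fixed basic interval $J$ of $f$ (that is, $J=J_i$ for $F_0$, and $J=J_i+h$ with $i\in I$ and $h\in\mathbb N$, resp. $h\in\mathbb Z$, for $F_{\mathbb N}$, resp. $F_{\mathbb Z}$), $\delta(f)=\inf\{s\ge0:\sum_{n\ge1}\sum_{x\in\mathrm{Per}_n(f)\cap J}|(f^n)'(x)|^{-s}<\infty\}$, which does not depend on $J$. Write $\delta_0=\delta(F_0)$ and $\delta_{\mathbb Z}=\delta(F_{\mathbb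 Z})$. Pressure and Gibbs measures on the base. Write $\mathfrak R_0=\mathfrak R(F_0)$. A function $g:\mathfrak R_0\to\mathbb R$ is called Hölder continuous if its restrictions to $\mathfrak R_0\cap J_i$ are Hölder continuous with exponent and constant independent of $i$. With $S_ng=\sum_{k=0}^{n-1}g\circ F_0^k$ put $\mathcal P(g)=\limsup_{n\to\infty}\frac1n\log\sum_{x\in\mathrm{Per}_n(F_0)\cap J_i}\exp(S_ng(x))$ (independent of $i\in I$). If $\mathcal P(g)<\infty$, $\mu_g$ denotes the unique $F_0$-invariant Borel probability measure on $\mathfrak R_0$ for which there is $C\ge1$ with $C^{-1}\le \mu_g(J_\omega)/\exp(S_\omega g-n\mathcal P(g))\le C$ for all $n\ge1$, $\omega\in I^n$, where $J_\omega=\{x: F_0^k(x)\in J_{\omega_k},\,0\le k<n\}$ and $S_\omega g=\sup_{J_\omega\cap\mathfrak R_0}S_ng$. Geometric potential: $\varphi=-\log|F_0'|$. $F_0$ is assumed strongly regular: there is $s>0$ with $0<\mathcal P(s\varphi)<\infty$; then $\mathcal P(\delta_0\varphi)=0$. It is assumed that $\int(-\varphi)\,d\mu_{\delta_0\varphi}<\infty$. Finally $\alpha_{\max}=\int\psi\,d\mu_{\delta_0\varphi}\in\mathbb R\cup\{+\infty\}$. *)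

(* Defs.v *)
From HB Require Import structures.
From mathcomp Require Import all_boot all_order all_algebra.
From mathcomp Require Import all_classical all_reals all_analysis.

Set Implicit Arguments.
Unset Strict Implicit.
Unset Printing Implicit Defensive.

Import Order.TTheory GRing.Theory Num.Theory.
Import numFieldNormedType.Exports.

Local Open Scope classical_set_scope.
Local Open Scope ring_scope.

Section Hausdorff.
Context {R : realType}.
Implicit Types (A U : set R) (s d : R).

Definition diam U : \bar R :=
  ereal_sup [set `|x - y|%:E | x in U & y in U].

(* The empty set gets weight 0 also when s = 0; since 0 `^ 0 = 1 for powR,
   the 0-dimensional measure is then the counting measure. *)
Definition hausdorff_weight s U : \bar R :=
  if U == set0 then 0%E else (diam U `^ s)%E.

Definition hausdorff_premeasure s d A : \bar R :=
  ereal_inf [set (\sum_(0 <= k <oo) hausdorff_weight s (U k))%E |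
    U in [set U : (set R)^nat |
      A `<=` \bigcup_k U k /\ forall k, (diam (U k) <= d%:E)%E]].

Definition hausdorff_measure s A : \bar R :=
  ereal_sup [set hausdorff_premeasure s d A | d in [set d : R | 0 < d]].

Definition dimH A : \bar R :=
  ereal_inf [set s%:E | s in [set s : R | 0 <= s /\ hausdorff_measure s A = 0%E]].

End Hausdorff.

(* A partial map of the line is given by its domain D together with a total
   function f whose values outside D are irrelevant: D is open in all uses below,
   and only orbits that stay in D are considered, so that neither these
   orbits nor the derivatives of iterates along them see those values. *)
Section PartialMaps.
Context {R : realType}.
Implicit Types (D J : set R) (f : R -> R).

Definition repeller D f : set R := \bigcap_n (iter n f @^-1` D).

Definition periodic_points D f (n : nat) : set R :=
  [set x | repeller D f x /\ iter n f x = x].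

Definition transient_pos D f : set R :=
  [set x | repeller D f x /\ limn_einf (fun n => (iter n f x)%:E) = +oo%E].

Definition transient_neg D f : set R :=
  [set x | repeller D f x /\ limn_esup (fun n => (iter n f x)%:E) = -oo%E].

Definition transitive_on_repeller D f : Prop :=
  forall U V : set R, open U -> open V ->
    (U `&` repeller D f) !=set0 -> (V `&` repeller D f) !=set0 ->
    exists n : nat,
      ((iter n f @` (U `&` repeller D f)) `&` (V `&` repeller D f)) !=set0.

Definition crit_exponent D f J : \bar R :=
  ereal_inf [set s%:E | s in [set s : R | 0 <= s /\
    (\sum_(1 <= n <oo)
       \esum_(x in periodic_points D f n `&` J) (`|derive1 (iter n f) x| `^ (- s))%:E
     < +oo)%E]].

End PartialMaps.

Section BaseMap.
Context {R : realType}.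
Variables (I : set nat) (J : nat -> set R) (F0 : R -> R).

Definition base_domain : set R := \bigcup_(i in I) J i.

Definition C2_extendable_near_closure (A : set R) (f : R -> R) : Prop :=
  exists (U : set R) (g : R -> R),
    [/\ open U, closure A `<=` U, {in A, g =1 f} &
      forall x, U x -> [/\ derivable g x 1, derivable (derive1 g) x 1 &
                          {for x, continuous (derive1n 2 g)}]].

Record base_map : Prop := BaseMap {
  base_card : exists i j, [/\ I i, I j & i != j] ;
  base_interval : forall i, I i ->
    [/\ J i !=set0, open (J i), is_interval (J i) & J i `<=` `]0, 1[%classic] ;
  base_disjoint : trivIset I J ;
  base_full_branch : forall i, I i -> F0 @` J i = `]0, 1[%classic ;
  base_C2 : forall i, I i -> C2_extendable_near_closure (J i) F0 ;
  base_expanding :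
    (1 < ereal_inf [set `|derive1 F0 x|%:E | x in base_domain])%E ;
  base_adler :
    (ereal_sup [set (`|derive1n 2 F0 x| / derive1 F0 x ^+ 2)%:E | x in base_domain]
       < +oo)%E
}.

Definition constant_on_branches (T : Type) (g : R -> T) : Prop :=
  forall i, I i -> forall x y, J i x -> J i y -> g x = g y.

Definition step_function (psi : R -> int) : Prop :=
  [/\ constant_on_branches psi,
    ereal_inf [set ((psi x)%:~R : R)%:E | x in base_domain] = (-1)%:E &
    (0 < ereal_sup [set ((psi x)%:~R : R)%:E | x in base_domain])%E].

Definition reflexion_rule (psi : R -> int) (psi1 : R -> nat) : Prop :=
  constant_on_branches psi1 /\
  exists2 M : R, 0 < M & forall x, base_domain x ->
    (psi x)%:~R <= ((psi1 x)%:R : R) <= (psi x)%:~R + M.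

Definition domZ : set R := [set x + k%:~R | x in base_domain & k in [set: int]].
Definition domN : set R := [set x + k%:R | x in base_domain & k in [set: nat]].

Definition FZ (psi : R -> int) (x : R) : R :=
  let n : R := (Num.floor x)%:~R in
  F0 (x - n) + (psi (x - n))%:~R + n.

Definition FN (psi : R -> int) (psi1 : R -> nat) (x : R) : R :=
  if 0 < x < 1 then F0 x + (psi1 x)%:R else FZ psi x.

Definition geom_potential (x : R) : R := - ln `|derive1 F0 x|.

Definition birkhoff_sum (g : R -> R) (n : nat) (x : R) : R :=
  \sum_(k < n) g (iter k F0 x).

Definition pressure (i : nat) (g : R -> R) : \bar R :=
  limn_esup (fun n => ((n%:R^-1)%:E *
    lne (\esum_(x in periodic_points base_domain F0 n `&` J i)
           (expR (birkhoff_sum g n x))%:E))%E).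

Definition strongly_regular (i : nat) : Prop :=
  exists2 s : R, 0 < s &
    (0 < pressure i (fun x => s * geom_potential x)%R < +oo)%E.

Definition cylinder (n : nat) (w : 'I_n -> nat) : set R :=
  [set x | forall k : 'I_n, J (w k) (iter k F0 x)].

Definition birkhoff_sup (g : R -> R) (n : nat) (w : 'I_n -> nat) : \bar R :=
  ereal_sup [set (birkhoff_sum g n x)%:E |
              x in cylinder w `&` repeller base_domain F0].

(* Borel probability measures on the repeller are viewed as Borel probability
   measures on the line giving full mass to the repeller.  The two-sided bound
   on the quotient mu (J_w) / exp (S_w g - n P) is cleared of denominators. *)
Definition gibbs_measure (i : nat) (g : R -> R)
    (mu : probability (measurableTypeR R) R) : Prop :=
  [/\ (pressure i g < +oo)%E,
    mu (repeller base_domain F0) = 1%E,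
    (forall A : set (measurableTypeR R), measurable A ->
      mu (F0 @^-1` A `&` repeller base_domain F0) = mu A) &
    exists2 C : R, 1 <= C & forall (n : nat) (w : 'I_n -> nat),
      (0 < n)%N -> (forall k, I (w k)) ->
      let E := expeR (birkhoff_sup g w - n%:R%:E * pressure i g)%E in
      (C^-1%:E * E <= mu (cylinder w) <= C%:E * E)%E].

End BaseMap.

(* Main.v *)
Require Import Defs.
From HB Require Import structures.
From mathcomp Require Import all_boot all_order all_algebra.
From mathcomp Require Import all_classical all_reals all_analysis.
From mathcomp Require Import measurable_realfun.
From mathcomp Require Import ring lra zify.

Set Implicit Arguments.
Unset Strict Implicit.
Unset Printing Implicit Defensive.
Import Order.TTheory GRing.Theory Num.Theory.
Import numFieldNormedType.Exports.
Local Open Scope classical_set_scope.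
Local Open Scope ring_scope.

(** A point of either transient set is coded by the letters of the branches its orbit
visits, and up to translations [T^+] and [T^-] become the sets of [y] whose sums
[S_n psi y] tend to [+oo] or [-oo].  By bounded distortion a word [w] has a weight
[b w], comparable to the length of its cylinder and to the inverse derivative along
it, and [b (w ++ v)] is comparable to [b w * b v].  Periodic points code all words
up to boundary effects, so [delta_0] and [delta_Z] are the critical exponents of
[b w `^ s] summed over all words and over the words of total step [0].

Lower bounds: finitely many words of equal length, all of step of the wanted sign, with
[sum b w `^ s] large, generate a self-similar subset of dimension almost [s].  For
[s < delta_Z] one appends a letter to words of step [0].  For [s < delta_0] and drift
of the wanted sign (or [0]), Markov's inequality gives [S_n >= - eps n] with
[mu]-probability bounded below; passing from [delta_0] to [s] wins an exponential factor
in [n], which pays for [eps n] extra letters.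

Upper bounds: for [s > delta_0] all words are summable and cover.  For
[delta_Z < s < delta_0] and drift of the opposite sign, let [W] be words of equal
length, of opposite step and with large total weight.  Appending [W] maps the words of
step in a band [-L, -M] injectively into those of step in [-L, 0], so the latter
carry a bounded weight as [L] grows; hence the words with step of the wanted sign are
summable, and they cover the transient set infinitely often. *)

(** * Sums over countable sets and Hausdorff measure *)

(** Cylinders are open intervals and neighbouring ones may touch. So nested cylinders may have empty
    intersection, the fixed point of an iterate may fall on an end point, and points with different
    codes may be arbitrarily close. One device removes all three obstacles: a fixed word [g], whose
    cylinder has its closure inside []0, 1[], is put in front of the words, at the price of a
    bounded factor. Where levels or drift matter, [g] is completed to total step 0.

    The lower bounds give away a little of the exponent twice: to pass from a divergent sum to one
    length of large weight, and from there to many words above one common threshold. Both losses are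
    arbitrarily small.

    In the upper bound every level is comparable to level 0, but with a constant depending on the
    level. This gives only finiteness of each band, and finiteness is what allows half of a band to
    be absorbed on the other side of an inequality.

    The step function is bounded below only, so [alpha_max] may be infinite and upward drift is read
    off truncations. The Gibbs bound turns into a bound by weights through the inequality P(delta_0
    phi) >= 0, which is derived from strong regularity. *)

Section Esum.
Context {R : realType}.
Local Open Scope ereal_scope.

Lemma esum_le_subset (T : choiceType) (X Y : set T) (a : T -> \bar R) :
  X `<=` Y -> \esum_(x in X) a x <= \esum_(y in Y) a y.
Proof.
move=> XY; apply: ge_ereal_sup => _ [F [finF FX] <-].
by apply: ereal_sup_ubound; exists F => //; split=> // x /FX /XY.
Qed.

Lemma esumZ_le (T : choiceType) (X : set T) (C : R) (a : T -> \bar R) :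
  (0 <= C)%R -> (forall x, X x -> 0 <= a x) ->
  \esum_(x in X) (C%:E * a x) <= C%:E * \esum_(x in X) a x.
Proof.
move=> C0 a0; apply: ge_ereal_sup => _ [F [finF FX] <-].
rewrite fsbig_finite//= big_seq -ge0_sume_distrr -?big_seq; last first.
  by move=> i; rewrite in_fset_set// inE => /FX /a0.
apply: lee_wpmul2l; first by rewrite lee_fin.
by apply: ereal_sup_ubound; exists F => //; rewrite fsbig_finite.
Qed.

(** Common pattern of the later estimates: words are recoded injectively, by appending a word or by
    passing to a periodic point, and each term loses a bounded factor. *)
Lemma esum_le_inj (T T' : choiceType) (X : set T) (Y : set T') (f : T -> T')
    (C : R) (a : T -> \bar R) (b : T' -> \bar R) :
  (0 <= C)%R -> set_inj X f -> (forall x, X x -> Y (f x)) ->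
  (forall x, X x -> a x <= C%:E * b (f x)) ->
  (forall y, Y y -> 0 <= b y) ->
  \esum_(x in X) a x <= C%:E * \esum_(y in Y) b y.
Proof.
move=> C0 injf fXY ab b0.
apply: (le_trans (le_esum ab)).
apply: (le_trans (esumZ_le _ _)) => //; first by move=> x /fXY /b0.
apply: lee_wpmul2l; first by rewrite lee_fin.
rewrite -esum_image//; apply: esum_le_subset => _ [x Xx <-]; exact: fXY.
Qed.

(** [esum] is a supremum over finite sets, so finitely many terms already exceed [y]. The finite
    families of words in the lower and upper bounds arise this way. *)
Lemma esum_gt (T : choiceType) (X : set T) (a : T -> \bar R) (y : \bar R) :
  y < \esum_(x in X) a x ->
  exists s : seq T, [/\ uniq s, (forall x, x \in s -> X x) &
    y < \sum_(x <- s) a x].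
Proof.
move=> /ereal_sup_gt[_ [F [finF FX] <-]]; rewrite fsbig_finite// => yF.
exists (finmap.enum_fset (fset_set F)); split => // x.
by rewrite in_fset_set// inE; exact: FX.
Qed.

Lemma sum_le_esum (T : choiceType) (X : set T) (a : T -> \bar R) (s : seq T) :
  uniq s -> (forall x, x \in s -> X x) ->
  \sum_(x <- s) a x <= \esum_(x in X) a x.
Proof.
move=> us sX; apply: ereal_sup_ubound; exists [set` s] => /=.
  by split; [exact: finite_seq|move=> x /= /sX].
by rewrite -fsbig_seq.
Qed.

Lemma le_esum_sup (T : choiceType) (X : set T) (a : T -> \bar R) (y : \bar R) :
  (forall s : seq T, uniq s -> (forall x, x \in s -> X x) ->
    \sum_(x <- s) a x <= y) ->
  \esum_(x in X) a x <= y.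
Proof.
move=> h; apply: ge_ereal_sup => _ [F [finF FX] <-]; rewrite fsbig_finite//.
apply: h => // x.
by rewrite in_fset_set// inE; exact: FX.
Qed.

Lemma esum_setU_le (T : choiceType) (X Y Z : set T) (a : T -> \bar R) :
  X `<=` Y `|` Z -> (forall x, 0 <= a x) ->
  \esum_(x in X) a x <= \esum_(x in Y) a x + \esum_(x in Z) a x.
Proof.
move=> XYZ a0; rewrite (esumID Y)//; apply: leeD; apply: esum_le_subset.
  by move=> x [].
by move=> x [/XYZ[]].
Qed.

Lemma ereal_between (x y : \bar R) : x < y ->
  exists2 s : R, x < s%:E & s%:E < y.
Proof.
case: x y => [x| |] [y| |] // xy.
- by rewrite lte_fin in xy; exists ((x + y) / 2)%R; rewrite lte_fin midf_lt.
- by exists (x + 1)%R; rewrite ?ltry// lte_fin ltrDl.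
- by exists (y - 1)%R; rewrite ?ltNyr// lte_fin gtrDl oppr_lt0.
- by exists 0%R; rewrite ?ltNyr ?ltry.
Qed.

End Esum.

(** * Null sets, countable stability and a criterion for positive Hausdorff measure *)

Section Hausdorff.
Context {R : realType}.
Local Open Scope ereal_scope.
Implicit Types (A U : set R) (s d : R).

Lemma hausdorff_weight_ge0 s U : 0 <= hausdorff_weight s U.
Proof. by rewrite /hausdorff_weight; case: ifP => // _; exact: poweR_ge0. Qed.

Lemma hausdorff_weight0 s : hausdorff_weight s (@set0 R) = 0.
Proof. by rewrite /hausdorff_weight eqxx. Qed.

Lemma diam_ge0 U : U !=set0 -> 0 <= diam U.
Proof.
move=> [x Ux]; apply: ereal_sup_ubound; exists x => //; exists x => //.
by rewrite subrr normr0.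
Qed.

Lemma diam_set0 : diam (@set0 R) = -oo.
Proof.
rewrite /diam (_ : [set _ | _ in _ & _ in _] = set0) ?ereal_sup0//.
by apply/seteqP; split => // x [].
Qed.

Lemma hausdorff_weight_le s U (c : R) : (0 <= s)%R -> diam U <= c%:E ->
  hausdorff_weight s U <= (c `^ s)%:E.
Proof.
move=> s0 Uc; rewrite /hausdorff_weight; case: ifPn => [_|/set0P U0].
  by rewrite lee_fin powR_ge0.
have d0 := diam_ge0 U0.
rewrite -poweR_EFin gt0_ler_poweR// in_itv/= leey andbT//.
exact: le_trans Uc.
Qed.

Lemma premeasure_le_cover (T : countType) (X : set T) (V : T -> set R) A s d :
  A `<=` \bigcup_(x in X) V x -> (forall x, X x -> diam (V x) <= d%:E) ->
  hausdorff_premeasure s d A <= \esum_(x in X) hausdorff_weight s (V x).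
Proof.
move=> AV Vd.
(* Indices that code no element of [X] receive the empty set, of weight 0 and diameter -oo, so they
   disturb neither the sum nor the mesh. *)
pose U k := if pickle_inv k is Some x then if x \in X then V x else set0
            else @set0 R.
have Udef x : X x -> U (pickle x) = V x by move=> Xx; rewrite /U pickleK_inv mem_set.
apply: (@le_trans _ _ (\sum_(0 <= k <oo) hausdorff_weight s (U k))).
  apply: ereal_inf_lbound; exists U => //; split.
    by move=> y /AV[x Xx Vy]; exists (pickle x) => //; rewrite Udef.
  move=> k; rewrite /U; case: pickle_inv => [x|]; last by rewrite diam_set0 leNye.
  by case: ifPn => [/set_mem /Vd//|_]; rewrite diam_set0 leNye.
rewrite nneseries_esumT; last by move=> k; exact: hausdorff_weight_ge0.
rewrite (esumID (pickle @` X)); last by move=> *; exact: hausdorff_weight_ge0.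
rewrite [X in _ + X]esum1 ?adde0; last first.
  move=> k [_ kX]; rewrite /U; case Ek : pickle_inv => [x|]; last exact: hausdorff_weight0.
  case: ifPn => [/set_mem Xx|_]; last exact: hausdorff_weight0.
  by exfalso; apply: kX; exists x => //; have := @pickle_invK T k; rewrite /ocancel Ek.
rewrite setTI esum_image; last by move=> x y _ _; exact: (pcan_inj (@pickleK T)).
by apply: le_esum => x Xx; rewrite Udef.
Qed.

Lemma hausdorff_premeasure_ge0 s d A : 0 <= hausdorff_premeasure s d A.
Proof.
apply: le_ereal_inf_tmp => _ [U _ <-].
by apply: nneseries_ge0 => k _ _; exact: hausdorff_weight_ge0.
Qed.

Lemma hausdorff_measure_eq0 s A :
  (forall d e : R, (0 < d)%R -> (0 < e)%R ->
    hausdorff_premeasure s d A <= e%:E) ->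
  hausdorff_measure s A = 0.
Proof.
move=> h; apply/eqP; rewrite eq_le; apply/andP; split.
  apply: ge_ereal_sup => _ [d d0 <-]; apply/lee_addgt0Pr => e e0.
  by rewrite add0e; exact: h.
apply: (le_trans (hausdorff_premeasure_ge0 s 1 A)).
by apply: ereal_sup_ubound; exists 1%R => /=.
Qed.

Lemma hausdorff_measure0_cover s A d e : hausdorff_measure s A = 0 ->
  (0 < d)%R -> (0 < e)%R ->
  exists U : (set R)^nat, [/\ A `<=` \bigcup_k U k,
    forall k, diam (U k) <= d%:E &
    \sum_(0 <= k <oo) hausdorff_weight s (U k) < e%:E].
Proof.
move=> h d0 e0.
have : hausdorff_premeasure s d A < e%:E.
  apply: (@le_lt_trans _ _ 0); last by rewrite lte_fin.
  by rewrite -h; apply: ereal_sup_ubound; exists d.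
by move=> /ereal_inf_lt[_ [U [AU Ud] <-] Ue]; exists U.
Qed.

Lemma hausdorff_measure0_bigcup s A (B : nat -> set R) :
  A `<=` \bigcup_k B k -> (forall k, hausdorff_measure s (B k) = 0) ->
  hausdorff_measure s A = 0.
Proof.
move=> AB B0; apply: hausdorff_measure_eq0 => d e d0 e0.
have eps k : (0 < e / (2 ^ k.+1)%:R)%R by rewrite divr_gt0// ltr0n expn_gt0.
have /choice[U HU] : forall k, exists U : (set R)^nat, [/\ B k `<=` \bigcup_j U j,
    forall j, diam (U j) <= d%:E &
    \sum_(0 <= j <oo) hausdorff_weight s (U j) < (e / (2 ^ k.+1)%:R)%:E].
  by move=> k; exact: hausdorff_measure0_cover.
apply: (@le_trans _ _ (\esum_(p in [set: nat * nat])
    hausdorff_weight s (U p.1 p.2))).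
  apply: premeasure_le_cover; last by move=> [k j] _; have [_ /(_ j)] := HU k.
  move=> x /AB[k _]; have [BU _ _] := HU k => /BU[j _ Ux].
  by exists (k, j).
have -> : [set: nat * nat] = [set: nat] `*`` (fun=> [set: nat]).
  by apply/seteqP; split => // -[].
rewrite -(@esum_esum _ _ _ _ _ (fun k j => hausdorff_weight s (U k j)));
  last by move=> *; exact: hausdorff_weight_ge0.
apply: (@le_trans _ _ (\esum_(k in [set: nat]) (e / (2 ^ k.+1)%:R)%:E)).
  apply: le_esum => k _; have [_ _ /ltW] := HU k.
  by rewrite nneseries_esumT// => j; exact: hausdorff_weight_ge0.
rewrite -nneseries_esumT; last by move=> k; rewrite lee_fin ltW.
have := @epsilon_trick R (fun=> 0) e xpredT (fun=> lexx _) (ltW e0).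
rewrite [X in _ <= X + _]eseries0// add0e; apply: le_trans.
by under [leRHS]eq_eseriesr do rewrite add0e.
Qed.

Lemma hausdorff_measure0_sub s A B : A `<=` B ->
  hausdorff_measure s B = 0 -> hausdorff_measure s A = 0.
Proof.
move=> AB B0; apply: (@hausdorff_measure0_bigcup s A (fun=> B)) => //.
by move=> x /AB; exists 0%N.
Qed.

Lemma diam_translate U c : diam [set (x + c)%R | x in U] = diam U.
Proof.
rewrite /diam; congr ereal_sup; apply/seteqP; split => y.
  move=> [_ [a Ua <-] [_ [b Ub <-] <-]]; exists a => //; exists b => //.
  by congr (`| _ |%:E)%R; ring.
move=> [a Ua [b Ub <-]]; exists (a + c)%R; first by exists a.
exists (b + c)%R; first by exists b.
by congr (`| _ |%:E)%R; ring.
Qed.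

Lemma hausdorff_measure0_translate s A c : hausdorff_measure s A = 0 ->
  hausdorff_measure s [set (x + c)%R | x in A] = 0.
Proof.
move=> A0; apply: hausdorff_measure_eq0 => d e d0 e0.
have [U [AU Ud Ue]] := hausdorff_measure0_cover A0 d0 e0.
apply: (le_trans _ (ltW Ue)).
apply: ereal_inf_lbound; exists (fun k => [set (x + c)%R | x in U k]).
  split; last by move=> k; rewrite diam_translate.
  by move=> _ [x /AU[k _ Ux] <-]; exists k => //; exists x.
apply: eq_eseriesr => k _; rewrite /hausdorff_weight diam_translate.
rewrite (_ : (_ == set0) = (U k == set0))//; apply/eqP/eqP => [Uc|->].
  apply/seteqP; split => // x Ux.
  by have : (set0 : set R) (x + c)%R by rewrite -Uc; exists x.
by rewrite image_set0.
Qed.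

Lemma dimH_ge0 A : 0 <= dimH A.
Proof. by apply: le_ereal_inf_tmp => _ [s [s0 _] <-]; rewrite lee_fin. Qed.

Lemma hausdorff_measure_set0 s : hausdorff_measure s (@set0 R) = 0.
Proof.
apply: hausdorff_measure_eq0 => d e d0 e0.
apply: (@le_trans _ _ 0); last by rewrite lee_fin ltW.
apply: ereal_inf_lbound; exists (fun=> set0); last first.
  by apply: eseries0 => k _ _; exact: hausdorff_weight0.
by split => // k; rewrite diam_set0 leNye.
Qed.

Lemma dimH_set0 : dimH (@set0 R) = 0.
Proof.
apply/eqP; rewrite eq_le dimH_ge0 andbT; apply: ereal_inf_lbound.
by exists 0%R => //; split => //; exact: hausdorff_measure_set0.
Qed.

(** At exponent 0 every non-empty set weighs 1, so a cover of total weight below 1 consists of empty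
    sets. *)
Lemma hausdorff_measure_dim0 A : hausdorff_measure 0 A = 0 -> A = set0.
Proof.
move=> /hausdorff_measure0_cover /(_ ltr01 ltr01)[U [AU _ U1]].
apply/seteqP; split => // x /AU[k _ Ux].
have : hausdorff_weight 0 (U k) <= \sum_(0 <= k <oo) hausdorff_weight 0 (U k).
  rewrite nneseries_esumT; last by move=> j; exact: hausdorff_weight_ge0.
  apply: le_trans (sum_le_esum (s := [:: k]) _ _ _) => //.
  by rewrite big_seq1.
rewrite leNgt /hausdorff_weight ifF; last by apply/negbTE/set0P; exists x.
by rewrite poweRe0 U1.
Qed.

(** Countable stability and translation invariance combined; this is what allows the integer part of
    a point to be forgotten. *)
Lemma dimH_le_translates A B : A `<=` \bigcup_(k in [set: int]) [set (x + k%:~R)%R | x in B] ->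
  dimH A <= dimH B.
Proof.
move=> AB; apply: le_ereal_inf_tmp => _ [s [s0 B0] <-].
apply: ereal_inf_lbound; exists s => //; split => //.
apply: (@hausdorff_measure0_bigcup s A
  (fun n => if pickle_inv n is Some k then [set (x + (k : int)%:~R)%R | x in B] else set0)).
  by move=> x /AB[k _ Bk]; exists (pickle k); rewrite ?pickleK_inv.
move=> n; case: pickle_inv => [k|]; first exact: hausdorff_measure0_translate.
apply: (@hausdorff_measure0_sub s _ B) => //; exact: sub0set.
Qed.

(** The null exponent [s'] may be smaller than the given [s]; this freedom lets an upper bound avoid
    one bad exponent. *)
Lemma dimH_le A (t : \bar R) :
  (forall s, t < s%:E -> exists2 s', (0 <= s' <= s)%R & hausdorff_measure s' A = 0) ->
  dimH A <= t.
Proof.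
move=> h; rewrite leNgt; apply/negP => tA.
have [s ts sA] := ereal_between tA.
have [s' /andP[s'0 s's] A0] := h _ ts.
have : dimH A <= s'%:E by apply: ereal_inf_lbound; exists s'.
by rewrite leNgt (le_lt_trans _ sA)// lee_fin.
Qed.

(** Exponents below [s] suffice, which leaves room for the losses in the construction of subsets.
    Exponent 0 could be null only for the empty set, and the hypothesis excludes that too. *)
Lemma dimH_ge A (t : \bar R) :
  (forall s, (0 < s)%R -> s%:E < t ->
    forall s', (0 < s' < s)%R -> hausdorff_measure s' A != 0) ->
  t <= dimH A.
Proof.
move=> h; apply: le_ereal_inf_tmp => _ [s' [s'0 A0] <-].
rewrite leNgt; apply/negP => st.
have [s ss' sA] := ereal_between st; rewrite lte_fin in ss'.
have s0 := le_lt_trans s'0 ss'.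
move: s'0; rewrite le_eqVlt => /predU1P[e|s'0]; last first.
  by have := h s s0 sA s'; rewrite s'0 ss' A0 eqxx => /(_ isT).
have Ae : A = set0 by apply: hausdorff_measure_dim0; rewrite e.
have := h s s0 sA (s / 2)%R; rewrite Ae hausdorff_measure_set0 eqxx.
have -> : (0 < s / 2 < s)%R by apply/andP; split; lra.
by move=> /(_ isT).
Qed.

Lemma diam_le U (c : R) :
  (forall x y, U x -> U y -> `|x - y| <= c)%R -> diam U <= c%:E.
Proof.
by move=> h; apply: ge_ereal_sup => _ [x Ux [y Uy <-]]; rewrite lee_fin h.
Qed.

(** A form of the mass distribution principle. A cover of [A] pulled back along [T] is contained in
    intervals of length at most [2 C diam ^ s], which cover the unit interval; so no cover by sets
    of diameter at most 1 weighs less than [1 / (2 C)]. Enlarging the preimages to intervals removes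
    any question of measurability of [T]. *)
Lemma holder_inverse_hausdorff (T : R -> R) A s (C : R) : (0 < s)%R ->
  (forall t, (0 <= t < 1)%R -> A (T t)) ->
  (forall t t', (0 <= t < 1)%R -> (0 <= t' < 1)%R ->
    (`|t - t'| <= C * `|T t - T t'| `^ s)%R) ->
  hausdorff_measure s A != 0.
Proof.
move=> s0 TA TC; apply/eqP => A0.
have C0 : (0 < C)%R.
  have : (`|0 - 2^-1| <= C * `|T 0 - T 2^-1| `^ s :> R)%R by apply: TC; lra.
  rewrite ltNge; move=> h; apply/negP => C0.
  have : (C * `|T 0 - T 2^-1| `^ s <= 0)%R by rewrite mulr_le0_ge0// powR_ge0.
  have : (0 < `|0 - 2^-1| :> R)%R by rewrite sub0r normrN gtr0_norm.
  lra.
have Ci : (0 < (2 * C)^-1)%R by rewrite invr_gt0 mulr_gt0.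
have [U [AU Ud Ue]] := hausdorff_measure0_cover A0 ltr01 Ci.
pose V k := [set t : R | (0 <= t < 1)%R /\ U k (T t)].
have /choice[B HB] : forall k, exists B : interval R, V k `<=` [set` B] /\
    lebesgue_measure [set` B] <= (2 * C)%:E * hausdorff_weight s (U k).
  move=> k; have [[t [t01 Ut]]|V0] := pselect (exists t, V k t); last first.
    exists `]0%R, 0%R[; split; first by move=> t Vt; case: V0; exists t.
    rewrite lebesgue_measure_itv/= ltxx mule_ge0 ?hausdorff_weight_ge0//.
    by rewrite lee_fin; lra.
  have U0 : U k !=set0 by exists (T t).
  have dfin : diam (U k) \is a fin_num.
    by rewrite ge0_fin_numE ?diam_ge0// (le_lt_trans (Ud k)) ?ltry.
  pose r := (C * fine (diam (U k)) `^ s)%R.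
  exists `[(t - r)%R, (t + r)%R]; split.
    move=> t' [t'01 Ut'] /=; rewrite in_itv/=.
    have : (`|t - t'| <= r)%R.
      apply: (le_trans (TC _ _ t01 t'01)); rewrite /r ler_pM2l// ge0_ler_powR//.
      - exact: ltW.
      - by rewrite nnegrE fine_ge0// diam_ge0.
      - rewrite -lee_fin fineK//; apply: ereal_sup_ubound; exists (T t) => //.
        by exists (T t').
    by rewrite ler_norml => /andP[h1 h2]; apply/andP; split; lra.
  have r0 : (0 <= r)%R by rewrite mulr_ge0 ?powR_ge0// ltW.
  have -> : hausdorff_weight s (U k) = (fine (diam (U k)) `^ s)%:E.
    by rewrite /hausdorff_weight ifF -?poweR_EFin ?fineK//; apply/negbTE/set0P.
  rewrite lebesgue_measure_itv/=; case: ifP => _; last first.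
    by rewrite -EFinM lee_fin mulr_ge0 ?powR_ge0//; lra.
  by rewrite -EFinB -EFinM lee_fin /r; lra.
have : lebesgue_measure (`[0%R, 1%R[%classic : set R) <=
    \sum_(0 <= k <oo) lebesgue_measure [set` B k].
  apply: measure_sigma_subadditive => //.
  move=> t /=; rewrite in_itv/= => t01; have [k _ Uk] := AU _ (TA _ t01).
  by exists k => //; have [VB _] := HB k; apply: VB.
rewrite lebesgue_measure_itv/= lte_fin ltr01 oppr0 adde0 leNgt => /negP; apply.
apply: (@le_lt_trans _ _ ((2 * C)%:E * \sum_(0 <= k <oo) hausdorff_weight s (U k))).
  rewrite -nneseriesZl; last first.
    by move=> k _; exact: hausdorff_weight_ge0.
  by apply: lee_nneseries => // k _; have [_] := HB k.
rewrite (_ : 1 = (2 * C)%:E * (2 * C)^-1%:E); last first.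
  by rewrite -EFinM divff//; lra.
by rewrite lte_pmul2l// lte_fin mulr_gt0.
Qed.

End Hausdorff.

(** * Weighted words *)

Section Sums.
Context {R : realType}.

Lemma geometric_sum_le (q : R) (N : nat) : 0 < q < 1 ->
  \sum_(0 <= n < N) q ^+ n <= (1 - q)^-1.
Proof.
move=> /andP[q0 q1]; have h : 0 < 1 - q by rewrite subr_gt0.
rewrite -[leRHS]mul1r ler_pdivlMr//.
suff -> : (\sum_(0 <= n < N) q ^+ n) * (1 - q) = 1 - q ^+ N.
  by rewrite gerBl exprn_ge0// ltW.
elim: N => [|N IH]; first by rewrite big_nil mul0r expr0 subrr.
by rewrite big_nat_recr//= mulrDl IH exprS; ring.
Qed.

Lemma esum_geometric_lty (C q : R) : 0 < q < 1 -> 0 <= C ->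
  (\esum_(n in [set: nat]) (C * q ^+ n)%:E < +oo)%E.
Proof.
move=> q01 C0; have [q0 _] := andP q01.
apply: (@le_lt_trans _ _ (C * (1 - q)^-1)%:E); last exact: ltry.
rewrite -nneseries_esumT; last by move=> n; rewrite lee_fin mulr_ge0// exprn_ge0// ltW.
apply: lime_le.
  by apply: is_cvg_nneseries => n _ _; rewrite lee_fin mulr_ge0// exprn_ge0// ltW.
apply: nearW => N; rewrite sumEFin lee_fin -mulr_sumr ler_wpM2l//.
exact: geometric_sum_le.
Qed.

Lemma esum_fiber (T : choiceType) (X : set T) (lev : T -> nat) (a : T -> \bar R) :
  (forall x, X x -> (0 <= a x)%E) ->
  \esum_(x in X) a x =
  \esum_(n in [set: nat]) \esum_(x in X `&` [set x | lev x = n]) a x.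
Proof.
move=> a0.
rewrite (@esum_esum R nat T setT (fun n => X `&` [set x | lev x = n]) (fun=> a));
  last by move=> n x _ [/a0].
rewrite (reindex_esum X _ (fun x => (lev x, x)))//; split => /=.
- by move=> x Xx.
- by move=> x y _ _ [].
- by move=> [n x] /= [_ [Xx <-]]; exists x.
Qed.

Lemma esum_lty_geometric (T : choiceType) (X : set T) (lev : T -> nat)
    (a : T -> \bar R) (C q : R) (N : nat) :
  (forall x, X x -> (0 <= a x)%E) ->
  0 < q < 1 -> 0 <= C ->
  (forall n, (\esum_(x in X `&` [set x | lev x = n]) a x < +oo)%E) ->
  (forall n, (N <= n)%N ->
    (\esum_(x in X `&` [set x | lev x = n]) a x <= (C * q ^+ n)%:E)%E) ->
  (\esum_(x in X) a x < +oo)%E.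
Proof.
move=> a0 q01 C0 fin geo; have [q0 _] := andP q01.
rewrite (esum_fiber lev a0).
set u := (F in \esum_(n in _) F n).
have u0 n : (0 <= u n)%E by apply: esum_ge0 => x [/a0].
have low M : (\esum_(n in [set n | (n < M)%N]) u n < +oo)%E.
  elim: M => [|M IH].
    by rewrite (_ : [set _ | _] = set0) ?esum_set0//; apply/seteqP; split.
  apply: (@le_lt_trans _ _ (\esum_(n in [set n | (n < M)%N]) u n + \esum_(n in [set M]) u n)%E).
    apply: esum_setU_le => // n /=; rewrite ltnS leq_eqVlt => /orP[/eqP|]; by [right|left].
  by rewrite lte_add_pinfty// esum_set1// fin.
apply: (@le_lt_trans _ _ (\esum_(n in [set n | (n < N)%N]) u n +
    \esum_(n in [set n | (N <= n)%N]) u n)%E).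
  by apply: esum_setU_le => // n _ /=; case: ltnP => ?; [left|right].
apply: lte_add_pinfty => //.
apply: (le_lt_trans _ (esum_geometric_lty q01 C0)).
apply: (@le_trans _ _ (\esum_(n in [set n | (N <= n)%N]) (C * q ^+ n)%:E)).
  by apply: le_esum => n; exact: geo.
exact: esum_le_subset.
Qed.

(** A finite set carries all but [e] of the sum, and beyond its largest level only the remainder is
    left. *)
Lemma esum_lty_tail (T : choiceType) (X : set T) (lev : T -> nat)
    (a : T -> \bar R) (e : R) :
  (forall x, (0 <= a x)%E) -> (\esum_(x in X) a x < +oo)%E -> 0 < e ->
  exists N : nat, (\esum_(x in X `&` [set x | (N <= lev x)%N]) a x <= e%:E)%E.
Proof.
move=> a0 Xfin e0.
have Z0 : (0 <= \esum_(x in X) a x)%E by apply: esum_ge0.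
have Zf : \esum_(x in X) a x \is a fin_num by rewrite ge0_fin_numE.
have : (\esum_(x in X) a x - e%:E < \esum_(x in X) a x)%E.
  by rewrite lteBlDr// lteDl// lte_fin.
move=> /esum_gt[s [us sX hs]].
exists (\max_(x <- s) lev x).+1.
set Y := X `&` _.
have sp : (\sum_(x <- s) a x + \esum_(x in Y) a x <= \esum_(x in X) a x)%E.
  rewrite [leRHS](esumID [set` s])//; apply: leeD.
    by apply: sum_le_esum => // x xs; split => //; exact: sX.
  apply: esum_le_subset => x [Xx /= hx]; split => // xs.
  by have := @leq_bigmax_seq _ s xpredT lev x xs isT; rewrite leqNgt hx.
have Yf : \esum_(x in Y) a x \is a fin_num.
  rewrite ge0_fin_numE ?esum_ge0//; apply: le_lt_trans Xfin.
  by apply: esum_le_subset => x [].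
rewrite -(fineK Yf) -(fineK Zf) in sp hs *.
have sf : (\sum_(x <- s) a x)%E \is a fin_num.
  rewrite ge0_fin_numE ?sume_ge0//; apply: le_lt_trans Xfin.
  exact: sum_le_esum.
rewrite -(fineK sf) in sp hs *.
rewrite -EFinD lee_fin in sp; rewrite -EFinB lte_fin in hs; rewrite lee_fin.
lra.
Qed.

End Sums.

Lemma cat_injl (T : eqType) (v : seq T) : injective (cat^~ v).
Proof.
move=> w w' h.
have sz : size w = size w' by have := congr1 size h; rewrite !size_cat => /addIn.
by move/eqP: h; rewrite eqseq_cat// => /andP[/eqP].
Qed.

(** * Abstract weights on words and one-sided sums *)

Section Symbolic.
Context {R : realType} (Ix : set nat) (b : seq nat -> R) (K lam : R)
  (S : seq nat -> int).

Definition words : set (seq nat) := [set w : seq nat | forall i : nat, i \in w -> Ix i].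

Lemma words_cat w v : words w -> words v -> words (w ++ v).
Proof. by move=> hw hv i; rewrite mem_cat => /orP[/hw|/hv]. Qed.

Lemma words_catl w v : words (w ++ v) -> words w.
Proof. by move=> h i iw; apply: h; rewrite mem_cat iw. Qed.

Lemma words_catr w v : words (w ++ v) -> words v.
Proof. by move=> h i iv; apply: h; rewrite mem_cat iv orbT. Qed.

Hypothesis K0 : 0 < K.
Hypothesis lam1 : 1 < lam.
Hypothesis b0 : forall w, words w -> 0 < b w.
Hypothesis blam : forall w, words w -> b w <= lam ^- size w.
Hypothesis bcat_ge : forall w v, words w -> words v -> b w * b v <= K * b (w ++ v).

Definition wsum (X : set (seq nat)) (s : R) : \bar R :=
  \esum_(w in X) (b w `^ s)%:E.

Lemma wsum_ge0 X s : (0 <= wsum X s)%E.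
Proof. by apply: esum_ge0 => w _; rewrite lee_fin powR_ge0. Qed.

Lemma wsum_subset X Y s : X `<=` Y -> (wsum X s <= wsum Y s)%E.
Proof. exact: esum_le_subset. Qed.

Lemma lam0 : 0 < lam. Proof. exact: lt_trans lam1. Qed.

Lemma b_le1 w : words w -> b w <= 1.
Proof.
move=> /blam /le_trans; apply; rewrite invf_le1 ?exprn_gt0 ?lam0//.
by rewrite exprn_ege1// ltW.
Qed.

Lemma wsum_antimono X s t : X `<=` words -> s <= t ->
  (wsum X t <= wsum X s)%E.
Proof.
move=> Xw st; apply: le_esum => w /Xw ww; rewrite lee_fin.
by rewrite ger_powR// b0//= b_le1.
Qed.

(** Each letter brings a factor at most [1 / lam], so raising the exponent gains exponentially in
    the length. Every exponential gain traded against a loss below comes from here. *)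
Lemma b_powR_drop w s t : words w -> s <= t ->
  b w `^ t <= (lam `^ (s - t)) ^+ size w * b w `^ s.
Proof.
move=> ww st; have bw := b0 ww.
rewrite -[X in b w `^ X <= _](subrK s) [leLHS]powRD; last by apply/implyP => _; exact: lt0r_neq0.
rewrite ler_wpM2r ?powR_ge0//.
have -> : (lam `^ (s - t)) ^+ size w = (lam ^- size w) `^ (t - s).
  rewrite -powR_mulrn ?powR_ge0// -powRrM -powR_invn ?ltW ?lam0//.
  by rewrite -powRrM; congr (_ `^ _); ring.
rewrite ge0_ler_powR ?subr_ge0 ?nnegrE ?blam//; first exact: ltW.
by rewrite invr_ge0 exprn_ge0// ltW// lam0.
Qed.

Lemma lam_powR_lt1 s t : s < t -> 0 < lam `^ (s - t) < 1.
Proof.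
move=> st; rewrite powR_gt0 ?lam0//= -(opprB t s) powRN invf_lt1 ?powR_gt0 ?lam0//.
have : 1 `^ (t - s) < lam `^ (t - s).
  by rewrite gt0_ltr_powR ?subr_gt0 ?nnegrE// ltW// lam0.
by rewrite powR1.
Qed.

Lemma bcat_powR_ge w v s : 0 <= s -> words w -> words v ->
  b w `^ s * b v `^ s <= K `^ s * b (w ++ v) `^ s.
Proof.
move=> s0 ww wv; have wwv := words_cat ww wv.
rewrite -!powRM ?(ltW (b0 _))//; last exact: ltW.
rewrite ge0_ler_powR ?nnegrE ?bcat_ge//; first by rewrite mulr_ge0// ltW// b0.
by rewrite mulr_ge0// ltW// b0.
Qed.

Lemma words_const i n : Ix i -> words (nseq n i).
Proof. by move=> Ii j; rewrite mem_nseq => /andP[_ /eqP ->]. Qed.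

Lemma b_nseq_ge i n : Ix i -> (b [:: i] / K) ^+ n * b [::] <= b (nseq n i).
Proof.
have i1 : Ix i -> words [:: i] by move=> Ii j; rewrite inE => /eqP ->.
have w0 : words [::] by [].
move=> Ii; elim: n => [|n IH]; first by rewrite expr0 mul1r.
have h := bcat_ge (i1 Ii) (words_const (n := n) Ii).
rewrite exprS -mulrA; apply: (le_trans (ler_wpM2l _ IH)).
  by rewrite divr_ge0 ?(ltW K0)// ltW// b0//; exact: i1.
by rewrite mulrAC ler_pdivrMr// [leRHS]mulrC.
Qed.

Lemma wsum_cat_le X Y v s : 0 <= s -> words v -> X `<=` words ->
  (forall w, X w -> Y (w ++ v)) ->
  (wsum X s <= ((K / b v) `^ s)%:E * wsum Y s)%E.
Proof.
move=> s0 wv Xw XY; have bv := b0 wv.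
apply: (esum_le_inj (f := cat^~ v)) => //.
- exact: powR_ge0.
- by move=> w w' _ _; exact: cat_injl.
- move=> w Xw'; rewrite -EFinM lee_fin powRM ?invr_ge0 ?(ltW K0) ?(ltW bv)//.
  rewrite -powR_inv1 ?(ltW bv)// -powRrM mulN1r powRN mulrAC.
  by rewrite ler_pdivlMr ?powR_gt0// bcat_powR_ge//; exact: Xw.
- by move=> w _; rewrite lee_fin powR_ge0.
Qed.

Section Drift.
Hypothesis Scat : forall w v, S (w ++ v) = S w + S v.
Hypothesis Sgen : forall r : int, exists2 v, words v & S v = r.

Let level j : set (seq nat) := words `&` [set w | S w = j].

Let band (L : nat) : set (seq nat) :=
  words `&` [set w | (- L%:Z <= S w <= 0)%R].

(** A fixed word of step [- j] brings all words of level [j] to level 0 at a bounded cost. The cost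
    depends on [j], so nothing uniform in [j] follows. *)
Lemma wsum_level_lty s j : 0 <= s -> (wsum (level 0) s < +oo)%E ->
  (wsum (level j) s < +oo)%E.
Proof.
move=> s0 fin0; have [v wv Sv] := Sgen (- j).
apply: (@le_lt_trans _ _ (((K / b v) `^ s)%:E * wsum (level 0) s)%E).
  apply: wsum_cat_le => //; first by move=> w [].
  by move=> w [ww Sw]; split; [exact: words_cat|rewrite /= Scat Sv Sw subrr].
by rewrite lte_mul_pinfty// lee_fin powR_ge0.
Qed.

Lemma wsum_band_lty s (L : nat) : 0 <= s -> (wsum (level 0) s < +oo)%E ->
  (wsum (band L) s < +oo)%E.
Proof.
move=> s0 fin0; elim: L => [|L IH].
  apply: le_lt_trans fin0; apply: wsum_subset => w [ww /= Sw]; split => //=.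
  by apply/eqP; rewrite eq_le andbC -[X in X <= _]oppr0.
apply: (@le_lt_trans _ _ (wsum (band L) s +
    wsum (level (- L.+1%:Z)%R) s)%E); last first.
  by rewrite lte_add_pinfty// wsum_level_lty.
apply: esum_setU_le => [w [ww /= Sw]|w]; last by rewrite lee_fin powR_ge0.
have [e|ne] := eqVneq (S w) (- L.+1%:Z); [by right|left; split => //=].
by lia.
Qed.

(* Appending words of [W] to the words of low level maps them injectively into
   the band, so a large total weight of [W] forces the low levels to carry at
   most half of the weight of the band. *)
Lemma wsum_nonpos_lty s n (W : seq (seq nat)) : 0 <= s ->
  (wsum (level 0) s < +oo)%E -> uniq W ->
  (forall w, w \in W -> [/\ words w, size w = n & 1 <= S w]) ->
  2 * K `^ s <= \sum_(w <- W) b w `^ s ->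
  (wsum (words `&` [set w | (S w <= 0)%R]) s < +oo)%E.
Proof.
move=> s0 fin0 uW WP WK.
have [M HM] : exists M : nat, forall w, w \in W -> S w <= M%:Z.
  exists (\max_(w <- W) `|S w|%N) => w wW.
  have /= := @leq_bigmax_seq _ W xpredT (fun w => `|S w|%N) w wW isT.
  move: (\max_(w <- W) _)%N => m.
  by lia.
pose T L := wsum (band L) s.
have Tfin L : T L \is a fin_num by rewrite ge0_fin_numE ?wsum_ge0// wsum_band_lty.
have Kp : 0 < K `^ s by rewrite powR_gt0.
(* With [A] the weight of the steps in [[-L, -M]], [T L <= A + T M] and [2 A <= T L]. As [T L] is
   finite, half of it can be absorbed, and the resulting bound does not depend on [L]. *)
have TM L : (T L <= 2%:E * T M)%E.
  pose A := words `&` [set w | - L%:Z <= S w <= - M%:Z].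
  have AT : (T L <= wsum A s + T M)%E.
    apply: esum_setU_le => [w [ww /= Sw]|w]; last by rewrite lee_fin powR_ge0.
    by have [h|h] := leP (S w) (- M%:Z); [left|right]; split => //=; lia.
  have AL : (2%:E * wsum A s <= T L)%E.
    have step1 : (wsum A s <= ((2 * K `^ s)^-1)%:E *
        \esum_(w in A) \esum_(v in [set` W]) (b w `^ s * b v `^ s)%:E)%E.
      apply: (esum_le_inj (f := id)) => //.
      - by rewrite invr_ge0 mulr_ge0// ltW.
      - move=> w Aw; rewrite esum_fset; last 2 first.
        - exact: finite_seq.
        - by move=> v _; rewrite lee_fin mulr_ge0 ?powR_ge0.
        rewrite -fsbig_seq// sumEFin -EFinM lee_fin -mulr_sumr.
        rewrite mulrC -mulrA ler_peMr ?powR_ge0// ler_pdivlMr ?mulr_gt0// mul1r.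
        exact: WK.
      - by move=> w _; apply: esum_ge0 => v _; rewrite lee_fin mulr_ge0 ?powR_ge0.
    have step2 : (\esum_(w in A) \esum_(v in [set` W]) (b w `^ s * b v `^ s)%:E <=
        (K `^ s)%:E * T L)%E.
      rewrite (esum_esum (J := fun=> [set` W]) (a := fun w v => (b w `^ s * b v `^ s)%:E));
        last by move=> w v _ _; rewrite lee_fin mulr_ge0 ?powR_ge0.
      apply: (esum_le_inj (f := fun p => p.1 ++ p.2)) => //.
      - exact: ltW.
      (* The words of [W] share one length, so a concatenation determines where to cut it. *)
      - move=> [w v] [w' v'] /set_mem[/= _ /WP[_ vn _]] /set_mem[/= _ /WP[_ vn' _]] /eqP.
        have [ww'|] := eqVneq (size w) (size w'); first by rewrite eqseq_cat// => /andP[/eqP -> /eqP ->].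
        by move=> sz /eqP /(congr1 size); rewrite !size_cat vn vn' => /addIn /eqP; rewrite (negPf sz).
      - move=> [w v] [/= [ww /= Sw] /= vW]; have [wv vn Sv] := WP _ vW; have := HM _ vW.
        split; first exact: words_cat.
        by rewrite /= Scat; lia.
      - move=> [w v] [/= [ww /= Sw] /= vW]; have [wv vn Sv] := WP _ vW.
        by rewrite -EFinM lee_fin bcat_powR_ge.
      - by move=> w _; rewrite lee_fin powR_ge0.
    have Af : wsum A s \is a fin_num.
      rewrite ge0_fin_numE ?wsum_ge0//; apply: le_lt_trans (wsum_band_lty L s0 fin0).
      by apply: wsum_subset => w [ww /= ?]; split => //=; lia.
    have := le_trans step1 (lee_wpmul2l _ step2).
    rewrite lee_fin invr_ge0 mulr_ge0 ?(ltW Kp)// => /(_ isT).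
    rewrite -(fineK Af) -(fineK (Tfin L)) -!EFinM !lee_fin mulrA invfM mulrVK ?unitfE ?gt_eqF//.
    by rewrite mulrC ler_pdivlMr// mulrC.
  have Af : wsum A s \is a fin_num.
    rewrite ge0_fin_numE ?wsum_ge0//; apply: le_lt_trans (wsum_band_lty L s0 fin0).
    by apply: wsum_subset => w [ww /= ?]; split => //=; lia.
  move: AT AL; rewrite -(fineK Af) -(fineK (Tfin L)) -(fineK (Tfin M)).
  by rewrite -!EFinM -EFinD !lee_fin; lra.
apply: (@le_lt_trans _ _ (2%:E * T M)%E); last first.
  by rewrite lte_mul_pinfty// ?lee_fin// wsum_band_lty.
apply: le_esum_sup => F uF FP.
pose L := (\max_(w <- F) `|S w|)%N.
apply: (le_trans _ (TM L)); apply: sum_le_esum => // w wF.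
have [ww /= Sw] := FP _ wF; split => //=.
have /= := @leq_bigmax_seq _ F xpredT (fun w => `|S w|%N) w wF isT.
by rewrite -/L; lia.
Qed.

End Drift.
End Symbolic.

(** * Thresholds for weights, covers by words *)

Section Thresholds.
Context {R : realType}.

Lemma expr_unbounded (lam x : R) : 1 < lam -> exists N : nat, x <= lam ^+ N.
Proof.
move=> lam1.
have bern N : 1 + N%:R * (lam - 1) <= lam ^+ N.
  elim: N => [|N IH]; first by rewrite mul0r addr0 expr0.
  rewrite exprS; apply: (@le_trans _ _ (lam * (1 + N%:R * (lam - 1)))).
    have : 0 <= N%:R * (lam - 1) ^+ 2 by rewrite mulr_ge0// sqr_ge0.
    by rewrite -natr1; nra.
  by rewrite ler_wpM2l// ltW// (lt_trans ltr01).
have h : 0 < lam - 1 by rewrite subr_gt0.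
have [N HN] : exists N : nat, x / (lam - 1) <= N%:R.
  have := archi_boundP (normr_ge0 (x / (lam - 1))).
  by exists (Num.bound `|x / (lam - 1)|); apply: ltW; apply: le_lt_trans (ler_norm _) _.
exists N; apply: le_trans (bern N); rewrite ler_pdivrMr// in HN; lra.
Qed.

Lemma dyadic_scale (x : R) : 0 < x <= 1 ->
  exists l : nat, 2^-1 ^+ l <= x /\ x <= 2 * 2^-1 ^+ l.
Proof.
move=> /andP[x0 x1].
have [N HN] := expr_unbounded x^-1 (ltr1n R 2).
have ex : exists l : nat, 2^-1 ^+ l <= x.
  by exists N; rewrite exprVn invf_ple ?posrE// exprn_gt0.
case: (ex_minnP ex) => -[|l] hl mn.
  by exists 0%N; rewrite expr0 in hl *; split => //; lra.
exists l.+1; split => //; rewrite exprS mulrA divff// mul1r.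
have [h|/ltW//] := leP (2^-1 ^+ l) x.
by have := mn l h; rewrite ltnn.
Qed.

(** Dyadic summation: at scale [2 ^- l] the counting bound at [s'] leaves a geometric factor
    [2 ^- (l (s - s'))]. Read backwards, a large sum forces many words above one common threshold
    [r]. *)
Lemma sum_powR_le_count (T : eqType) (W : seq T) (b : T -> R) (s s' Lam : R) :
  0 <= s' -> s' < s -> (forall w, w \in W -> 0 < b w <= 1) ->
  (forall r, 0 < r <= 1 ->
    (count (fun w => r <= b w) W)%:R * r `^ s' <= Lam) ->
  \sum_(w <- W) b w `^ s <= 2 `^ s * Lam * (1 - 2^-1 `^ (s - s'))^-1.
Proof.
move=> s'0 s's bW cnt.
have s0 : 0 <= s by rewrite ltW// (le_lt_trans s'0).
have Lam0 : 0 <= Lam.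
  by apply: le_trans (cnt 1 _); rewrite ?ltr01 ?lexx// mulr_ge0// powR_ge0.
pose h (l : nat) : R := 2^-1 ^+ l.
have h01 l : 0 < h l <= 1.
  by rewrite exprn_gt0 ?invr_gt0//= exprn_ile1//; lra.
have [L HL] : exists L : nat, forall w, w \in W -> exists2 l, (l < L)%N & h l <= b w <= 2 * h l.
  elim: W bW {cnt} => [|w W IH] bW; first by exists 0%N.
  have [|L HL] := IH; first by move=> v vW; apply: bW; rewrite inE vW orbT.
  have [l [l1 l2]] := dyadic_scale (bW w (mem_head _ _)).
  exists (maxn L l.+1) => v; rewrite inE => /predU1P[->|/HL[l' l'L hl']].
    by exists l; rewrite ?leq_max ?leqnn ?orbT//; apply/andP.
  by exists l' => //; rewrite leq_max l'L.
have step : \sum_(w <- W) b w `^ s <= \sum_(w <- W) \sum_(0 <= l < L) (h l <= b w)%R%:R * (2 * h l) `^ s.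
  rewrite big_seq [leRHS]big_seq; apply: ler_sum => w wW.
  have [l lL /andP[l1 l2]] := HL w wW; have /andP[bw0 _] := bW w wW.
  rewrite (big_rem l) ?mem_index_iota//= l1 mul1r.
  rewrite -[leLHS]addr0 lerD//.
    by rewrite ge0_ler_powR// nnegrE ?ltW// mulr_gt0//; have /andP[] := h01 l.
  by apply: sumr_ge0 => i _; rewrite mulr_ge0 ?powR_ge0.
apply: (le_trans step); rewrite exchange_big/=.
have q01 : 0 < (2^-1 : R) `^ (s - s') < 1.
  rewrite powR_gt0 ?invr_gt0//= -powR_inv1// -powRrM mulN1r.
  rewrite -[ltRHS](powRr0 2) powRN powRr0 invf_lt1 ?powR_gt0//.
  have : 1 `^ (s - s') < (2 : R) `^ (s - s').
    by rewrite gt0_ltr_powR ?subr_gt0 ?nnegrE ?ltr1n.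
  by rewrite powR1.
apply: (le_trans _ (ler_wpM2l _ (geometric_sum_le L q01))); last first.
  by rewrite mulr_ge0 ?powR_ge0.
rewrite mulr_sumr; apply: ler_sum => l _.
rewrite -mulr_suml -(big_map (fun w => h l <= b w) xpredT (fun x : bool => x%:R)).
have -> : \sum_(j <- [seq h l <= b w | w <- W]) (j : bool)%:R =
    (count (fun w => h l <= b w) W)%:R :> R.
  by elim: W {bW cnt HL step} => [|w W IH]/=; rewrite ?big_nil// big_cons IH natrD.
have /andP[hl0 _] := h01 l.
rewrite powRM ?(ltW hl0)// -[leRHS]mulrA mulrCA ler_wpM2l ?powR_ge0//.
have -> : h l `^ s = h l `^ s' * (2^-1 `^ (s - s')) ^+ l.
  have -> : (2^-1 `^ (s - s')) ^+ l = h l `^ (s - s').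
    by rewrite -powR_mulrn ?powR_ge0// powRAC powR_mulrn// invr_ge0.
  rewrite -powRD; last by apply/implyP => _; exact: lt0r_neq0.
  by congr (_ `^ _); ring.
rewrite mulrA ler_wpM2r ?exprn_ge0 ?powR_ge0//.
exact: cnt.
Qed.

End Thresholds.

Section Covering.
Context {R : realType} (Ix : set nat) (b : seq nat -> R) (lam : R).
Hypothesis lam1 : 1 < lam.
Hypothesis b0 : forall w, words Ix w -> 0 < b w.
Hypothesis blam : forall w, words Ix w -> b w <= lam ^- size w.

(** A Borel-Cantelli argument: every point lies in pieces of arbitrarily long words, so each tail of
    the convergent sum is a cover. *)
Lemma wsum_lty_hausdorff0 (V : seq nat -> set R) (c : R) X A s :
  0 < s -> 0 < c -> X `<=` words Ix -> (wsum b X s < +oo)%E ->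
  (forall w, words Ix w -> (diam (V w) <= (c * b w)%:E)%E) ->
  (forall x, A x -> forall N, exists2 w, X w /\ (N <= size w)%N & V w x) ->
  hausdorff_measure s A = 0%E.
Proof.
move=> s0 c0 Xw Xfin dV AV; apply: hausdorff_measure_eq0 => d e d0 e0.
have lam0 : 0 < lam by exact: lt_trans lam1.
have [N1 HN1] := expr_unbounded (c / d) lam1.
have cs0 : 0 < c `^ s by rewrite powR_gt0.
have [N2 HN2] : exists N : nat, (\esum_(w in X `&` [set w | (N <= size w)%N]) (b w `^ s)%:E
    <= (e / c `^ s)%:E)%E.
  apply: (esum_lty_tail size) => //; first by move=> x; rewrite lee_fin powR_ge0.
  by rewrite divr_gt0.
(* [N1] makes the diameters smaller than [d], [N2] makes the total weight of the cover smaller than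
   [e]. *)
pose N := maxn N1 N2.
apply: (le_trans (premeasure_le_cover (X := X `&` [set w | (N <= size w)%N]) (V := V) s _ _)).
- by move=> x /AV /(_ N)[w [Xw' Nw] Vw]; exists w.
- move=> w [/Xw ww /= Nw]; apply: (le_trans (dV _ ww)); rewrite lee_fin.
  rewrite -ler_pdivlMl// mulrC; apply: (le_trans (blam ww)).
  rewrite invf_ple ?posrE ?exprn_gt0 ?divr_gt0// invfM invrK mulrC.
  apply: (le_trans HN1); rewrite ler_eXn2l//.
  by apply: leq_trans Nw; rewrite leq_maxl.
apply: (@le_trans _ _ ((c `^ s)%:E * (e / c `^ s)%:E)%E); last first.
  by rewrite -EFinM mulrC mulrVK// unitfE gt_eqF.
apply: (le_trans _ (lee_wpmul2l _ HN2)); last by rewrite lee_fin ltW.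
apply: (esum_le_inj (f := id)) => //.
- exact: ltW.
- by move=> w [Xw' /= /(leq_trans _) h]; split => //=; apply: h; rewrite leq_maxr.
- move=> w [/Xw ww _]; rewrite -EFinM -powRM ?(ltW c0) ?(ltW (b0 _))//.
  by apply: hausdorff_weight_le; [exact: ltW|exact: dV].
- by move=> w _; rewrite lee_fin powR_ge0.
Qed.

(** If every length carried at most [Lam] at the smaller exponent [s'], the larger exponent would
    gain a factor exponential in the length and the total sum would converge. *)
Lemma wsum_pinfty_level (X : set (seq nat)) s s' (Lam : R) : s' < s ->
  X `<=` words Ix -> ~ (wsum b X s < +oo)%E ->
  exists n, (Lam%:E < wsum b (X `&` [set w | size w = n]) s')%E.
Proof.
move=> s's Xw; apply: contra_notP => /forallNP nh.
have bound n : (wsum b (X `&` [set w | size w = n]) s' <= Lam%:E)%E.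
  by rewrite leNgt; apply/negP; exact: nh.
have Lam0 : 0 <= Lam by rewrite -lee_fin; apply: le_trans (bound 0%N); exact: wsum_ge0.
have q01 := lam_powR_lt1 lam1 s's.
have geo n : (wsum b (X `&` [set w | size w = n]) s <=
    (Lam * (lam `^ (s' - s)) ^+ n)%:E)%E.
  rewrite mulrC EFinM; apply: (le_trans _ (lee_wpmul2l _ (bound n))); last first.
    by rewrite lee_fin exprn_ge0// powR_ge0.
  apply: (esum_le_inj (f := id)) => //.
  - by rewrite exprn_ge0// powR_ge0.
  - move=> w [/Xw ww /= <-]; rewrite -EFinM lee_fin.
    exact: (b_powR_drop (Ix := Ix)) (ltW s's).
  - by move=> w _; rewrite lee_fin powR_ge0.
apply: (esum_lty_geometric (lev := size) (N := 0%N) _ q01 Lam0) => //.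
- by move=> w _; rewrite lee_fin powR_ge0.
- by move=> n; apply: le_lt_trans (geo n) _; exact: ltry.
- by move=> n _; exact: geo.
Qed.

End Covering.

(** * Branches and cylinders *)

Section Calculus.
Context {R : realType}.
Implicit Types (A : set R) (f g : R -> R).

Lemma is_derive_open_eq A f g x d : open A -> A x -> (forall y, A y -> f y = g y) ->
  is_derive x 1 g d -> is_derive x 1 f d.
Proof.
move=> oA Ax fg gd.
have near_fg : \near x, g x = f x.
  by apply: filterS (open_nbhs_nbhs (conj oA Ax)) => y Ay; rewrite fg.
have [gx <-] := gd; apply: DeriveDef.
  exact: near_eq_derivable near_fg gx.
by apply: near_eq_derive; apply: filterS near_fg => y ->.
Qed.

Lemma derive1_open_eq A f g x : open A -> A x -> (forall y, A y -> f y = g y) ->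
  derive1 f x = derive1 g x.
Proof.
move=> oA Ax fg; rewrite !derive1E; apply: near_eq_derive.
by apply: filterS (open_nbhs_nbhs (conj oA Ax)) => y Ay; rewrite fg.
Qed.

Lemma mvt_interval A f df x y : is_interval A ->
  (forall z, A z -> is_derive z 1 f (df z)) -> A x -> A y -> x <= y ->
  exists2 c, A c & f y - f x = df c * (y - x).
Proof.
move=> iA fd Ax Ay xy.
have zA z : z \in `[x, y] -> A z by rewrite in_itv/=; exact: iA.
have [||c cxy ->] := @MVT_segment R f df x y xy; last by exists c => //; exact: zA.
  by move=> z zxy; apply: fd; apply: zA; exact: subset_itv_oo_cc.
by apply: derivable_within_continuous => z /zA /fd /(@ex_derive _ _ _ _ _ _ _).
Qed.

Lemma ivt_interval A f x y v : is_interval A ->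
  (forall z, A z -> derivable f z 1) -> A x -> A y ->
  f x <= v <= f y -> exists2 c, A c & f c = v.
Proof.
move=> iA fd Ax Ay fv.
wlog xy : f x y v fd Ax Ay fv / x <= y.
  move=> H; have [xy|/ltW yx] := leP x y; first exact: (H f x y).
  have [||c Ac /oppr_inj fc] := H (\- f) y x (- v) _ Ay Ax _ yx; last by exists c.
  - by move=> z Az; apply: derivableN; exact: fd.
  - by move/andP: fv => [fx fy]; rewrite !lerN2 fx fy.
have zA z : z \in `[x, y] -> A z by rewrite in_itv/=; exact: iA.
have [||c cxy fc] := @IVT R f x y v xy; last by exists c => //; exact: zA.
  by apply: derivable_within_continuous => z /zA /fd.
move/andP: fv => [fx fy]; rewrite (min_idPl _) ?(max_idPr _) ?fx ?fy//;
  exact: le_trans fx fy.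
Qed.

End Calculus.

Section BaseConstants.
Context {R : realType} (I : set nat) (J : nat -> set R) (F0 : R -> R).
Hypothesis hF0 : base_map I J F0.

Lemma base_expansion_rate : exists2 lam : R, 1 < lam &
  forall x, base_domain I J x -> lam <= `|derive1 F0 x|.
Proof.
have /ereal_between[s s1 sF] := base_expanding hF0.
exists s; first by rewrite lte_fin in s1.
move=> x Dx; rewrite -lee_fin; apply: (le_trans (ltW sF)).
by apply: ereal_inf_lbound; exists x.
Qed.

Lemma base_adler_bound : exists2 B : R, 0 <= B &
  forall x, base_domain I J x -> `|derive1n 2 F0 x| <= B * derive1 F0 x ^+ 2.
Proof.
have /ereal_between[s s1 _] := base_adler hF0.
have [lam lam1 Hlam] := base_expansion_rate.
exists (Num.max s 0); first by rewrite le_max lexx orbT.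
move=> x Dx.
have dx : 0 < derive1 F0 x ^+ 2.
  by rewrite -[_ ^+ 2]ger0_norm ?sqr_ge0// normrX exprn_gt0// (lt_le_trans _ (Hlam _ Dx))// (lt_trans ltr01).
rewrite -ler_pdivrMr// le_max; apply/orP; left.
rewrite -lee_fin; apply: le_trans (ltW s1).
by apply: ereal_sup_ubound; exists x.
Qed.

End BaseConstants.

Section Geometry.
Context {R : realType} (I : set nat) (J : nat -> set R) (F0 : R -> R).
Variables (lam B : R).
Hypothesis hF0 : base_map I J F0.
Hypothesis lam1 : 1 < lam.
Hypothesis Hlam : forall x, base_domain I J x -> lam <= `|derive1 F0 x|.
Hypothesis B0 : 0 <= B.
Hypothesis HB : forall x, base_domain I J x ->
  `|derive1n 2 F0 x| <= B * derive1 F0 x ^+ 2.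

Lemma lam_gt0 : 0 < lam. Proof. exact: lt_trans lam1. Qed.

Lemma branch_open i : I i -> open (J i).
Proof. by move=> Ii; have [] := base_interval hF0 Ii. Qed.

Lemma branch_interval i : I i -> is_interval (J i).
Proof. by move=> Ii; have [] := base_interval hF0 Ii. Qed.

Lemma branch_sub01 i x : I i -> J i x -> 0 < x < 1.
Proof.
by move=> Ii Jx; have [_ _ _ /(_ x Jx)] := base_interval hF0 Ii; rewrite /= in_itv.
Qed.

Lemma branch_onto i x : I i -> J i x -> 0 < F0 x < 1.
Proof.
move=> Ii Jx; have : (F0 @` J i) (F0 x) by exists x.
by rewrite (base_full_branch hF0 Ii) /= in_itv.
Qed.

Lemma branch_surj i y : I i -> 0 < y < 1 -> exists2 x, J i x & F0 x = y.
Proof.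
move=> Ii y01; have : (F0 @` J i) y by rewrite (base_full_branch hF0 Ii) /= in_itv.
by move=> [x Jx <-]; exists x.
Qed.

Lemma branch_inj i j x : I i -> I j -> J i x -> J j x -> i = j.
Proof.
move=> Ii Ij Jix Jjx; apply: (base_disjoint hF0) => //.
by exists x.
Qed.

Lemma branch_dom i x : I i -> J i x -> base_domain I J x.
Proof. by move=> Ii Jx; exists i. Qed.

(** [derive1 F0] is taken of the total function [F0]; since the branch is open, [F0] agrees near [x]
    with its smooth extension. *)
Lemma branch_is_derive i x : I i -> J i x -> is_derive x 1 F0 (derive1 F0 x).
Proof.
move=> Ii Jx; have [U [g [oU JU Fg gd]]] := base_C2 hF0 Ii.
have Ux : U x by apply: JU; exact: subset_closure.
have Fg' y : J i y -> F0 y = g y by move=> Jy; rewrite Fg// inE.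
rewrite (derive1_open_eq (branch_open Ii) Jx Fg').
apply: (is_derive_open_eq (branch_open Ii) Jx Fg').
by have [dg _ _] := gd _ Ux; rewrite derive1E; exact: derivableP.
Qed.

Lemma branch_is_derive2 i x : I i -> J i x ->
  is_derive x 1 (derive1 F0) (derive1n 2 F0 x).
Proof.
move=> Ii Jx; have [U [g [oU JU Fg gd]]] := base_C2 hF0 Ii.
have Ux : U x by apply: JU; exact: subset_closure.
have Fg' y : J i y -> F0 y = g y by move=> Jy; rewrite Fg// inE.
have Fg2 y : J i y -> derive1 F0 y = derive1 g y.
  by move=> Jy; exact: (derive1_open_eq (branch_open Ii) Jy Fg').
rewrite /derive1n /= (derive1_open_eq (branch_open Ii) Jx Fg2).
apply: (is_derive_open_eq (branch_open Ii) Jx Fg2).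
by have [_ dg _] := gd _ Ux; rewrite derive1E; exact: derivableP.
Qed.

(** The derivative does not vanish on a branch and is itself differentiable there, so the
    intermediate value theorem fixes its sign. The factor [sg] treats both orientations at once. *)
Lemma branch_sign i : I i -> exists2 sg : R, sg = 1 \/ sg = -1 &
  forall x, J i x -> sg * derive1 F0 x = `|derive1 F0 x|.
Proof.
move=> Ii.
have nz x : J i x -> derive1 F0 x != 0.
  by move=> Jx; rewrite -normr_gt0 (lt_le_trans lam_gt0)// Hlam//; exact: branch_dom Jx.
have [[x0 [Jx0 Fx0]]|allpos] := pselect (exists x, J i x /\ derive1 F0 x < 0); last first.
  exists 1; [by left|move=> x Jx; rewrite mul1r ger0_norm// leNgt; apply/negP => h].
  by apply: allpos; exists x.
exists (-1); [by right|move=> x Jx; rewrite mulN1r ler0_norm// leNgt; apply/negP => h].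
have [z Jz||c Jc Fc] := ivt_interval (v := 0) (branch_interval Ii) _ Jx0 Jx (f := derive1 F0).
- by have [] := branch_is_derive2 Ii Jz.
- by rewrite (ltW Fx0) (ltW h).
- by have := nz c Jc; rewrite Fc eqxx.
Qed.

(* [ln |F0'| -+ B |F0|] is monotone on a branch, since [|F0''| <= B F0'^2]. *)
Lemma branch_distortion i x y : I i -> J i x -> J i y ->
  `|ln `|derive1 F0 x| - ln `|derive1 F0 y| | <= B * `|F0 x - F0 y|.
Proof.
move=> Ii; wlog xy : x y / x <= y.
  move=> H Jx Jy; have [xy|/ltW yx] := leP x y; first exact: H.
  by rewrite distrC (distrC (F0 x)); exact: H.
move=> Jx Jy; have [sg sg1 Hsg] := branch_sign Ii.
have pos z : J i z -> 0 < sg * derive1 F0 z.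
  by move=> Jz; rewrite Hsg// (lt_le_trans lam_gt0)// Hlam//; exact: branch_dom Jz.
have dln z : J i z -> is_derive z 1 (fun z => ln (sg * derive1 F0 z))
    (derive1n 2 F0 z / derive1 F0 z).
  move=> Jz; have Fz := branch_is_derive2 Ii Jz.
  have := is_derive1_ln (pos z Jz) => lnz.
  have scal : is_derive z 1 (fun z => sg * derive1 F0 z) (sg * derive1n 2 F0 z).
    by apply: is_deriveZ.
  have cmp : is_derive z 1 (fun z => ln (sg * derive1 F0 z))
      ((sg * derive1 F0 z)^-1 * (sg * derive1n 2 F0 z)) :=
    @is_derive1_comp R (@ln R) (fun z => sg * derive1 F0 z) z _ _ lnz scal.
  apply: (is_derive_eq cmp).
  have sg0 : sg != 0 by case: sg1 => ->; rewrite ?oppr_eq0 oner_eq0.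
  by rewrite invfM mulrACA mulrA mulVf// mul1r mulrC.
have bnd z : J i z -> `|derive1n 2 F0 z / derive1 F0 z| <= B * (sg * derive1 F0 z).
  move=> Jz; have Fz := pos z Jz; rewrite Hsg// in Fz *.
  rewrite normrM normfV ler_pdivrMr// -mulrA -expr2 -normrX.
  by rewrite (ger0_norm (sqr_ge0 _)); apply: HB; exact: branch_dom Jz.
have dF c z : J i z -> is_derive z 1 (fun z => ln (sg * derive1 F0 z) + c * (sg * F0 z))
    (derive1n 2 F0 z / derive1 F0 z + c * (sg * derive1 F0 z)).
  move=> Jz; have := branch_is_derive Ii Jz => Fz; have := dln z Jz => lnz.
  have s1 : is_derive z 1 (fun z => sg * F0 z) (sg * derive1 F0 z) by apply: is_deriveZ.
  have s2 : is_derive z 1 (fun z => c * (sg * F0 z)) (c * (sg * derive1 F0 z)) by apply: is_deriveZ.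
  exact: is_deriveD.
have iJ := branch_interval Ii.
have [c1 Jc1 E1] := mvt_interval iJ (dF B) Jx Jy xy.
have [c2 Jc2 E2] := mvt_interval iJ (dF (- B)) Jx Jy xy.
have [c3 Jc3 E3] := mvt_interval iJ (fun z Jz => branch_is_derive Ii Jz) Jx Jy xy.
have sF : 0 <= sg * (F0 y - F0 x).
  by rewrite E3 mulrA mulr_ge0 ?subr_ge0//; apply: ltW; exact: pos.
have <- : sg * (F0 y - F0 x) = `|F0 x - F0 y|.
  by rewrite -(ger0_norm sF) normrM distrC; case: sg1 => ->; rewrite ?normrN normr1 mul1r.
have lnE z : J i z -> ln `|derive1 F0 z| = ln (sg * derive1 F0 z) by move=> Jz; rewrite Hsg.
rewrite (lnE x Jx) (lnE y Jy).
have key1 (q p : R) : `|q| <= B * p -> 0 <= q + B * p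
  by rewrite ler_norml => /andP[h _]; rewrite addrC -lerBlDl sub0r.
have key2 (q p : R) : `|q| <= B * p -> q + - B * p <= 0
  by rewrite ler_norml => /andP[_ h]; rewrite mulNr subr_le0.
have k1 := mulr_ge0 (key1 _ _ (bnd c1 Jc1)) (etrans (subr_ge0 x y) xy).
have k2 := mulr_le0_ge0 (key2 _ _ (bnd c2 Jc2)) (etrans (subr_ge0 x y) xy).
rewrite -E1 /= in k1; rewrite -E2 /= in k2.
move: k1 k2 {E1 E2 E3}; move: (ln _) (ln _) (F0 x) (F0 y) => u v a c k1 k2.
rewrite ler_norml; lra.
Qed.

(** Cylinders are taken in the interval and not in the repeller: they are open intervals on which
    the iterate is monotone and onto []0, 1[], so mean value and intermediate value arguments
    apply. *)
Fixpoint cyl (w : seq nat) : set R :=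
  if w is i :: w' then J i `&` F0 @^-1` cyl w' else `]0, 1[%classic.

(** The chain-rule product, which splits algebraically along orbits; on a cylinder of length [n] it
    is the derivative of the iterate. *)
Definition deriv_iter (n : nat) (x : R) : R :=
  \prod_(k < n) derive1 F0 (iter k F0 x).

Lemma deriv_iter0 x : deriv_iter 0 x = 1.
Proof. by rewrite /deriv_iter big_ord0. Qed.

Lemma deriv_iterS n x :
  deriv_iter n.+1 x = deriv_iter n (F0 x) * derive1 F0 x.
Proof.
rewrite /deriv_iter big_ord_recl/= mulrC; congr (_ * _).
by apply: eq_bigr => k _; rewrite -iterSr.
Qed.

Lemma deriv_iterD n m x :
  deriv_iter (n + m) x = deriv_iter m (iter n F0 x) * deriv_iter n x.
Proof.
elim: n x => [|n IH] x; first by rewrite deriv_iter0 mulr1.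
by rewrite addSn !deriv_iterS IH -iterSr mulrA.
Qed.

Lemma cyl_sub01 w x : words I w -> cyl w x -> 0 < x < 1.
Proof.
case: w => [_|i w ww [Jx _]]; first by rewrite /= in_itv.
by apply: branch_sub01 Jx; apply: ww; rewrite mem_head.
Qed.

Lemma words_cons i w : words I (i :: w) -> I i /\ words I w.
Proof.
by move=> h; split; [apply: h; rewrite mem_head|move=> j jw; apply: h; rewrite inE jw orbT].
Qed.

Lemma cyl_cat w v x : words I w -> words I v ->
  cyl (w ++ v) x <-> cyl w x /\ cyl v (iter (size w) F0 x).
Proof.
move=> + wv; elim: w x => [|i w IH] x /=.
  by move=> _; split=> [h|[]//]; split => //; rewrite in_itv/=; exact: cyl_sub01 h.
move=> /words_cons[Ii ww]; rewrite -iterS iterSr; split.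
  by move=> [Jx /(IH _ ww)[]].
by move=> [[Jx h1 h2]]; split => //; apply/(IH _ ww).
Qed.

Lemma cyl_surj w y : words I w -> 0 < y < 1 ->
  exists2 x, cyl w x & iter (size w) F0 x = y.
Proof.
elim: w y => [|i w IH] y; first by move=> _ y01; exists y => //=; rewrite in_itv.
move=> /words_cons[Ii ww] /(IH _ ww)[x xw <-].
have [z Jz Fz] := branch_surj Ii (cyl_sub01 ww xw).
by exists z; [split; rewrite //= Fz|rewrite iterSr Fz].
Qed.

Lemma cyl_iter01 w x : words I w -> cyl w x -> 0 < iter (size w) F0 x < 1.
Proof.
elim: w x => [|i w IH] x /=; first by rewrite in_itv.
by move=> /words_cons[_ ww] [_ xw]; rewrite -iterS iterSr; exact: IH.
Qed.

Lemma cyl_open w : words I w -> open (cyl w).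
Proof.
elim: w => [_|i w IH /words_cons[Ii ww]] /=; first exact: itv_open.
rewrite openE => x [Jx Fx]; apply: filterI.
  by apply: open_nbhs_nbhs; split => //; exact: branch_open.
have [dF _] := branch_is_derive Ii Jx.
have /differentiable_continuous cF : differentiable F0 x by apply/derivable1_diffP.
by apply: cF; apply: open_nbhs_nbhs; split => //; exact: IH.
Qed.

Lemma cyl_uniq w v x : words I w -> words I v -> size w = size v ->
  cyl w x -> cyl v x -> w = v.
Proof.
elim: w v x => [|i w IH] [|j v] x //= /words_cons[Ii ww] /words_cons[Ij wv] [sz] [Jx xw] [Jx' xv].
by rewrite (branch_inj Ii Ij Jx Jx') (IH v _ ww wv sz xw xv).
Qed.

Lemma cyl_is_derive w x : words I w -> cyl w x ->
  is_derive x 1 (iter (size w) F0) (deriv_iter (size w) x).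
Proof.
elim: w x => [|i w IH] x /=; first by rewrite deriv_iter0 => _ _; exact: is_derive_id.
move=> /words_cons[Ii ww] [Jx xw]; rewrite deriv_iterS.
have -> : iter (size w).+1 F0 = iter (size w) F0 \o F0.
  by apply/funext => y; rewrite iterSr.
by apply: is_derive1_comp; [exact: IH|exact: branch_is_derive Ii Jx].
Qed.

Lemma branch_increasing i : I i -> exists2 sg : R, sg = 1 \/ sg = -1 &
  forall x y, J i x -> J i y -> x < y -> 0 < sg * (F0 y - F0 x).
Proof.
move=> Ii; have [sg sg1 Hsg] := branch_sign Ii; exists sg => // x y Jx Jy xy.
have [c Jc ->] := mvt_interval (branch_interval Ii)
  (fun z Jz => branch_is_derive Ii Jz) Jx Jy (ltW xy).
rewrite mulrA mulr_gt0 ?subr_gt0// Hsg// (lt_le_trans lam_gt0)// Hlam//.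
exact: branch_dom Jc.
Qed.

Lemma cyl_monotone w : words I w -> exists2 sg : R, sg = 1 \/ sg = -1 &
  forall x y, cyl w x -> cyl w y -> x < y ->
    0 < sg * (iter (size w) F0 y - iter (size w) F0 x).
Proof.
elim: w => [_|i w IH /words_cons[Ii ww]].
  by exists 1; [left|move=> x y _ _ xy; rewrite mul1r subr_gt0].
have [sg sg1 Hsg] := IH ww; have [t t1 Ht] := branch_increasing Ii.
exists (sg * t).
  by case: sg1 => ->; case: t1 => ->; rewrite ?mulrNN ?mulr1 ?mul1r ?mulrN1; [left|right|right|left].
move=> x y [Jx xw] [Jy yw] xy; rewrite -/(iter _ _ _) /= -!iterS !iterSr.
have h := Ht _ _ Jx Jy xy.
case: t1 => e; rewrite e ?mul1r ?mulN1r ?mulr1 ?mulrN1 in h *.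
  by apply: Hsg => //; rewrite -subr_gt0.
rewrite opprB subr_gt0 in h; rewrite mulNr -mulrN opprB.
exact: Hsg.
Qed.

Lemma cyl_interval w : words I w -> is_interval (cyl w).
Proof.
elim: w => [_|i w IH /words_cons[Ii ww]] /=; first exact: interval_is_interval.
move=> x y [Jx xw] [Jy yw] z /andP[xz zy].
have Jz : J i z by apply: (branch_interval Ii) Jx Jy _ _; rewrite xz.
split => //=; have [sg sg1 Hsg] := branch_increasing Ii.
move: xz; rewrite le_eqVlt => /predU1P[<-//|xz].
move: zy; rewrite le_eqVlt => /predU1P[->//|zy].
have h1 := Hsg _ _ Jx Jz xz; have h2 := Hsg _ _ Jz Jy zy.
have [e|e] := sg1; rewrite e ?mul1r ?mulN1r in h1 h2.
  by apply: (IH ww) xw yw _ _; lra.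
by apply: (IH ww) yw xw _ _; lra.
Qed.

Lemma cyl_mvt w x y : words I w -> cyl w x -> cyl w y ->
  exists2 c, cyl w c & `|iter (size w) F0 y - iter (size w) F0 x| =
    `|deriv_iter (size w) c| * `|y - x|.
Proof.
move=> ww; wlog xy : x y / x <= y.
  move=> H xw yw; have [xy|/ltW yx] := leP x y; first exact: H.
  by have [c cw e] := H _ _ yx yw xw; exists c => //; rewrite distrC e distrC.
move=> xw yw; have [c cw ->] := mvt_interval (cyl_interval ww)
  (fun z zw => cyl_is_derive ww zw) xw yw xy.
by exists c => //; rewrite normrM.
Qed.

Lemma deriv_iter_ge w x : words I w -> cyl w x ->
  lam ^+ size w <= `|deriv_iter (size w) x|.
Proof.
elim: w x => [|i w IH] x; first by rewrite deriv_iter0 normr1.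
move=> /words_cons[Ii ww] [Jx xw]; rewrite deriv_iterS normrM exprSr.
rewrite ler_pM ?exprn_ge0 ?(ltW lam_gt0)//; first exact: IH.
by apply: Hlam; exact: branch_dom Jx.
Qed.

Lemma deriv_iter_gt0 w x : words I w -> cyl w x -> 0 < `|deriv_iter (size w) x|.
Proof.
by move=> ww xw; rewrite (lt_le_trans _ (deriv_iter_ge ww xw))// exprn_gt0// lam_gt0.
Qed.

Lemma cyl_expand w x y : words I w -> cyl w x -> cyl w y ->
  lam ^+ size w * `|y - x| <= `|iter (size w) F0 y - iter (size w) F0 x|.
Proof.
move=> ww xw yw; have [c cw ->] := cyl_mvt ww xw yw.
by rewrite ler_wpM2r// deriv_iter_ge.
Qed.

(** Before the remaining letters [w] are read, two points of the cylinder are at most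
    [lam ^- size w] apart, so one step contributes at most [B] times this. The bound is the partial
    sum of this geometric series, and [distortion] is the exponential of its limit. *)
Lemma cyl_log_distortion w x y : words I w -> cyl w x -> cyl w y ->
  ln `|deriv_iter (size w) x| - ln `|deriv_iter (size w) y| <=
  B * lam / (lam - 1) * (1 - lam ^- size w).
Proof.
have l1 : 0 < lam - 1 by rewrite subr_gt0.
elim: w x y => [|i w IH] x y.
  by rewrite !deriv_iter0 !subrr invr1 subrr mulr0.
move=> wiw; have [Ii ww] := words_cons wiw; move=> [Jx xw] [Jy yw].
have Fp z : J i z -> 0 < `|derive1 F0 z|.
  by move=> Jz; rewrite (lt_le_trans lam_gt0)// Hlam//; exact: branch_dom Jz.
rewrite !deriv_iterS !normrM !lnM ?posrE ?(deriv_iter_gt0 ww) ?Fp//.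
have h1 := branch_distortion Ii Jx Jy.
have ln0 : 0 < lam ^+ size w by rewrite exprn_gt0// lam_gt0.
have h2 : `|F0 x - F0 y| <= lam ^- size w.
  rewrite -[leRHS]mul1r ler_pdivlMr// mulrC; apply: (le_trans (cyl_expand ww yw xw)).
  have := cyl_iter01 ww xw; have := cyl_iter01 ww yw.
  by rewrite ler_norml; lra.
have h3 := IH _ _ ww xw yw.
have h4 : ln `|derive1 F0 x| - ln `|derive1 F0 y| <= B * lam ^- size w.
  by apply: (le_trans (ler_norm _)); apply: (le_trans h1); rewrite ler_wpM2l.
have -> : B * lam / (lam - 1) * (1 - lam ^- (size (i :: w))) =
    B * lam / (lam - 1) * (1 - lam ^- size w) + B * lam ^- size w.
  by rewrite /= exprS; field; rewrite !gt_eqF// lam_gt0.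
lra.
Qed.

Definition distortion : R := expR (B * lam / (lam - 1)).

Lemma distortion_ge1 : 1 <= distortion.
Proof.
rewrite -expR0 ler_expR divr_ge0 ?subr_ge0 ?(ltW lam1)// mulr_ge0//.
exact: ltW lam_gt0.
Qed.

Lemma cyl_distortion w x y : words I w -> cyl w x -> cyl w y ->
  `|deriv_iter (size w) x| <= distortion * `|deriv_iter (size w) y|.
Proof.
move=> ww xw yw; have := cyl_log_distortion ww xw yw.
have dx := deriv_iter_gt0 ww xw; have dy := deriv_iter_gt0 ww yw.
rewrite lerBlDr => h; rewrite -[leLHS]lnK ?posrE// -[X in _ * X]lnK ?posrE// -expRD ler_expR.
apply: (le_trans h); rewrite lerD2r -[leRHS]mulr1 ler_wpM2l//.
  rewrite divr_ge0 ?subr_ge0 ?(ltW lam1)// mulr_ge0//; exact: ltW lam_gt0.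
by rewrite gerBl invr_ge0 exprn_ge0// ltW// lam_gt0.
Qed.

End Geometry.

(** * Nested intervals and expansions in base [m] *)

Section Digits.
Context {R : realType}.

(** The sets need not be closed, but each traps the next one in a closed interval with end points of
    its own; the supremum of the left end points lies in all of them. *)
Lemma nested_intervals (C : nat -> set R) (x y : nat -> R) :
  (forall k, C k (x k)) ->
  (forall k z, C k.+1 z -> C k z /\ x k <= z <= y k) ->
  (forall k z, x k <= z <= y k -> C k z) ->
  exists z, forall k, C k z.
Proof.
move=> Cx Cxy xyC.
have down k j z : C (k + j)%N z -> C k z.
  elim: j z => [|j IH] z; first by rewrite addn0.
  by rewrite addnS => /Cxy[/IH].
have xk k j : (k < j)%N -> x k <= x j <= y k.
  move=> kj; have : C (k.+1 + (j - k.+1))%N (x j) by rewrite subnKC.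
  by move=> /down /Cxy[].
have ub k : ubound (range x) (y k).
  move=> _ [j _ <-]; have [kj|jk|->] := ltngtP k j.
  - by have /andP[] := xk _ _ kj.
  - by have /andP[h1 _] := xk _ _ jk; have /andP[h2 h3] := xk _ _ (leqnn k.+1);
       exact: le_trans h1 (le_trans h2 h3).
  - by have /andP[h2 h3] := xk _ _ (leqnn j.+1); exact: le_trans h2 h3.
exists (sup (range x)) => k; apply: xyC; apply/andP; split.
  by apply: ub_le_sup; [exists (y 0%N); exact: ub|exists k].
by apply: ge_sup; [exists (x 0%N); exists 0%N|exact: ub].
Qed.

(** The first [k] digits of [t] in base [m], read as one number; [digit] is the last digit of the
    next prefix. *)
Definition prefix_num (m : nat) (t : R) (k : nat) : nat := Num.truncn (m%:R ^+ k * t).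
Definition digit (m : nat) (t : R) (k : nat) : nat := (prefix_num m t k.+1 %% m)%N.

Lemma prefix_numS m t k : (0 < m)%N -> 0 <= t ->
  prefix_num m t k.+1 = (prefix_num m t k * m + digit m t k)%N.
Proof.
move=> m0 t0; rewrite /digit {1}(divn_eq (prefix_num m t k.+1) m); congr (_ * _ + _)%N.
have y0 : 0 <= m%:R ^+ k * t by rewrite mulr_ge0// exprn_ge0.
have my0 : 0 <= m%:R ^+ k.+1 * t by rewrite mulr_ge0// exprn_ge0.
have /andP[h1 h2] := truncn_itv y0; have /andP[h3 h4] := truncn_itv my0.
rewrite -!/(prefix_num _ _ _) in h1 h2 h3 h4.
set p := prefix_num m t k in h1 h2 *; set q := prefix_num m t k.+1 in h3 h4 *.
have mR : 0 < m%:R :> R by rewrite ltr0n.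
have e : m%:R ^+ k.+1 * t = m%:R * (m%:R ^+ k * t) by rewrite exprS mulrA.
have l1 : (p * m < q.+1)%N.
  rewrite -(ltr_nat R) natrM; apply: le_lt_trans h4.
  by rewrite e mulrC ler_wpM2l// ltW.
have l2 : (q < p.+1 * m)%N.
  rewrite -(ltr_nat R) natrM; apply: (le_lt_trans h3).
  by rewrite e mulrC ltr_pM2r.
apply/eqP; rewrite eqn_leq -ltnS ltn_divLR// l2 /=.
by rewrite leq_divRL.
Qed.

Lemma digits_close m t t' k : (0 < m)%N -> 0 <= t < 1 -> 0 <= t' < 1 ->
  (forall j, (j < k)%N -> digit m t j = digit m t' j) ->
  `|t - t'| <= m%:R ^- k.
Proof.
move=> m0 /andP[t0 t1] /andP[t0' t1'] dd.
have pe : prefix_num m t k = prefix_num m t' k.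
  elim: k dd => [|k IH] dd.
    have z u : 0 <= u < 1 -> prefix_num m u 0 = 0%N.
      by move=> u01; apply/eqP; rewrite /prefix_num expr0 mul1r truncn_eq//; lra.
    by rewrite !z ?t0 ?t0'.
  by rewrite !prefix_numS// IH ?dd// => j jk; apply: dd; rewrite ltnS ltnW.
have mk : 0 < m%:R ^+ k :> R by rewrite exprn_gt0// ltr0n.
rewrite -[leRHS]mul1r ler_pdivlMr// -[X in _ * X](gtr0_norm mk) -normrM mulrBl.
have y0 : 0 <= m%:R ^+ k * t by rewrite mulr_ge0// ltW.
have y0' : 0 <= m%:R ^+ k * t' by rewrite mulr_ge0// ltW.
have := truncn_itv y0; have := truncn_itv y0'; rewrite -!/(prefix_num _ _ _) pe -!natr1.
rewrite ler_norml ![_ * m%:R ^+ k]mulrC; lra.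
Qed.

Lemma digit_lt m t k : (0 < m)%N -> (digit m t k < m)%N.
Proof. by move=> m0; rewrite ltn_mod. Qed.

End Digits.

Section Weights.
Context {R : realType} (I : set nat) (J : nat -> set R) (F0 : R -> R).
Variables (lam K : R).
Hypothesis hF0 : base_map I J F0.
Hypothesis lam1 : 1 < lam.
Hypothesis Hlam : forall x, base_domain I J x -> lam <= `|derive1 F0 x|.
Hypothesis K1 : 1 <= K.
Hypothesis HK : forall w x y, words I w -> cyl J F0 w x -> cyl J F0 w y ->
  `|deriv_iter F0 (size w) x| <= K * `|deriv_iter F0 (size w) y|.

Local Notation cyl := (cyl J F0).
Local Notation D := (deriv_iter F0).
Local Notation words := (words I).
Local Notation R0 := (repeller (base_domain I J) F0).

Definition cyl_pt (w : seq nat) : R := xget 0 (cyl w).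

Lemma cyl_ptP w : words w -> cyl w (cyl_pt w).
Proof.
move=> ww; have [|x xw _] := cyl_surj hF0 (y := 2^-1) ww; first by apply/andP; split; lra.
exact: xgetI xw.
Qed.

(** The inverse derivative at one chosen point; by bounded distortion another point changes it by a
    factor at most [K]. *)
Definition weight (w : seq nat) : R := `|D (size w) (cyl_pt w)|^-1.

Let D0 w x (ww : words w) (xw : cyl w x) : 0 < `|D (size w) x| :=
  deriv_iter_gt0 lam1 Hlam ww xw.

Let K0 : 0 < K. Proof. exact: lt_le_trans K1. Qed.

Lemma weight_gt0 w : words w -> 0 < weight w.
Proof. by move=> ww; rewrite invr_gt0 D0//; exact: cyl_ptP. Qed.

Lemma weight_le w : words w -> weight w <= lam ^- size w.
Proof.
move=> ww; have h := cyl_ptP ww; rewrite lef_pV2 ?posrE ?D0//.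
  exact: (deriv_iter_ge lam1 Hlam).
by rewrite exprn_gt0// (lam_gt0 lam1).
Qed.

Lemma weight_le_deriv w x : words w -> cyl w x -> weight w <= K * `|D (size w) x|^-1.
Proof.
move=> ww xw; have h := cyl_ptP ww; rewrite /weight ler_pdivlMr ?D0// mulrC.
by rewrite ler_pdivrMr ?D0// HK.
Qed.

Lemma deriv_le_weight w x : words w -> cyl w x -> `|D (size w) x|^-1 <= K * weight w.
Proof.
move=> ww xw; have h := cyl_ptP ww; rewrite /weight ler_pdivlMr ?D0// mulrC.
by rewrite ler_pdivrMr ?D0// HK.
Qed.

(** The chain rule is exact at the chosen point of [w ++ v]; comparing each factor with the point
    chosen for [w] or for [v] costs one [K], hence [K ^+ 2]. *)
Lemma weight_cat_ge w v : words w -> words v ->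
  weight w * weight v <= K ^+ 2 * weight (w ++ v).
Proof.
move=> ww wv; have wwv := words_cat ww wv; have h := cyl_ptP wwv.
have [hw hv] := (cyl_cat hF0 _ ww wv).1 h.
rewrite [X in _ <= _ * X]/weight size_cat deriv_iterD normrM invfM.
rewrite [X in _ <= _ * X]mulrC expr2 mulrACA.
by rewrite ler_pM ?(ltW (weight_gt0 _))// weight_le_deriv.
Qed.

Lemma diam_cyl w : words w -> (diam (cyl w) <= (K * weight w)%:E)%E.
Proof.
move=> ww; apply: diam_le => x y xw yw.
have [c cw e] := cyl_mvt hF0 lam1 Hlam ww yw xw.
have : `|D (size w) c| * `|x - y| <= 1.
  rewrite -e; have := cyl_iter01 ww xw; have := cyl_iter01 ww yw.
  by rewrite ler_norml; lra.
rewrite -ler_pdivlMl ?D0// mulr1 => /le_trans; apply; exact: deriv_le_weight.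
Qed.

Definition word_step (psi : R -> int) (w : seq nat) : int :=
  \sum_(i <- w) psi (cyl_pt [:: i]).

Lemma word_step_cat psi w v :
  word_step psi (w ++ v) = word_step psi w + word_step psi v.
Proof. by rewrite /word_step big_cat. Qed.

Definition path_sum (psi : R -> int) (n : nat) (x : R) : int :=
  \sum_(k < n) psi (iter k F0 x).

Lemma path_sumS psi n x : path_sum psi n.+1 x = psi x + path_sum psi n (F0 x).
Proof.
rewrite /path_sum big_ord_recl; congr (_ + _).
by apply: eq_bigr => k _; rewrite -iterSr.
Qed.

Lemma path_sumD psi n m x :
  path_sum psi (n + m) x = path_sum psi n x + path_sum psi m (iter n F0 x).
Proof.
elim: n x => [|n IH] x; first by rewrite /path_sum big_ord0 add0r.
by rewrite addSn !path_sumS IH -iterSr addrA.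
Qed.

Lemma words1 i : I i -> words [:: i].
Proof. by move=> Ii j; rewrite inE => /eqP ->. Qed.

Lemma letter_step (psi : R -> int) i x : constant_on_branches I J psi -> I i -> J i x ->
  psi (cyl_pt [:: i]) = psi x.
Proof.
by move=> cpsi Ii Jx; apply: (cpsi i) => //; have [] := cyl_ptP (words1 Ii).
Qed.

Lemma path_sum_cyl (psi : R -> int) w x : constant_on_branches I J psi -> words w -> cyl w x ->
  path_sum psi (size w) x = word_step psi w.
Proof.
move=> cpsi; elim: w x => [|i w IH] x.
  by rewrite /path_sum /word_step big_ord0 big_nil.
move=> /words_cons[Ii ww] [Jx xw].
by rewrite path_sumS IH// /word_step big_cons (letter_step cpsi Ii Jx).
Qed.

Lemma repellerP x : R0 x <-> forall n, base_domain I J (iter n F0 x).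
Proof. by split=> [h n|h n _]; apply: h. Qed.

Lemma repeller_code x n : R0 x -> exists w, [/\ words w, size w = n & cyl w x].
Proof.
elim: n x => [|n IH] x Rx.
  exists [::]; split => //=; have /repellerP /(_ 0%N)[i Ii Jx] := Rx.
  by rewrite in_itv/=; exact: (branch_sub01 hF0 Ii Jx).
have RFx : R0 (F0 x).
  by apply/repellerP => k; rewrite -iterSr; have /repellerP := Rx; exact.
have [w [ww <- xw]] := IH _ RFx.
have /repellerP /(_ 0%N)[i Ii Jx] := Rx.
exists (i :: w); split => // j; rewrite inE => /predU1P[->//|]; exact: ww.
Qed.

Lemma cyl_base_domain w x k : words w -> (k < size w)%N -> cyl w x ->
  base_domain I J (iter k F0 x).
Proof.
elim: w x k => [|i w IH] x [|k]// /words_cons[Ii ww]; rewrite /= ?ltnS.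
  by move=> _ [Jx _]; exists i.
by move=> kw [Jx xw]; rewrite -iterS iterSr; exact: IH.
Qed.

(* Two distinct letters give three disjoint cylinders, and the one in the middle
   stays away from the end points of the unit interval. *)
Lemma inner_cylinder : exists (g : seq nat) (a c : R),
  [/\ words g, 0 < a, c < 1 & forall x, cyl g x -> a <= x <= c].
Proof.
have [i [j [Ii Ij ij]]] := base_card hF0.
have w1 : words [:: i; i] by move=> k; rewrite !inE orbb => /eqP ->.
have w2 : words [:: i; j] by move=> k; rewrite !inE => /orP[] /eqP ->.
have w3 : words [:: j; i] by move=> k; rewrite !inE => /orP[] /eqP ->.
have distinct u v : words u -> words v -> size u = size v -> u != v -> forall x, cyl u x -> ~ cyl v x.
  by move=> wu wv suv /eqP uv x xu xv; apply: uv; exact: (cyl_uniq hF0 wu wv suv xu xv).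
have middle u v w : words u -> words v -> words w -> size u = size v -> size v = size w ->
    u != v -> v != w -> cyl_pt u < cyl_pt v < cyl_pt w ->
    exists (g : seq nat) (a c : R),
      [/\ words g, 0 < a, c < 1 & forall x, cyl g x -> a <= x <= c].
  move=> wu wv ww suv svw uv vw /andP[puv pvw].
  have [hu hv hw] := And3 (cyl_ptP wu) (cyl_ptP wv) (cyl_ptP ww).
  exists v, (cyl_pt u), (cyl_pt w); split => //.
  - by have /andP[] := cyl_sub01 hF0 wu hu.
  - by have /andP[] := cyl_sub01 hF0 ww hw.
  - have iv := cyl_interval hF0 lam1 Hlam wv.
    move=> x xv; rewrite !leNgt; apply/andP; split; apply/negP => h.
    + apply: (distinct u v wu wv suv uv _ hu).
      by apply: (iv _ _ xv hv); rewrite !ltW.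
    + apply: (distinct v w wv ww svw vw _ _ hw).
      by apply: (iv _ _ hv xv); rewrite !ltW.
have ji : j != i by rewrite eq_sym.
have n12 : [:: i; i] != [:: i; j] by rewrite !eqseq_cons eqxx (negPf ij).
have n23 : [:: i; j] != [:: j; i] by rewrite !eqseq_cons (negPf ij).
have n13 : [:: i; i] != [:: j; i] by rewrite !eqseq_cons (negPf ij).
have n21 : [:: i; j] != [:: i; i] by rewrite eq_sym.
have n32 : [:: j; i] != [:: i; j] by rewrite eq_sym.
have n31 : [:: j; i] != [:: i; i] by rewrite eq_sym.
have pne u v : words u -> words v -> size u = size v -> u != v -> cyl_pt u != cyl_pt v.
  move=> wu wv suv uv; apply/eqP => e; apply: (distinct u v wu wv suv uv _ (cyl_ptP wu)).
  by rewrite e; exact: cyl_ptP.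
have p12 := pne _ _ w1 w2 erefl n12; have p13 := pne _ _ w1 w3 erefl n13.
have p23 := pne _ _ w2 w3 erefl n23.
case: (ltgtP (cyl_pt [:: i; i]) (cyl_pt [:: i; j])) p12 => // c12 _;
case: (ltgtP (cyl_pt [:: i; i]) (cyl_pt [:: j; i])) p13 => // c13 _;
case: (ltgtP (cyl_pt [:: i; j]) (cyl_pt [:: j; i])) p23 => // c23 _.
- by apply: (middle _ _ _ w1 w2 w3) => //; rewrite c12.
- by apply: (middle _ _ _ w1 w3 w2) => //; rewrite c13.
- by have := lt_trans c12 (lt_trans c23 c13); rewrite ltxx.
- by apply: (middle _ _ _ w3 w1 w2) => //; rewrite c13.
- by apply: (middle _ _ _ w2 w1 w3) => //; rewrite c12.
- by have := lt_trans c12 (lt_trans c13 c23); rewrite ltxx.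
- by apply: (middle _ _ _ w2 w3 w1) => //; rewrite c23.
- by apply: (middle _ _ _ w3 w2 w1) => //; rewrite c23.
Qed.

(** The iterate along [w] is monotone and onto []0, 1[]. The preimages of [a] and [c] lie inside the
    open cylinder of [w] and enclose whatever is mapped into [[a, c]], in an order that depends on
    the orientation. *)
Lemma cyl_hull g w a c : words g -> words w -> 0 < a -> c < 1 ->
  (forall x, cyl g x -> a <= x <= c) ->
  exists x y, [/\ cyl w x, cyl w y &
    forall v z, words v -> cyl (w ++ g ++ v) z -> x <= z <= y].
Proof.
move=> wg ww a0 c1 gac; have /andP[ag gc] := gac _ (cyl_ptP wg).
have ac := le_trans ag gc.
have [xa xaw Ea] : exists2 x, cyl w x & iter (size w) F0 x = a.
  by apply: (cyl_surj hF0) => //; rewrite a0 (le_lt_trans ac c1).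
have [xc xcw Ec] : exists2 x, cyl w x & iter (size w) F0 x = c.
  by apply: (cyl_surj hF0) => //; rewrite c1 (lt_le_trans a0 ac).
have [sg sg1 Hsg] := cyl_monotone hF0 lam1 Hlam ww.
have Zb v z : words v -> cyl (w ++ g ++ v) z -> cyl w z /\ a <= iter (size w) F0 z <= c.
  move=> wv /(cyl_cat hF0 _ ww (words_cat wg wv))[zw /(cyl_cat hF0 _ wg wv)[zg _]].
  by split => //; exact: gac.
case: sg1 => e; rewrite e in Hsg.
- exists xa, xc; split => // v z wv /Zb[//|zw /andP[az zc]].
  rewrite !leNgt; apply/andP; split; apply/negP => h.
  + by have := Hsg _ _ zw xaw h; rewrite Ea mul1r; lra.
  + by have := Hsg _ _ xcw zw h; rewrite Ec mul1r; lra.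
- exists xc, xa; split => // v z wv /Zb[//|zw /andP[az zc]].
  rewrite !leNgt; apply/andP; split; apply/negP => h.
  + by have := Hsg _ _ zw xcw h; rewrite Ec mulN1r; lra.
  + by have := Hsg _ _ xaw zw h; rewrite Ea mulN1r; lra.
Qed.

End Weights.

(** * Lower bounds from iterated function systems *)

Fixpoint concat_prefix (u : nat -> seq nat) (d : nat -> nat) (k : nat) : seq nat :=
  if k is k'.+1 then concat_prefix u d k' ++ u (d k') else [::].

Lemma eq_concat_prefix u d d' k : (forall j, (j < k)%N -> d j = d' j) ->
  concat_prefix u d k = concat_prefix u d' k.
Proof.
elim: k => //= k IH dd; rewrite dd// IH// => j jk; apply: dd; exact: ltnW.
Qed.

Section IteratedFunctionSystem.
Context {R : realType} (I : set nat) (J : nat -> set R) (F0 : R -> R).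
Variables (lam : R).
Hypothesis hF0 : base_map I J F0.
Hypothesis lam1 : 1 < lam.
Hypothesis Hlam : forall x, base_domain I J x -> lam <= `|derive1 F0 x|.

Local Notation cyl := (cyl J F0).
Local Notation D := (deriv_iter F0).
Local Notation words := (words I).

Variables (m l : nat) (g : seq nat) (v : nat -> seq nat) (a c rho s : R).
Let u d := g ++ v d.
Hypothesis m1 : (1 < m)%N.
Hypothesis wg : words g.
Hypothesis a0 : 0 < a.
Hypothesis c1 : c < 1.
Hypothesis gac : forall x, cyl g x -> a <= x <= c.
Hypothesis wv : forall d, (d < m)%N -> words (v d).
Hypothesis su : forall d, (d < m)%N -> size (u d) = l.
Hypothesis injv : forall d d', (d < m)%N -> (d' < m)%N -> v d = v d' -> d = d'.
Hypothesis rho0 : 0 < rho.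
Hypothesis Drho : forall d x, (d < m)%N -> cyl (u d) x -> `|D l x| <= rho^-1.
Hypothesis s0 : 0 < s.
Hypothesis mrho : m%:R^-1 <= rho `^ s.

Let m0 : (0 < m)%N. Proof. exact: ltnW. Qed.

Let wu d : (d < m)%N -> words (u d).
Proof. by move=> dm; apply: words_cat => //; exact: wv. Qed.

Let pref := concat_prefix u.

Let wpref (d : nat -> nat) k : (forall j, (d j < m)%N) -> words (pref d k).
Proof. by move=> dm; elim: k => //= k IH; apply: words_cat => //; exact: wu. Qed.

Let size_pref (d : nat -> nat) k : (forall j, (d j < m)%N) -> size (pref d k) = (k * l)%N.
Proof. by move=> dm; elim: k => //= k IH; rewrite size_cat IH su// mulSn addnC. Qed.

Let pref_point (d : nat -> nat) : (forall j, (d j < m)%N) ->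
  exists z, forall k, cyl (pref d k) z.
Proof.
move=> dm.
have /choice[xy Hxy] : forall k, exists xy : R * R, [/\ cyl (pref d k) xy.1, cyl (pref d k) xy.2 &
    forall v z, words v -> cyl (pref d k ++ g ++ v) z -> xy.1 <= z <= xy.2].
  move=> k; have [x [y h]] := cyl_hull hF0 lam1 Hlam wg (@wpref _ k dm) a0 c1 gac.
  by exists (x, y).
apply: (@nested_intervals R (fun k => cyl (pref d k)) (fun k => (xy k).1) (fun k => (xy k).2)).
- by move=> k; have [] := Hxy k.
- move=> k z; rewrite /pref /= -/pref => hz; have [_ _ H] := Hxy k; split.
    by have [] := (cyl_cat hF0 _ (@wpref _ k dm) (wu (dm k))).1 hz.
  by apply: H hz; exact: wv.
- move=> k z; have [h1 h2 _] := Hxy k.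
  exact: (cyl_interval hF0 lam1 Hlam (@wpref _ k dm)) h1 h2 z.
Qed.

(** The two end points of the hull are interior to the open cylinder of [u d], so the hull keeps a
    positive distance from its complement. Finitely many letters then give one common gap. *)
Let gap_one d : (d < m)%N -> exists2 e : R, 0 < e & forall v' z z', words v' ->
  cyl (u d ++ g ++ v') z -> ~ cyl (u d) z' -> e <= `|z - z'|.
Proof.
move=> dm; have [x [y [xu yu H]]] := cyl_hull hF0 lam1 Hlam wg (wu dm) a0 c1 gac.
have oc := cyl_open hF0 (wu dm).
have /nbhs_ballP[e1 /= e10 b1] : nbhs x (cyl (u d)) by exact: open_nbhs_nbhs.
have /nbhs_ballP[e2 /= e20 b2] : nbhs y (cyl (u d)) by exact: open_nbhs_nbhs.
exists (Num.min e1 e2); first by rewrite lt_min e10.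
move=> v' z z' wv' /(H _ _ wv') /andP[xz zy] nz'.
rewrite leNgt; apply/negP; rewrite lt_min => /andP[z1 z2].
have [h|h] := ltP z' x.
  apply: nz'; apply: b1; rewrite /ball /= gtr0_norm ?subr_gt0//.
  by apply: le_lt_trans z1; rewrite ger0_norm; lra.
have [h'|h'] := ltP y z'.
  apply: nz'; apply: b2; rewrite /ball /= ltr0_norm ?subr_lt0//.
  by apply: le_lt_trans z2; rewrite ler0_norm; lra.
by apply: nz'; apply: (cyl_interval hF0 lam1 Hlam (wu dm) xu yu); rewrite h h'.
Qed.

Let gap : exists2 e : R, 0 < e & forall d v' z z', (d < m)%N -> words v' ->
  cyl (u d ++ g ++ v') z -> ~ cyl (u d) z' -> e <= `|z - z'|.
Proof.
suff H M : exists2 e : R, 0 < e & forall d v' z z', (d < M)%N -> (d < m)%N -> words v' ->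
  cyl (u d ++ g ++ v') z -> ~ cyl (u d) z' -> e <= `|z - z'|.
  by have [e e0 He] := H m; exists e => // d v' z z' dm; exact: He.
elim: M => [|M [e e0 He]]; first by exists 1.
have [Mm|mM] := ltnP M m; last first.
  exists e => // d v' z z' _ dm; apply: He => //; exact: leq_trans dm mM.
have [e' e'0 He'] := gap_one Mm.
exists (Num.min e e'); first by rewrite lt_min e0.
move=> d v' z z'; rewrite ltnS leq_eqVlt ge_min => /predU1P[->|dM] dm wv' hz hz'.
  by rewrite (He' v' z z' wv' hz hz') orbT.
by rewrite (He d v' z z' dM dm wv' hz hz').
Qed.

Let D_pref (d : nat -> nat) k x : (forall j, (d j < m)%N) -> cyl (pref d k) x ->
  `|D (k * l) x| <= rho ^- k.
Proof.
move=> dm; elim: k x => [|k IH] x; first by rewrite mul0n deriv_iter0 normr1 expr0 invr1.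
rewrite /pref /= -/pref => /(cyl_cat hF0 _ (@wpref _ k dm) (wu (dm k)))[h1 h2].
rewrite size_pref// in h2.
rewrite mulSn addnC deriv_iterD normrM exprS invfM.
by rewrite ler_pM// ?IH//; apply: Drho (dm k) _.
Qed.

(** [T t] is the point coded by the base-[m] digits of [t]. If two codes first differ at place [j],
    the images after [j] blocks are at least [e] apart while the derivative up to then is at most
    [rho ^- j]. So the points are at least [e rho ^+ j] apart, whereas
    [|t - t'| <= m ^- j <= rho ^ (s j)]. *)
Lemma ifs_holder : exists (T : R -> R) (C : R),
  (forall t, 0 <= t < 1 -> exists2 d : nat -> nat, (forall j, (d j < m)%N) &
    forall k, cyl (concat_prefix u d k) (T t)) /\
  (forall t t', 0 <= t < 1 -> 0 <= t' < 1 ->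
    `|t - t'| <= C * `|T t - T t'| `^ s).
Proof.
pose dg (t : R) := digit m t.
have dgm t j : (dg t j < m)%N by exact: digit_lt.
pose T t := xget 0 [set z | forall k, cyl (pref (dg t) k) z].
have TP t k : cyl (pref (dg t) k) (T t).
  have [z hz] := pref_point (dgm t).
  have h : [set z | forall k, cyl (pref (dg t) k) z] (T t) by exact: xgetI hz.
  exact: h.
have [e e0 He] := gap.
exists T, (e `^ (- s)); split.
  by move=> t _; exists (dg t) => // k; exact: TP.
move=> t t' t01 t01'.
have [->|tt'] := eqVneq t t'; first by rewrite subrr normr0 mulr_ge0 ?powR_ge0.
have [j hj] : exists j, dg t j != dg t' j.
  apply: contrapT => /forallNP nd.
  have mR : 1 < (m%:R : R) by rewrite ltr1n.
  have [k hk] := expr_unbounded (`|t - t'|^-1 + 1) mR.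
  have : `|t - t'| <= m%:R ^- k.
    apply: digits_close => // i _.
    by apply/eqP; rewrite -[_ == _]negbK; apply/negP; exact: nd.
  have tp : 0 < `|t - t'| by rewrite normr_gt0 subr_eq0.
  rewrite leNgt => /negP; apply.
  rewrite invf_plt ?posrE// ?exprn_gt0 ?ltr0n//.
  by apply: lt_le_trans hk; rewrite ltrDl.
have ex : exists j, dg t j != dg t' j by exists j.
case: (ex_minnP ex) => {j hj} {ex} j hj mn.
have same i : (i < j)%N -> dg t i = dg t' i.
  move=> ij; apply/eqP; rewrite -[_ == _]negbK; apply/negP => /mn.
  by rewrite leqNgt ij.
have pe : pref (dg t) j = pref (dg t') j by exact: eq_concat_prefix.
have wp := @wpref _ j (dgm t).
have hz : cyl (pref (dg t) j) (T t) /\ cyl (u (dg t j) ++ g ++ v (dg t j.+1)) (iter (j * l) F0 (T t)).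
  have := TP t j.+2; rewrite /pref /= -/pref -catA.
  move=> /(cyl_cat hF0 _ wp (words_cat (wu (dgm t j)) (wu (dgm t j.+1))))[].
  by rewrite size_pref.
have hz' : cyl (pref (dg t) j) (T t') /\ cyl (u (dg t' j)) (iter (j * l) F0 (T t')).
  have := TP t' j.+1; rewrite /pref /= -/pref -pe.
  move=> /(cyl_cat hF0 _ wp (wu (dgm t' j)))[].
  by rewrite size_pref.
have [z1 z2] := hz; have [z1' z2'] := hz'.
have nz : ~ cyl (u (dg t j)) (iter (j * l) F0 (T t')).
  move=> h; move/eqP: hj; apply; apply: injv => //.
  have := cyl_uniq hF0 (wu (dgm t j)) (wu (dgm t' j)) _ h z2'.
  rewrite !su// => /(_ erefl) /eqP; rewrite /u eqseq_cat// eqxx => /eqP -> //.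
have := He _ _ _ _ (dgm t j) (wv (dgm t j.+1)) z2 nz.
have [x xw E] := cyl_mvt hF0 lam1 Hlam wp z1' z1.
rewrite size_pref// in E; rewrite E => hgap.
have h1 : e * rho ^+ j <= `|T t - T t'|.
  rewrite -ler_pdivlMr ?exprn_gt0//; apply: (le_trans hgap).
  by rewrite mulrC ler_wpM2l//; exact: (D_pref (dgm t)) xw.
apply: (le_trans (digits_close m0 t01 t01' same)).
apply: (@le_trans _ _ (e `^ (- s) * (e * rho ^+ j) `^ s)); last first.
  rewrite ler_wpM2l ?powR_ge0// ge0_ler_powR ?nnegrE//; first exact: ltW.
  by rewrite mulr_ge0 ?exprn_ge0// ltW.
rewrite powRM ?exprn_ge0 ?(ltW e0) ?(ltW rho0)// mulrA powRN mulVf ?mul1r; last first.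
  by rewrite gt_eqF// powR_gt0.
have -> : (rho ^+ j) `^ s = (rho `^ s) ^+ j.
  by rewrite -!powR_mulrn ?powR_ge0 ?(ltW rho0)// powRAC.
rewrite -exprVn; apply: lerXn2r => //; rewrite nnegrE ?powR_ge0// invr_ge0//.
Qed.

End IteratedFunctionSystem.

Section LowerBound.
Context {R : realType} (I : set nat) (J : nat -> set R) (F0 : R -> R).
Variables (lam K : R).
Hypothesis hF0 : base_map I J F0.
Hypothesis lam1 : 1 < lam.
Hypothesis Hlam : forall x, base_domain I J x -> lam <= `|derive1 F0 x|.
Hypothesis K1 : 1 <= K.
Hypothesis HK : forall w x y, words I w -> cyl J F0 w x -> cyl J F0 w y ->
  `|deriv_iter F0 (size w) x| <= K * `|deriv_iter F0 (size w) y|.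

Local Notation cyl := (cyl J F0).
Local Notation D := (deriv_iter F0).
Local Notation words := (words I).
Local Notation R0 := (repeller (base_domain I J) F0).
Local Notation weight := (weight J F0).
Local Notation S psi := (word_step J F0 psi).

Variable (psi : R -> int).
Hypothesis cpsi : constant_on_branches I J psi.

Definition drift_set (sg : int) : set R := [set x | R0 x /\
  forall M : int, exists N : nat, forall n, (N <= n)%N -> M <= sg * path_sum F0 psi n x].

(** Every completed block raises the signed sum by at least 1, and inside a block it changes by a
    bounded amount, since the generators have finitely many prefixes. *)
Lemma concat_drift (sg : int) (W : seq (seq nat)) (l : nat) (u : nat -> seq nat)
    (d : nat -> nat) z :
  (forall w, w \in W -> [/\ words w, size w = l & 1 <= sg * S psi w]) ->
  (forall k, u (d k) \in W) ->
  (forall k, cyl (concat_prefix u d k) z) -> drift_set sg z.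
Proof.
move=> WP uW hz.
have wp k : words (concat_prefix u d k).
  elim: k => //= k IH; apply: words_cat => //; by have [] := WP _ (uW k).
have sp k : size (concat_prefix u d k) = (k * l)%N.
  by elim: k => //= k IH; have [_ su _] := WP _ (uW k); rewrite size_cat IH su mulSn addnC.
have l0 : (0 < l)%N.
  have [_ su S1] := WP _ (uW 0%N); rewrite -su lt0n; apply/eqP => /size0nil e.
  by move: S1; rewrite e /word_step big_nil mulr0.
have Sp k : k%:Z <= sg * S psi (concat_prefix u d k).
  elim: k => [|k IH]; first by rewrite /word_step big_nil mulr0.
  have [_ _ S1] := WP _ (uW k); rewrite /= word_step_cat mulrDr.
  by move: (sg * S psi _) (sg * S psi _) IH S1 => a c; lia.
split.
  apply/repellerP => n; apply: (@cyl_base_domain R I J F0 (concat_prefix u d n.+1)) => //.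
  by rewrite sp; apply: leq_trans (leq_pmulr _ l0).
have [B HB] : exists B : nat, forall w r, w \in W -> (r < l)%N ->
    (absz (sg * S psi (take r w)))%:Z <= B%:Z.
  pose L := flatten [seq [seq absz (sg * S psi (take r w)) | r <- iota 0 l] | w <- W].
  exists (\max_(x <- L) x)%N => w r wW rl.
  have xL : absz (sg * S psi (take r w)) \in L.
    apply/flattenP; exists [seq absz (sg * S psi (take r w)) | r <- iota 0 l].
      by apply/mapP; exists w.
    by apply/mapP; exists r; rewrite // mem_iota.
  by have := @leq_bigmax_seq _ L xpredT id _ xL isT.
(* After this time at least [|M| + B] blocks are complete, and the unfinished one takes away at most
   [B]. *)
move=> M; exists ((`|M|%N + B) * l)%N => n hn.
have nq := divn_eq n l; set q := (n %/ l)%N in nq; set r := (n %% l)%N in nq.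
have rl : (r < l)%N by rewrite ltn_mod.
have qM : (`|M|%N + B <= q)%N by rewrite leq_divRL.
have hq := hz q.+1; rewrite /= in hq.
have [_ su _] := WP _ (uW q); have wu : words (u (d q)) by have [] := WP _ (uW q).
have [h1 h2] := (cyl_cat hF0 _ (wp q) wu).1 hq; rewrite sp in h2.
rewrite nq path_sumD -{1}(sp q) (path_sum_cyl hF0 cpsi (wp q) h1) mulrDr.
have h3 : cyl (take r (u (d q))) (iter (q * l) F0 z).
  rewrite -[u (d q)](cat_take_drop r) in h2 wu.
  by have [] := (cyl_cat hF0 _ (words_catl wu) (words_catr wu)).1 h2.
have wt : words (take r (u (d q))).
  by rewrite -[u (d q)](cat_take_drop r) in wu; exact: words_catl wu.
have sr : size (take r (u (d q))) = r by rewrite size_take su rl.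
rewrite -{1}sr (path_sum_cyl hF0 cpsi wt h3).
have := Sp q; have := HB _ r (uW q) rl.
by move: (sg * S psi _) (sg * S psi _) => a c; lia.
Qed.

Hypothesis Sgen : forall r : int, exists2 v, words v & S psi v = r.

(** A large sum at [s] yields many words of one length with weight at least a common [r]. Preceded
    by [g] they generate a system with uniform contraction bound [c0 r], whose limit set is the
    Hoelder-inverse image of the unit interval at exponent [s']. *)
Lemma drift_hausdorff_neq0 (sg : int) (s s' : R) : 0 < s' -> s' < s ->
  (forall Lam : R, exists n,
    (Lam%:E < wsum weight (words `&` [set w | size w = n /\ (1 <= sg * S psi w)%R]) s)%E) ->
  hausdorff_measure s' (drift_set sg) != 0%E.
Proof.
move=> s'0 s's big.
have b0 := weight_gt0 hF0 lam1 Hlam.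
have K0 : 0 < K by exact: lt_le_trans K1.
have [g0 [a [c [wg0 a0 c1 gac0]]]] := inner_cylinder hF0 lam1 Hlam.
have [e we Se] := Sgen (- S psi g0).
pose g := g0 ++ e; have wg : words g by exact: words_cat.
have Sg : S psi g = 0 by rewrite word_step_cat Se subrr.
have gac x : cyl g x -> a <= x <= c by move=> /(cyl_cat hF0 _ wg0 we)[/gac0].
(* Prefixing [g] costs [K ^+ 2] by quasi-multiplicativity, and passing to the derivative at an
   arbitrary point one more [K]. *)
pose c0 := weight g / K ^+ 3.
have c00 : 0 < c0 by rewrite divr_gt0 ?exprn_gt0 ?b0.
have Dbound w x : words w -> cyl (g ++ w) x -> c0 * weight w <= `|D (size (g ++ w)) x|^-1.
  move=> ww hx; have wgw := words_cat wg ww.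
  have h1 := weight_le_deriv hF0 lam1 Hlam HK wgw hx.
  have h2 := weight_cat_ge hF0 lam1 Hlam HK wg ww.
  have K30 : 0 < K ^+ 3 by rewrite exprn_gt0.
  rewrite /c0 mulrAC ler_pdivrMr// [leRHS]mulrC; apply: (le_trans h2).
  rewrite [K ^+ 3]exprSr -[leRHS]mulrA; apply: ler_wpM2l => //.
  by rewrite exprn_ge0// ltW.
(* The 2 guarantees at least two generators, since [r ^ s' <= 1]; the other term gives the Moran
   condition [m (c0 r) ^ s' >= 1]. *)
pose Lam := Num.max 2 (c0 `^ (- s')).
have [n /esum_gt[W [uW WP bigW]]] := big (2 `^ s * Lam * (1 - 2^-1 `^ (s - s'))^-1).
rewrite sumEFin lte_fin in bigW.
have [r /andP[r0 r1] hr] : exists2 r, 0 < r <= 1 &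
    Lam < (count (fun w => r <= weight w) W)%:R * r `^ s'.
  apply: contrapT => /forall2NP nr.
  have : \sum_(w <- W) weight w `^ s <= 2 `^ s * Lam * (1 - 2^-1 `^ (s - s'))^-1.
    apply: sum_powR_le_count => //; first exact: ltW.
      move=> w /WP[ww _]; rewrite b0//=.
      exact: (b_le1 lam1 (weight_le hF0 lam1 Hlam)).
    by move=> r r01; have [//|/negP] := nr r; rewrite -leNgt.
  by rewrite leNgt bigW.
pose W0 := [seq w <- W | r <= weight w].
pose m := size W0.
have mE : m = count (fun w => r <= weight w) W by rewrite /m size_filter.
rewrite -mE in hr.
have rs1 : r `^ s' <= 1.
  by rewrite -(powRr0 r) ger_powR ?r0// ltW.
have m1 : (1 < m)%N.
  rewrite -(ltr_nat R); apply: (@lt_le_trans _ _ (m%:R * r `^ s')).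
    apply: le_lt_trans hr; rewrite le_max; apply/orP; left; lra.
  by rewrite ler_piMr.
pose v d := nth [::] W0 d.
have vW d : (d < m)%N -> v d \in W0 by move=> dm; rewrite mem_nth.
have W0P w : w \in W0 -> [/\ words w, size w = n, 1 <= sg * S psi w & r <= weight w].
  by rewrite mem_filter => /andP[rw /WP[ww [sw Sw]]].
have s0 : 0 < s by exact: lt_trans s'0 _.
pose l := (size g + n)%N.
have [T [C [TP TC]]] : exists (T : R -> R) (C : R),
  (forall t, 0 <= t < 1 -> exists2 d : nat -> nat, (forall j, (d j < m)%N) &
    forall k, cyl (concat_prefix (fun d => g ++ v d) d k) (T t)) /\
  (forall t t', 0 <= t < 1 -> 0 <= t' < 1 ->
    `|t - t'| <= C * `|T t - T t'| `^ s').
  apply: (ifs_holder hF0 lam1 Hlam (l := l) (a := a) (c := c) (rho := c0 * r)) => //.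
  - by move=> d /vW /W0P[].
  - by move=> d /vW /W0P[_ sw _ _]; rewrite size_cat sw.
  - move=> d d' dm dm' /eqP; rewrite nth_uniq//; first by move/eqP.
    exact: filter_uniq.
  - exact: mulr_gt0.
  - move=> d x dm hx; have [ww sw _ rw] := W0P _ (vW _ dm).
    have h := Dbound _ _ ww hx.
    have sl : size (g ++ v d) = l by rewrite size_cat sw.
    have Dp : 0 < `|D (size (g ++ v d)) x|.
      by apply: (deriv_iter_gt0 lam1 Hlam) hx; exact: words_cat.
    rewrite sl in h Dp; rewrite -[leLHS]invrK lef_pV2 ?posrE ?invr_gt0// ?(mulr_gt0 c00 r0)//.
    by apply: le_trans h; rewrite ler_wpM2l// ltW.
  - rewrite powRM ?(ltW c00) ?(ltW r0)//.
    have mR : 0 < (m%:R : R) by rewrite ltr0n ltnW.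
    have cs : 0 < c0 `^ s' by rewrite powR_gt0.
    rewrite -[leLHS]mul1r ler_pdivrMr// -mulrA -ler_pdivrMl// mulr1 -powRN.
    rewrite mulrC; apply: ltW; apply: le_lt_trans hr; by rewrite le_max lexx orbT.
apply: (holder_inverse_hausdorff s'0 _ TC) => t t01.
have [d dm hz] := TP t t01.
apply: (concat_drift (W := [seq g ++ w | w <- W0]) (l := l) _ _ hz).
  move=> _ /mapP[w /W0P[ww sw Sw _] ->]; split; [exact: words_cat|by rewrite size_cat sw|].
  by rewrite word_step_cat Sg add0r.
by move=> k; apply: map_f; exact: vW.
Qed.

End LowerBound.

(** * Periodic points, critical exponents and pressure *)

Section PeriodicSums.
Context {R : realType} (I : set nat) (J : nat -> set R) (F0 : R -> R).
Variables (lam K : R).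
Hypothesis hF0 : base_map I J F0.
Hypothesis lam1 : 1 < lam.
Hypothesis Hlam : forall x, base_domain I J x -> lam <= `|derive1 F0 x|.
Hypothesis K1 : 1 <= K.
Hypothesis HK : forall w x y, words I w -> cyl J F0 w x -> cyl J F0 w y ->
  `|deriv_iter F0 (size w) x| <= K * `|deriv_iter F0 (size w) y|.

Local Notation cyl := (cyl J F0).
Local Notation D := (deriv_iter F0).
Local Notation words := (words I).
Local Notation R0 := (repeller (base_domain I J) F0).
Local Notation weight := (weight J F0).

Let b0 := weight_gt0 hF0 lam1 Hlam.
Let K0 : 0 < K. Proof. exact: lt_le_trans K1. Qed.

Lemma periodic_unique w x y : words w -> (0 < size w)%N -> cyl w x -> cyl w y ->
  iter (size w) F0 x = x -> iter (size w) F0 y = y -> x = y.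
Proof.
move=> ww w0 xw yw Fx Fy; have := cyl_expand hF0 lam1 Hlam ww xw yw; rewrite Fx Fy => h.
apply/eqP; rewrite eq_sym -subr_eq0 -normr_le0 leNgt; apply/negP => p.
have l : 1 < lam ^+ size w by rewrite exprn_egt1 -?lt0n.
by move: h; rewrite -[leRHS]mul1r ler_pM2r// leNgt l.
Qed.

(** The cylinder of [g ++ w] lies in [[a, c]] and its iterate takes the values [a / 2 < a] and
    [(1 + c) / 2 > c], so iterate minus identity changes sign inside. For a word without such a
    prefix the fixed point might be an end point of the open cylinder. *)
Lemma periodic_exists g w a c : words g -> words w -> 0 < a -> c < 1 ->
  (forall x, cyl g x -> a <= x <= c) ->
  exists2 x, cyl (g ++ w) x & iter (size (g ++ w)) F0 x = x.
Proof.
move=> wg ww a0 c1 gac; have wgw := words_cat wg ww.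
have gb x : cyl (g ++ w) x -> a <= x <= c by move=> /(cyl_cat hF0 _ wg ww)[/gac].
have [y1 hy1 E1] : exists2 y, cyl (g ++ w) y & iter (size (g ++ w)) F0 y = a / 2.
  apply: (cyl_surj hF0) => //; have /gb/andP[h1 h2] := cyl_ptP hF0 wgw.
  by apply/andP; split; lra.
have [y2 hy2 E2] : exists2 y, cyl (g ++ w) y & iter (size (g ++ w)) F0 y = (1 + c) / 2.
  apply: (cyl_surj hF0) => //; have /gb/andP[h1 h2] := cyl_ptP hF0 wgw.
  by apply/andP; split; lra.
have [||x xgw Ex] := @ivt_interval R (cyl (g ++ w)) (fun t => iter (size (g ++ w)) F0 t - t)
    y1 y2 0 (cyl_interval hF0 lam1 Hlam wgw) _ hy1 hy2.
- move=> z hz; have [dz _] := cyl_is_derive hF0 wgw hz.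
  by apply: derivableB => //; exact: derivable_id.
- have /andP[h1 h2] := gb _ hy1; have /andP[h3 h4] := gb _ hy2; rewrite E1 E2; apply/andP; split; lra.
by exists x => //; apply/eqP; rewrite -subr_eq0 Ex.
Qed.

Lemma iter_periodic n q x : iter n F0 x = x -> iter (q * n) F0 x = x.
Proof. by move=> Fx; elim: q => // q IH; rewrite mulSn iterD IH. Qed.

Lemma periodic_repeller w x : words w -> (0 < size w)%N -> cyl w x ->
  iter (size w) F0 x = x -> R0 x.
Proof.
move=> ww w0 xw Fx; apply/repellerP => n.
rewrite (divn_eq n (size w)) addnC iterD iter_periodic//.
by apply: (@cyl_base_domain R I J F0 w) => //; rewrite ltn_mod.
Qed.

Lemma deriv_powRN w x s : words w -> cyl w x ->
  `|D (size w) x| `^ (- s) = `|D (size w) x|^-1 `^ s.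
Proof.
move=> ww xw; have h := deriv_iter_gt0 lam1 Hlam ww xw.
by rewrite -powR_inv1 ?(ltW h)// -powRrM mulN1r.
Qed.

(* [X n] stands for the periodic points of period [n] counted in a critical
   exponent, [Y] for the set of their codes. *)
Section Codes.
Variables (X : nat -> set R) (Y : set (seq nat)).
Hypothesis Yw : Y `<=` words.

Lemma periodic_sum_le n s : 0 <= s -> (0 < n)%N ->
  (forall x, X n x -> iter n F0 x = x /\ exists w, [/\ Y w, size w = n & cyl w x]) ->
  (\esum_(x in X n) (`|D n x| `^ (- s))%:E <=
   (K `^ s)%:E * wsum weight (Y `&` [set w | size w = n]) s)%E.
Proof.
move=> s0 n0 XP.
pose f x := xget [::] [set w | [/\ Y w, size w = n & cyl w x]].
have fP x : X n x -> [/\ Y (f x), size (f x) = n & cyl (f x) x].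
  move=> /XP[_ [w hw]].
  by have h : [set w | [/\ Y w, size w = n & cyl w x]] (f x) by exact: xgetI hw.
apply: (esum_le_inj (f := f)).
- exact: powR_ge0.
- move=> x y /set_mem Xx /set_mem Xy e.
  have [Yx sx xw] := fP _ Xx; have [Yy sy yw] := fP _ Xy.
  rewrite -e in yw; have [Fx _] := XP _ Xx; have [Fy _] := XP _ Xy.
  by apply: (periodic_unique (Yw Yx)); rewrite ?sx.
- by move=> x /fP[].
- move=> x /fP[Yx sx xw]; have ww := Yw Yx.
  rewrite -EFinM lee_fin -sx deriv_powRN// -powRM ?(ltW K0) ?(ltW (b0 _))//.
  rewrite ge0_ler_powR ?nnegrE ?invr_ge0// ?mulr_ge0 ?(ltW K0) ?(ltW (b0 _))//.
  exact: (deriv_le_weight hF0 lam1 Hlam HK).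
- by move=> w _; rewrite lee_fin powR_ge0.
Qed.

(** Every word [w] is represented by the periodic point of [g ++ w]. The constant collects [K ^+ 2]
    for cutting off [g] and [K] for the distortion. *)
Lemma periodic_sum_ge g n s : 0 <= s -> words g ->
  (forall w, Y w -> size w = n ->
     exists2 x, X (size g + n)%N x & cyl (g ++ w) x /\ iter (size (g ++ w)) F0 x = x) ->
  (wsum weight (Y `&` [set w | size w = n]) s <=
   ((K ^+ 3 / weight g) `^ s)%:E *
   \esum_(x in X (size g + n)%N) (`|D (size g + n) x| `^ (- s))%:E)%E.
Proof.
move=> s0 wg YP.
pose f w := xget 0 [set x | X (size g + n)%N x /\ cyl (g ++ w) x].
have fP w : Y w -> size w = n -> X (size g + n)%N (f w) /\ cyl (g ++ w) (f w).
  move=> Yw' sw; have [x Xx [hx _]] := YP _ Yw' sw.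
  have h : [set x | X (size g + n)%N x /\ cyl (g ++ w) x] (f w) by apply: xgetI (conj Xx hx).
  exact: h.
apply: (esum_le_inj (f := f)).
- exact: powR_ge0.
- move=> w w' /set_mem[Yw1 /= sw] /set_mem[Yw2 /= sw'] e.
  have [_ h1] := fP _ Yw1 sw; have [_ h2] := fP _ Yw2 sw'; rewrite -e in h2.
  have /eqP : g ++ w = g ++ w'.
    apply: (cyl_uniq hF0 _ _ _ h1 h2); rewrite ?size_cat ?sw ?sw'//;
      by apply: words_cat => //; exact: Yw.
  by rewrite eqseq_cat// eqxx => /eqP.
- by move=> w [Yw1 /= sw]; have [] := fP _ Yw1 sw.
- move=> w [Yw1 /= sw]; have [Xx hx] := fP _ Yw1 sw; have ww := Yw Yw1.
  have wgw := words_cat wg ww.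
  have sgw : (size g + n)%N = size (g ++ w) by rewrite size_cat sw.
  have K30 : 0 < K ^+ 3 by rewrite exprn_gt0.
  rewrite -EFinM lee_fin sgw deriv_powRN// -powRM ?invr_ge0 ?divr_ge0 ?(ltW K30) ?(ltW (b0 _))//.
  have h1 := weight_le_deriv hF0 lam1 Hlam HK wgw hx.
  have h2 := weight_cat_ge hF0 lam1 Hlam HK wg ww.
  rewrite ge0_ler_powR ?nnegrE ?(ltW (b0 _))//.
    by rewrite mulr_ge0 ?invr_ge0// divr_ge0 ?(ltW K30) ?(ltW (b0 _)).
  rewrite mulrAC ler_pdivlMr ?b0// mulrC; apply: (le_trans h2).
  by rewrite [K ^+ 3]exprSr -[leRHS]mulrA; apply: ler_wpM2l => //; rewrite exprn_ge0// ltW.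
- by move=> x _; rewrite lee_fin powR_ge0.
Qed.

Let total s := \esum_(n in [set n | (1 <= n)%N]) \esum_(x in X n) (`|D n x| `^ (- s))%:E.

Lemma total_ge g s : 0 <= s -> words g -> (0 < size g)%N ->
  (forall w, Y w ->
     exists2 x, X (size (g ++ w)) x & cyl (g ++ w) x /\ iter (size (g ++ w)) F0 x = x) ->
  (total s < +oo)%E -> (wsum weight Y s < +oo)%E.
Proof.
move=> s0 wg g0 YP tfin.
rewrite /wsum (esum_fiber size); last by move=> w _; rewrite lee_fin powR_ge0.
apply: (@le_lt_trans _ _ (((K ^+ 3 / weight g) `^ s)%:E * total s)%E); last first.
  by rewrite lte_mul_pinfty// lee_fin powR_ge0.
apply: (esum_le_inj (f := addn (size g))).
- exact: powR_ge0.
- by move=> n n' _ _ /addnI.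
- by move=> n _ /=; rewrite addn_gt0 g0.
- move=> n _; apply: periodic_sum_ge => // w Yw1 <-; rewrite -size_cat; exact: YP.
- by move=> n _; apply: esum_ge0 => x _; rewrite lee_fin powR_ge0.
Qed.

Lemma total_le s : 0 <= s ->
  (forall n x, (0 < n)%N -> X n x -> iter n F0 x = x /\ exists w, [/\ Y w, size w = n & cyl w x]) ->
  (wsum weight Y s < +oo)%E -> (total s < +oo)%E.
Proof.
move=> s0 XP; rewrite /wsum (esum_fiber size); last by move=> w _; rewrite lee_fin powR_ge0.
set t := esum _ _ => tfin.
apply: (@le_lt_trans _ _ ((K `^ s)%:E * t)%E); last first.
  by rewrite lte_mul_pinfty// lee_fin powR_ge0.
apply: (esum_le_inj (f := id)) => //.
- exact: powR_ge0.
- move=> n /= n0; apply: periodic_sum_le => // x; exact: XP.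
- by move=> n _; apply: esum_ge0 => x _; rewrite lee_fin powR_ge0.
Qed.

End Codes.

(** The letter [i] pulls an inner cylinder back into the basic interval where periodic points are
    counted, and the added tail resets the step to 0, so that words of level 0 yield periodic points
    of level 0. *)
Lemma inner_cylinder_head (psi : R -> int) i :
  (forall r : int, exists2 v, words v & word_step J F0 psi v = r) -> I i ->
  exists (g : seq nat) (a c : R), [/\ words (i :: g), 0 < a, c < 1,
    forall x, cyl (i :: g) x -> a <= x <= c & word_step J F0 psi (i :: g) = 0].
Proof.
move=> Sgen Ii; have [g [a [c [wg a0 c1 gac]]]] := inner_cylinder hF0 lam1 Hlam.
have wi := words1 Ii.
have [x [y [hx hy H]]] := cyl_hull hF0 lam1 Hlam wg wi a0 c1 gac.
have [e we Se] := Sgen (- word_step J F0 psi ([:: i] ++ g)).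
have wge : words (i :: (g ++ e)).
  by rewrite -cat1s; apply: words_cat => //; exact: words_cat.
exists (g ++ e), x, y; split => //.
- by have /andP[] := cyl_sub01 hF0 wi hx.
- by have /andP[] := cyl_sub01 hF0 wi hy.
- by move=> z hz; apply: (H e).
- by rewrite -cat1s catA word_step_cat Se subrr.
Qed.

End PeriodicSums.

Section LimSup.
Context {R : realType}.
Implicit Types u : (\bar R)^nat.

Lemma limn_esup_lt u (x : \bar R) : (limn_esup u < x)%E ->
  exists N : nat, forall n, (N <= n)%N -> (u n <= x)%E.
Proof.
move=> /ereal_inf_lt[_ [V [N _ NV] <-] Vx]; exists N => n Nn.
apply: le_trans (ltW Vx); apply: ereal_sup_ubound; exists n => //.
exact: NV.
Qed.

Lemma limn_esup_le u (x : \bar R) (N : nat) :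
  (forall n, (N <= n)%N -> (u n <= x)%E) -> (limn_esup u <= x)%E.
Proof.
move=> ux; apply: (@le_trans _ _ (ereal_sup (u @` [set n | (N <= n)%N]))).
  by apply: ereal_inf_lbound; exists [set n | (N <= n)%N] => //; exists N.
by apply: ge_ereal_sup => _ [n /= Nn <-]; exact: ux.
Qed.

Lemma nneseries_from1 (f : nat -> \bar R) : (forall n, (0 <= f n)%E) ->
  (\sum_(1 <= n <oo) f n)%E = \esum_(n in [set n | (1 <= n)%N]) f n.
Proof.
by move=> f0; rewrite eseries_cond nneseries_esum.
Qed.

End LimSup.

(** * Critical exponent and pressure of the base map *)

Section BaseExponent.
Context {R : realType} (I : set nat) (J : nat -> set R) (F0 : R -> R).
Variables (lam K : R).
Hypothesis hF0 : base_map I J F0.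
Hypothesis lam1 : 1 < lam.
Hypothesis Hlam : forall x, base_domain I J x -> lam <= `|derive1 F0 x|.
Hypothesis K1 : 1 <= K.
Hypothesis HK : forall w x y, words I w -> cyl J F0 w x -> cyl J F0 w y ->
  `|deriv_iter F0 (size w) x| <= K * `|deriv_iter F0 (size w) y|.

Local Notation cyl := (cyl J F0).
Local Notation D := (deriv_iter F0).
Local Notation words := (words I).
Local Notation D0 := (base_domain I J).
Local Notation R0 := (repeller D0 F0).
Local Notation weight := (weight J F0).

Variable (psi : R -> int).
Hypothesis Sgen : forall r : int, exists2 v, words v & word_step J F0 psi v = r.

Let b0 := weight_gt0 hF0 lam1 Hlam.
Let K0 : 0 < K. Proof. exact: lt_le_trans K1. Qed.

Let X i n : set R := periodic_points D0 F0 n `&` J i.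

Let psum i n s := \esum_(x in X i n) (`|D n x| `^ (- s))%:E.
Let lsum n s := wsum weight (words `&` [set w | size w = n]) s.

Let psum_ge0 i n s : (0 <= psum i n s)%E.
Proof. by apply: esum_ge0 => x _; rewrite lee_fin powR_ge0. Qed.

Lemma repeller_derive1_iter x n : R0 x -> derive1 (iter n F0) x = D n x.
Proof.
move=> Rx; have [w [ww <- xw]] := repeller_code hF0 n Rx.
by rewrite derive1E; have [_ ->] := cyl_is_derive hF0 ww xw.
Qed.

Let X_code i n x : (0 < n)%N -> X i n x ->
  iter n F0 x = x /\ exists w, [/\ words w, size w = n & cyl w x].
Proof. by move=> n0 [[Rx Fx] _]; split => //; exact: repeller_code. Qed.

Let X_prefix i : I i -> exists g, [/\ words g, (0 < size g)%N & forall w, words w ->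
  exists2 x, X i (size (g ++ w)) x & cyl (g ++ w) x /\ iter (size (g ++ w)) F0 x = x].
Proof.
move=> Ii; have [g [a [c [wg a0 c1 gac _]]]] := inner_cylinder_head hF0 lam1 Hlam Sgen Ii.
exists (i :: g); split => // w ww.
have [x hx Fx] := periodic_exists hF0 lam1 Hlam wg ww a0 c1 gac.
exists x => //; split; last by have [] := hx.
split => //; apply: periodic_repeller hx Fx => //; exact: words_cat.
Qed.

Let crit_sum i s : (\sum_(1 <= n <oo) \esum_(x in X i n)
     (`|derive1 (iter n F0) x| `^ (- s))%:E)%E =
  \esum_(n in [set n | (1 <= n)%N]) psum i n s.
Proof.
rewrite nneseries_from1; last by move=> n; apply: esum_ge0 => x _; rewrite lee_fin powR_ge0.
apply: eq_esum => n _; apply: eq_esum => x [[Rx _] _].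
by rewrite repeller_derive1_iter.
Qed.

Lemma base_crit_lt i s : I i -> (crit_exponent D0 F0 (J i) < s%:E)%E ->
  (wsum weight words s < +oo)%E.
Proof.
move=> Ii /ereal_inf_lt[_ [s' [s'0 fin] <-]]; rewrite lte_fin => s's.
have [g [wg g0 gX]] := X_prefix Ii.
apply: (@le_lt_trans _ _ (wsum weight words s')).
  by apply: (wsum_antimono lam1 b0 (weight_le hF0 lam1 Hlam)); [|exact: ltW].
rewrite crit_sum in fin.
exact: (@total_ge _ _ _ _ _ _ hF0 lam1 Hlam K1 HK (X i) words _ g s' s'0 wg g0 gX fin).
Qed.

Lemma base_crit_le i s : 0 <= s -> (wsum weight words s < +oo)%E ->
  (crit_exponent D0 F0 (J i) <= s%:E)%E.
Proof.
move=> s0 fin; apply: ereal_inf_lbound; exists s => //; split => //.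
rewrite crit_sum; apply: (total_le hF0 lam1 Hlam K1 HK (X := X i) (Y := words)) => //.
by move=> n x; exact: X_code.
Qed.

Local Notation P i s := (pressure I J F0 i (fun x => s * geom_potential F0 x)).

Lemma birkhoff_geom s n x : R0 x ->
  birkhoff_sum F0 (fun x => s * geom_potential F0 x) n x = - s * ln `|D n x|.
Proof.
elim: n x => [|n IH] x Rx.
  by rewrite /birkhoff_sum big_ord0 deriv_iter0 normr1 ln1 mulr0.
have RFx : R0 (F0 x).
  by apply/repellerP => k; rewrite -iterSr; have /repellerP := Rx; exact.
have dx : 0 < `|derive1 F0 x|.
  by rewrite (lt_le_trans _ (Hlam _))// ?(lt_trans ltr01)//; have /repellerP/(_ 0%N) := Rx.
have dn : 0 < `|D n (F0 x)|.
  have [w [ww <- xw]] := repeller_code hF0 n RFx.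
  exact: (deriv_iter_gt0 lam1 Hlam).
rewrite deriv_iterS normrM lnM// mulrDr -IH// /birkhoff_sum big_ord_recl/= addrC.
congr (_ + _); first by apply: eq_bigr => k _; rewrite -iterS iterSr.
by rewrite /geom_potential mulrN mulNr.
Qed.

Lemma pressureE i s : P i s =
  limn_esup (fun n => ((n%:R^-1)%:E * lne (psum i n s))%E).
Proof.
rewrite /pressure; congr limn_esup; apply/funext => n; congr (_ * lne _)%E.
apply: eq_esum => x [[Rx _] _]; rewrite birkhoff_geom//.
have dn : 0 < `|D n x|.
  have [w [ww <- xw]] := repeller_code hF0 n Rx.
  exact: (deriv_iter_gt0 lam1 Hlam).
by rewrite /powR gt_eqF.
Qed.

Lemma pressure_lt i s (c : R) : (P i s < c%:E)%E -> exists N : nat,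
  forall n, (N <= n)%N -> (psum i n s <= (expR c ^+ n)%:E)%E.
Proof.
rewrite pressureE => /limn_esup_lt[N HN]; exists N.+1 => n Nn.
have n0 : (0 < n)%N by exact: leq_ltn_trans Nn.
have nR : 0 < (n%:R : R) by rewrite ltr0n.
have h : (lne (psum i n s) <= (c * n%:R)%:E)%E.
  have := HN n (ltnW Nn); rewrite -(lee_pmul2l _ (x := n%:R%:E)) ?lte_fin//.
  by rewrite muleA -EFinM divff ?gt_eqF// mul1e -EFinM mulrC.
rewrite -expRM_natr -[leLHS]lneK ?in_itv/= ?psum_ge0 ?leey//.
by rewrite -[leRHS]/(expeR (c * n%:R)%:E) lee_expeR.
Qed.

Lemma pressure_le0 i s (N : nat) :
  (forall n, (N <= n)%N -> (psum i n s <= 1)%E) -> (P i s <= 0)%E.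
Proof.
move=> h; rewrite pressureE; apply: (limn_esup_le (N := N)) => n /h h1.
by rewrite mule_ge0_le0 ?lee_fin ?invr_ge0// lne_le0.
Qed.

Lemma lsum_le_psum i : I i -> exists g, exists2 C : R -> R, forall s, 0 <= C s & forall s n, 0 <= s ->
  (lsum n s <= (C s)%:E * psum i (size (g : seq nat) + n) s)%E.
Proof.
move=> Ii; have [g [wg g0 gX]] := X_prefix Ii.
exists g, (fun s => (K ^+ 3 / weight g) `^ s) => [s|s n s0]; first exact: powR_ge0.
apply: (periodic_sum_ge hF0 lam1 Hlam K1 HK (X := X i) (Y := words)) => // w ww sw.
by rewrite -sw -size_cat; exact: gX.
Qed.

Lemma psum_le_lsum i n s : 0 <= s -> (0 < n)%N -> (psum i n s <= (K `^ s)%:E * lsum n s)%E.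
Proof.
move=> s0 n0; apply: (periodic_sum_le hF0 lam1 Hlam K1 HK (X := X i) (Y := words)) => //.
by move=> x; exact: X_code.
Qed.

Lemma pressure_lsum_le i s (c : R) : I i -> 0 <= s -> (P i s < c%:E)%E ->
  exists (N : nat) (C : R), 0 <= C /\
    forall n, (N <= n)%N -> (lsum n s <= (C * expR c ^+ n)%:E)%E.
Proof.
move=> Ii s0 /pressure_lt[N HN]; have [g [C C0 HC]] := lsum_le_psum Ii.
exists N, (C s * expR c ^+ size g); split.
  by rewrite mulr_ge0// exprn_ge0// expR_ge0.
move=> n Nn; apply: (le_trans (HC s n s0)).
rewrite -mulrA -exprD [leRHS]EFinM; apply: lee_wpmul2l; first by rewrite lee_fin.
by apply: HN; exact: leq_trans Nn (leq_addl _ _).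
Qed.

(** Shorter words are padded to length [N] by a fixed word, at a bounded cost. *)
Lemma lsum_lty s (N : nat) : 0 <= s ->
  (forall n, (N <= n)%N -> (lsum n s < +oo)%E) -> forall n, (lsum n s < +oo)%E.
Proof.
move=> s0 HN n; have [Nn|nN] := leqP N n; first exact: HN.
have [i [_ [Ii _ _]]] := base_card hF0.
have wv := words_const (n := (N - n)%N) Ii.
apply: (@le_lt_trans _ _ (((K ^+ 2 / weight (nseq (N - n)%N i)) `^ s)%:E * lsum N s)%E).
  apply: (wsum_cat_le _ b0 (weight_cat_ge hF0 lam1 Hlam HK)) => //.
  - by rewrite exprn_gt0.
  - move=> w [ww /= sw]; split => /=; first exact: words_cat.
    by rewrite size_cat size_nseq sw subnKC// ltnW.
by rewrite lte_mul_pinfty ?lee_fin ?powR_ge0// HN.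
Qed.

Lemma wsum_words_lty s (q C : R) (N : nat) : 0 < q < 1 -> 0 <= C ->
  (forall n, (lsum n s < +oo)%E) ->
  (forall n, (N <= n)%N -> (lsum n s <= (C * q ^+ n)%:E)%E) ->
  (wsum weight words s < +oo)%E.
Proof.
move=> q01 C0 fin geo; apply: (esum_lty_geometric (lev := size) _ q01 C0 fin geo).
by move=> w _; rewrite lee_fin powR_ge0.
Qed.

(** Finite pressure at one exponent bounds the growth rate in the length by some [expR c], and a
    sufficiently larger exponent turns growth into decay. *)
Lemma base_crit_lty i s : I i -> 0 <= s -> (P i s < +oo)%E ->
  forall j, (crit_exponent D0 F0 (J j) < +oo)%E.
Proof.
move=> Ii s0 /ereal_between[c Pc _] j.
have [N [C [C0 HC]]] := pressure_lsum_le Ii s0 Pc.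
(* With [2 expR c <= lam ^+ k], raising the exponent by [k] brings the ratio down to at most
   [1 / 2]. *)
have [k Hk] := expr_unbounded (2 * expR c) lam1.
have e0 := expR_gt0 c.
have l0 := lam_gt0 lam1.
have [t [t0 ts qk]] : exists t : R, [/\ 0 <= t, s <= t & lam `^ (s - t) * expR c <= 2^-1].
  exists (s + k%:R); split; [by rewrite addr_ge0|by rewrite lerDl|].
  rewrite opprD addNKr powRN powR_mulrn ?(ltW l0)// mulrC ler_pdivrMr ?exprn_gt0//.
  lra.
apply: (@le_lt_trans _ _ t%:E); last exact: ltry.
apply: base_crit_le => //.
have geo n : (N <= n)%N -> (lsum n t <= (C * 2^-1 ^+ n)%:E)%E.
  move=> Nn; apply: (@le_trans _ _ ((lam `^ (s - t) ^+ n)%:E * lsum n s)%E).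
    apply: (esum_le_inj (f := id)) => //.
    - by rewrite exprn_ge0// powR_ge0.
    - move=> w [ww /= <-]; rewrite -EFinM lee_fin.
      exact: (b_powR_drop lam1 b0 (weight_le hF0 lam1 Hlam)).
    - by move=> w _; rewrite lee_fin powR_ge0.
  apply: (le_trans (lee_wpmul2l _ (HC n Nn))); first by rewrite lee_fin exprn_ge0// powR_ge0.
  rewrite -EFinM lee_fin mulrCA ler_wpM2l// -exprMn lerXn2r// nnegrE ?invr_ge0//.
  by rewrite mulr_ge0 ?powR_ge0// ltW.
apply: (@wsum_words_lty t 2^-1 C N) => //; first by apply/andP; split; lra.
apply: (lsum_lty (N := N)) => // n Nn.
by apply: le_lt_trans (geo n Nn) _; exact: ltry.
Qed.

Let wexp w s : words w -> weight w `^ s = expR (s * ln (weight w)).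
Proof. by move=> ww; rewrite /powR gt_eqF// b0. Qed.

(* Words of length [n] are split according to [weight w >= expR (- L n)]: below the
   threshold the exponent [s0] gains over [q ^ n], above it [d] loses little. *)
Lemma lsum_interpolation (s0 d c Q C1 C2 : R) (N : nat) : 0 <= s0 -> s0 < d -> 0 < c ->
  0 <= C1 -> 0 <= C2 ->
  (forall n, (N <= n)%N -> (lsum n d <= (C1 * expR (- c) ^+ n)%:E)%E) ->
  (forall n, (N <= n)%N -> (lsum n s0 <= (C2 * expR Q ^+ n)%:E)%E) ->
  exists2 s, s0 <= s < d & (wsum weight words s < +oo)%E.
Proof.
move=> s00 s0d c0 C10 C20 H1 H2.
have ds : 0 < d - s0 by rewrite subr_gt0.
(* [L] is so large that the gain below the threshold beats the growth rate [Q] by 1; the [e] that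
   follows is so small that its cost [e L] above the threshold uses at most half of the decay rate
   [c]. *)
have [L L0 LE] : exists2 L : R, 0 < L & (d - s0) / 2 * L = `|Q| + 1.
  exists (2 * (`|Q| + 1) / (d - s0)); first by rewrite divr_gt0// mulr_gt0// ltr_wpDl.
  by field; rewrite gt_eqF.
have [e [e0 e1 e2]] : exists e : R, [/\ 0 < e, e <= (d - s0) / 2 & e * L <= c / 2].
  exists (Num.min ((d - s0) / 2) (c / (2 * L))); split.
  - by rewrite lt_min !divr_gt0// mulr_gt0.
  - by rewrite ge_min lexx.
  - rewrite -ler_pdivlMr// ge_min; apply/orP; right.
    by rewrite invfM mulrA.
have e3 : Q + 1 <= (d - e - s0) * L.
  apply: (@le_trans _ _ (`|Q| + 1)); first by rewrite lerD2r ler_norm.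
  by rewrite -LE ler_wpM2r ?(ltW L0)//; lra.
exists (d - e); first by apply/andP; split; lra.
pose q := Num.max (expR (- (c / 2))) (expR (-1)).
have q01 : 0 < q < 1.
  by rewrite lt_max expR_gt0/= gt_max !expR_lt1; apply/andP; split; lra.
have /andP[q0 _] := q01.
have bound n : (N <= n)%N -> (lsum n (d - e) <= ((C1 + C2) * q ^+ n)%:E)%E.
  move=> Nn; have nR : 0 <= (n%:R : R) by [].
  apply: (@le_trans _ _ (\esum_(w in words `&` [set w | size w = n])
      ((expR (e * L * n%:R))%:E * (weight w `^ d)%:E +
       (expR (- (Q + 1) * n%:R))%:E * (weight w `^ s0)%:E))%E).
    apply: le_esum => w [ww /= sw]; rewrite -!EFinM -EFinD lee_fin !wexp// -!expRD.
    have [h|h] := leP (- L * n%:R) (ln (weight w)).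
      rewrite -[leLHS]addr0 lerD ?expR_ge0// ler_expR.
      have : e * (- L * n%:R) <= e * ln (weight w) by rewrite ler_wpM2l// ltW.
      lra.
    rewrite -[leLHS]add0r lerD ?expR_ge0// ler_expR.
    have : (d - e - s0) * ln (weight w) <= (d - e - s0) * (- L * n%:R).
      by rewrite ler_wpM2l ?ltW//; lra.
    have : (Q + 1) * n%:R <= (d - e - s0) * L * n%:R by rewrite ler_wpM2r.
    lra.
  rewrite esumD; last 2 first.
  - by move=> w _; rewrite mule_ge0// lee_fin ?expR_ge0 ?powR_ge0.
  - by move=> w _; rewrite mule_ge0// lee_fin ?expR_ge0 ?powR_ge0.
  rewrite mulrDl EFinD; apply: leeD.
    apply: (le_trans (esumZ_le _ _)); rewrite ?expR_ge0//.
      by move=> w _; rewrite lee_fin powR_ge0.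
    apply: (le_trans (lee_wpmul2l _ (H1 n Nn))); rewrite ?lee_fin ?expR_ge0//.
    rewrite mulrCA ler_wpM2l// -!expRM_natr -expRD.
    apply: (@le_trans _ _ (expR (- (c / 2)) ^+ n)).
      rewrite -expRM_natr ler_expR.
      have : e * L * n%:R <= c / 2 * n%:R by rewrite ler_wpM2r.
      lra.
    by rewrite lerXn2r ?nnegrE ?expR_ge0 ?(ltW q0)// le_max lexx.
  apply: (le_trans (esumZ_le _ _)); rewrite ?expR_ge0//.
    by move=> w _; rewrite lee_fin powR_ge0.
  apply: (le_trans (lee_wpmul2l _ (H2 n Nn))); rewrite ?lee_fin ?expR_ge0//.
  rewrite mulrCA ler_wpM2l// -!expRM_natr -expRD.
  apply: (@le_trans _ _ (expR (-1) ^+ n)).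
    by rewrite -expRM_natr ler_expR; lra.
  by rewrite lerXn2r ?nnegrE ?expR_ge0 ?(ltW q0)// le_max lexx orbT.
apply: (wsum_words_lty q01 (addr_ge0 C10 C20) (N := N)) => //.
apply: (lsum_lty (N := N)); first by lra.
by move=> n Nn; apply: le_lt_trans (bound n Nn) _; exact: ltry.
Qed.

(** Negative pressure at [d] means exponential decay in the length. Interpolation with the finite
    pressure at [s0 < d] would then give convergence at some exponent below the critical one. That
    [s0 < d] holds because convergence at [s0] would make its pressure non-positive, and equality
    would contradict the signs. *)
Lemma pressure_ge0 i j s0 d : I i -> I j -> 0 < s0 -> (0 < P i s0 < +oo)%E ->
  crit_exponent D0 F0 (J j) = d%:E -> (0 <= P i d)%E.
Proof.
move=> Ii Ij s00 /andP[P0 Pfin] dE.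
rewrite leNgt; apply/negP => Pd.
have s0d : s0 <= d.
  rewrite leNgt; apply/negP => ds0.
  have fin : (wsum weight words s0 < +oo)%E by apply: (base_crit_lt Ij); rewrite dE lte_fin.
  have Ks : 0 < K `^ s0 by rewrite powR_gt0.
  have [N HN] : exists N : nat, (\esum_(w in words `&` [set w | (N <= size w)%N])
      (weight w `^ s0)%:E <= ((K `^ s0)^-1)%:E)%E.
    apply: (esum_lty_tail size _ fin); last by rewrite invr_gt0.
    by move=> w; rewrite lee_fin powR_ge0.
  suff : (P i s0 <= 0)%E by rewrite leNgt P0.
  apply: (pressure_le0 (N := N.+1)) => n Nn.
  have n0 : (0 < n)%N by exact: leq_ltn_trans Nn.
  apply: (le_trans (psum_le_lsum _ (ltW s00) n0)).
  have -> : 1%E = ((K `^ s0)%:E * ((K `^ s0)^-1)%:E)%E :> \bar R.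
    by rewrite -EFinM divff// gt_eqF.
  apply: lee_wpmul2l; first by rewrite lee_fin ltW.
  apply: le_trans HN.
  by apply: wsum_subset => w [ww /= sw]; split => //=; rewrite sw ltnW.
have {}s0d : s0 < d.
  rewrite lt_neqAle s0d andbT; apply/eqP => e.
  by rewrite e in P0; have := lt_trans P0 Pd; rewrite ltxx.
have [c Pc c0] := ereal_between Pd; rewrite lte_fin in c0.
have [Q PQ _] := ereal_between Pfin.
have d0 : 0 <= d by rewrite (le_trans (ltW s00))// ltW.
have [N1 [C1 [C10 H1]]] := pressure_lsum_le Ii d0 Pc.
have [N2 [C2 [C20 H2]]] := pressure_lsum_le Ii (ltW s00) PQ.
have c0' : 0 < - c by rewrite oppr_gt0.
have [s /andP[s0s sd] fin] : exists2 s, s0 <= s < d & (wsum weight words s < +oo)%E.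
  apply: (lsum_interpolation (ltW s00) s0d c0' C10 C20 (N := maxn N1 N2) (Q := Q)) => n.
    by rewrite geq_max opprK => /andP[/H1].
  by rewrite geq_max => /andP[_ /H2].
have := base_crit_le j (le_trans (ltW s00) s0s) fin.
by rewrite dE lee_fin leNgt sd.
Qed.

End BaseExponent.

(** * The Gibbs measure and the drift *)

Section MeasurePieces.
Context d (T : measurableType d) (R : realType) (mu : {measure set T -> \bar R}).
Local Open Scope ereal_scope.

Lemma measure_le_esum (U : countType) (X : set U) (V : U -> set T) (A : set T) :
  measurable A -> (forall x, X x -> measurable (V x)) ->
  A `<=` \bigcup_(x in X) V x -> mu A <= \esum_(x in X) mu (V x).
Proof.
move=> mA mV AV.
pose W k := if pickle_inv k is Some x then if x \in X then V x else set0 else @set0 T.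
have mW k : measurable (W k).
  by rewrite /W; case: pickle_inv => [x|]//; case: ifPn => // /set_mem; exact: mV.
have Wdef x : X x -> W (pickle x) = V x by move=> Xx; rewrite /W pickleK_inv mem_set.
apply: (@le_trans _ _ (\sum_(0 <= k <oo) mu (W k))).
  apply: measure_sigma_subadditive => //.
  by move=> y /AV[x Xx Vy]; exists (pickle x); rewrite ?Wdef.
rewrite nneseries_esumT// (esumID (pickle @` X))//.
rewrite [X in _ + X]esum1 ?adde0; last first.
  move=> k [_ kX]; rewrite /W; case Ek : pickle_inv => [x|]; last exact: measure0.
  case: ifPn => [/set_mem Xx|_]; last exact: measure0.
  by exfalso; apply: kX; exists x => //; have := @pickle_invK U k; rewrite /ocancel Ek.
rewrite setTI esum_image; last by move=> x y _ _; exact: (pcan_inj (@pickleK U)).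
by apply: le_esum => x Xx; rewrite Wdef.
Qed.

Lemma measurable_fun_pieces (A : (set T)^nat) (f : T -> \bar R) (a : nat -> \bar R) :
  (forall i, measurable (A i)) -> (forall i x, A i x -> f x = a i) ->
  measurable_fun (\bigcup_i A i) f.
Proof.
move=> mA fa; apply/measurable_fun_bigcup => // i.
apply: (eq_measurable_fun (cst (a i))); last exact: measurable_cst.
by move=> x /set_mem /fa.
Qed.

Lemma integral_pieces (A : (set T)^nat) (f : T -> \bar R) (a : nat -> \bar R) :
  (forall i, measurable (A i)) -> trivIset setT A ->
  (forall i x, A i x -> f x = a i) -> (forall i, 0 <= a i) ->
  \int[mu]_(x in \bigcup_i A i) f x = \sum_(0 <= i <oo) (a i * mu (A i)).
Proof.
move=> mA tA fa a0; rewrite ge0_integral_bigcup//; last 2 first.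
- exact: measurable_fun_pieces fa.
- by move=> x [i _ /fa ->].
apply: eq_eseriesr => i _; rewrite -integral_cst//.
by apply: eq_integral => x /set_mem /fa.
Qed.

End MeasurePieces.

Section Gibbs.
Context {R : realType} (I : set nat) (J : nat -> set R) (F0 : R -> R).
Variables (lam K : R).
Hypothesis hF0 : base_map I J F0.
Hypothesis lam1 : 1 < lam.
Hypothesis Hlam : forall x, base_domain I J x -> lam <= `|derive1 F0 x|.
Hypothesis K1 : 1 <= K.
Hypothesis HK : forall w x y, words I w -> cyl J F0 w x -> cyl J F0 w y ->
  `|deriv_iter F0 (size w) x| <= K * `|deriv_iter F0 (size w) y|.

Local Notation cyl := (cyl J F0).
Local Notation D := (deriv_iter F0).
Local Notation words := (words I).
Local Notation D0 := (base_domain I J).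
Local Notation R0 := (repeller D0 F0).
Local Notation weight := (weight J F0).

Variable (psi : R -> int).
Hypothesis cpsi : constant_on_branches I J psi.

Let b0 := weight_gt0 hF0 lam1 Hlam.
Let K0 : 0 < K. Proof. exact: lt_le_trans K1. Qed.

Variables (ip : nat) (mu : probability (measurableTypeR R) R).
Hypothesis Iip : I ip.

Lemma cyl_measurable w : words w -> measurable (cyl w : set (measurableTypeR R)).
Proof. by move=> ww; apply: open_measurable; exact: (cyl_open hF0). Qed.

Lemma cyl_union_measurable (Y : set (seq nat)) : Y `<=` words ->
  measurable (\bigcup_(w in Y) cyl w : set (measurableTypeR R)).
Proof.
move=> Yw; apply: open_measurable; apply: bigcup_open => w Yw'.
by apply: (cyl_open hF0); exact: Yw.
Qed.

Lemma repeller_measurable : measurable (R0 : set (measurableTypeR R)).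
Proof.
have -> : R0 = \bigcap_n \bigcup_(w in words `&` [set w | size w = n]) cyl w.
  apply/seteqP; split => x.
    by move=> Rx n _; have [w [ww sw xw]] := repeller_code hF0 n Rx; exists w.
  move=> h; apply/repellerP => n; have [w [ww /= sw] xw] := h n.+1 Logic.I.
  by apply: (@cyl_base_domain R I J F0 w) => //; rewrite sw.
apply: bigcapT_measurable => n; apply: cyl_union_measurable; by move=> w [].
Qed.

Lemma cylE w x : words w -> cyl w x <->
  0 < x < 1 /\ forall k, (k < size w)%N -> J (nth 0%N w k) (iter k F0 x).
Proof.
elim: w x => [|i w IH] x; first by move=> _ /=; rewrite in_itv; split=> [|[]].
move=> wiw; have [Ii ww] := words_cons wiw; split.
  move=> h; split; first exact: (cyl_sub01 hF0 wiw h).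
  move: h => [Jx /(IH _ ww)[_ h]] [|k]//=; rewrite ltnS => kw.
  by rewrite -iterS iterSr; exact: h.
move=> [_ h]; have Jx : J i x := h 0%N isT; split => //=.
apply/(IH _ ww); split; first exact: (branch_onto hF0 Ii Jx).
by move=> k kw; rewrite -iterSr; exact: (h k.+1).
Qed.

(** [cyl] also asks the last iterate to lie in []0, 1[]; for a non-empty word this is automatic, as
    each branch maps into []0, 1[]. *)
Lemma cylinder_cyl w : words w -> (0 < size w)%N ->
  cylinder J F0 (fun k : 'I_(size w) => nth 0%N w k) = cyl w.
Proof.
move=> ww w0; apply/seteqP; split => x.
  move=> h; apply/(cylE _ ww); split; last by move=> k kw; exact: (h (Ordinal kw)).
  by apply: (branch_sub01 hF0 _ (h (Ordinal w0))) => /=; apply: ww; rewrite mem_nth.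
by move=> /(cylE _ ww)[_ h] k; exact: h.
Qed.

Lemma gibbs_cyl_le (d : R) : 0 <= d ->
  (0 <= pressure I J F0 ip (fun x => d * geom_potential F0 x)%R)%E ->
  gibbs_measure I J F0 ip (fun x => d * geom_potential F0 x) mu ->
  exists2 C : R, 0 < C & forall w, words w -> (0 < size w)%N ->
    (mu (cyl w) <= (C * weight w `^ d)%:E)%E.
Proof.
move=> d0 P0 [Pfin _ _ [C C1 HC]].
have Pf : pressure I J F0 ip (fun x => d * geom_potential F0 x) \is a fin_num.
  by rewrite ge0_fin_numE.
have C0 : 0 < C by exact: lt_le_trans C1.
exists (C * K `^ d); first by rewrite mulr_gt0// powR_gt0.
move=> w ww w0.
have wI (k : 'I_(size w)) : I (nth 0%N w k) by apply: ww; rewrite mem_nth.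
have [_] := andP (HC (size w) (fun k : 'I_(size w) => nth 0%N w k) w0 wI).
rewrite cylinder_cyl// => /le_trans; apply.
rewrite -mulrA EFinM; apply: lee_wpmul2l; first by rewrite lee_fin ltW.
have -> : (K `^ d * weight w `^ d)%:E = expeR (d * ln (K * weight w))%:E :> \bar R.
  have Kw : 0 < K * weight w by rewrite mulr_gt0// b0.
  by rewrite /= -powRM ?(ltW K0) ?(ltW (b0 _))// /powR gt_eqF.
rewrite lee_expeR -(fineK Pf) -EFinM leeBlDr//.
apply: (@le_trans _ _ (d * ln (K * weight w))%:E); last first.
  by rewrite -EFinD lee_fin lerDl mulr_ge0// fine_ge0.
apply: ge_ereal_sup => _ [x [hx Rx] <-].
have xw : cyl w x by rewrite -cylinder_cyl.
have Dx := deriv_iter_gt0 lam1 Hlam ww xw.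
rewrite (birkhoff_geom hF0 lam1 Hlam)// lee_fin mulNr -mulrN ler_wpM2l// -lnV ?posrE//.
rewrite ler_ln ?posrE ?invr_gt0 ?mulr_gt0 ?b0//.
exact: (deriv_le_weight hF0 lam1 Hlam HK).
Qed.

Hypothesis mu1 : mu R0 = 1%E.
Hypothesis mu_inv : forall A : set (measurableTypeR R), measurable A ->
  mu (F0 @^-1` A `&` R0) = mu A.

(** [F0] is uncontrolled off the base domain, so measurability and integrals are read off these
    countably many pieces, on which functions of the letter visited at time [k] are constant. *)
Let piece k i : set (measurableTypeR R) :=
  if i \in I then R0 `&` iter k F0 @^-1` J i else set0.

Lemma repeller_shift x : R0 x -> R0 (F0 x).
Proof. by move=> Rx; apply/repellerP => k; rewrite -iterSr; have /repellerP := Rx; exact. Qed.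

Lemma repeller_iter k x : R0 x -> R0 (iter k F0 x).
Proof. by move=> Rx; elim: k => //= k; exact: repeller_shift. Qed.

Let piece_measurable k i : measurable (piece k i).
Proof.
rewrite /piece; case: ifPn => // /set_mem Ii.
have -> : R0 `&` iter k F0 @^-1` J i =
    R0 `&` \bigcup_(w in [set w ++ [:: i] | w in words `&` [set w | size w = k]]) cyl w.
  have wi := words1 Ii; apply/seteqP; split => x [Rx /=].
    move=> Jx; split => //; have [w [ww sw xw]] := repeller_code hF0 k Rx.
    exists (w ++ [:: i]); first by exists w.
    apply/(cyl_cat hF0 _ ww wi); split => //; split; rewrite sw //=.
    by rewrite in_itv/=; exact: (branch_onto hF0 Ii Jx).
  move=> [_ [w [ww /= sw] <-]] /(cyl_cat hF0 _ ww wi)[_ [Jx _]].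
  by split => //; rewrite -sw.
apply: measurableI; first exact: repeller_measurable.
apply: cyl_union_measurable => _ [w [ww _] <-]; apply: words_cat => //; exact: words1.
Qed.

Let piece_cover k : R0 = \bigcup_i piece k i.
Proof.
apply/seteqP; split => x.
  move=> Rx; have /repellerP /(_ k)[i Ii Jx] := Rx.
  by exists i => //; rewrite /piece mem_set.
by move=> [i _]; rewrite /piece; case: ifP => // _ [].
Qed.

Let piece_disjoint k : trivIset setT (piece k).
Proof.
move=> i j _ _ [x []]; rewrite /piece; case: ifPn => // /set_mem Ii [_ Jix].
by case: ifPn => // /set_mem Ij [_ Jjx]; exact: (branch_inj hF0 Ii Ij Jix Jjx).
Qed.

Let mu_piece k i : mu (piece k i) = mu (piece 0 i).
Proof.
elim: k => // k <-; rewrite -[RHS]mu_inv//; congr (mu _).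
rewrite /piece; case: ifPn => _; last by rewrite preimage_set0 set0I.
apply/seteqP; split => x.
  by move=> [Rx Jx]; split => //; split; [exact: repeller_shift|rewrite /= -iterSr].
by move=> [[_ Jx] Rx]; split => //; rewrite /= -iterS iterSr.
Qed.

Section Observable.
Variable (f : R -> R).
Hypothesis cf : constant_on_branches I J f.
Hypothesis f0 : forall x, D0 x -> 0 <= f x.

Let val i : \bar R := if i \in I then (f (cyl_pt J F0 [:: i]))%:E else 0%E.

Let f_letter i x : I i -> J i x -> f (cyl_pt J F0 [:: i]) = f x.
Proof. by move=> Ii Jx; apply: (cf Ii) => //; have [] := cyl_ptP hF0 (words1 Ii). Qed.

Let val_piece k i x : piece k i x -> (f (iter k F0 x))%:E = val i.
Proof.
rewrite /piece /val; case: ifPn => // /set_mem Ii [_ Jx].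
by rewrite (f_letter Ii Jx).
Qed.

Let val_ge0 i : (0 <= val i)%E.
Proof.
rewrite /val; case: ifPn => // /set_mem Ii; rewrite lee_fin; apply: f0.
by exists i => //; have [] := cyl_ptP hF0 (words1 Ii).
Qed.

Lemma observable_measurable k : measurable_fun (R0 : set (measurableTypeR R))
  (fun x => (f (iter k F0 x))%:E).
Proof. rewrite (piece_cover k); apply: (measurable_fun_pieces (@piece_measurable k)); exact: val_piece. Qed.

Lemma observable_invariant k :
  (\int[mu]_(x in R0) (f (iter k F0 x))%:E = \int[mu]_(x in R0) (f x)%:E)%E.
Proof.
rewrite {1}(piece_cover k) (piece_cover 0).
rewrite (integral_pieces mu (@piece_measurable k) (@piece_disjoint k) (@val_piece k) val_ge0).
rewrite (integral_pieces mu (@piece_measurable 0) (@piece_disjoint 0) (@val_piece 0) val_ge0).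
by apply: eq_eseriesr => i _; congr (_ * _)%E; exact: mu_piece.
Qed.

(** By invariance the sum along [n] steps has integral at most [n B'], so Markov's inequality leaves
    mass at most [B' / B] where it reaches [n B]. The sum depends only on the word, so cylinders of
    the remaining words cover the rest. *)
Lemma markov_words (B B' : R) (n : nat) : (0 < n)%N -> 0 <= B' -> B' < B ->
  (\int[mu]_(x in R0) (f x)%:E <= B'%:E)%E ->
  ((1 - B' / B)%:E <= \esum_(w in words `&` [set w | size w = n /\
     (\sum_(i <- w) f (cyl_pt J F0 [:: i]) < n%:R * B)%R]) mu (cyl w))%E.
Proof.
move=> n0 B'0 B'B fB; have B0 : 0 < B by exact: le_lt_trans B'B.
set Y := words `&` _.
have Yw : Y `<=` words by move=> w [].
pose good : set (measurableTypeR R) := \bigcup_(w in Y) cyl w.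
have mgood : measurable good by exact: cyl_union_measurable.
have mR0 := repeller_measurable.
have mbad : measurable (R0 `\` good : set (measurableTypeR R)) by exact: measurableD.
have nR : 0 < (n%:R : R) by rewrite ltr0n.
have sumf w x : words w -> cyl w x ->
    \sum_(k < size w) f (iter k F0 x) = \sum_(i <- w) f (cyl_pt J F0 [:: i]).
  elim: w x => [|i w IH] x; first by rewrite big_ord0 big_nil.
  move=> /words_cons[Ii ww] [Jx xw]; rewrite big_ord_recl big_cons (f_letter Ii Jx) -(IH _ ww xw).
  by congr (_ + _); apply: eq_bigr => k _; rewrite -iterSr.
have bad_le : ((n%:R * B)%:E * mu (R0 `\` good) <= (n%:R * B')%:E)%E.
  rewrite -(integral_cst mu mbad).
  apply: (@le_trans _ _ (\int[mu]_(x in R0 `\` good) \sum_(k <- index_iota 0 n) (f (iter k F0 x))%:E)%E).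
    apply: ge0_le_integral => //.
    - by move=> x _; rewrite lee_fin mulr_ge0// ltW.
    - apply: emeasurable_sum => k; apply: (measurable_funS mR0 _ (observable_measurable k)).
      by move=> x [].
    - move=> x [Rx nx]; rewrite sumEFin lee_fin leNgt; apply/negP => h; apply: nx.
      have [w [ww sw xw]] := repeller_code hF0 n Rx.
      exists w => //; split => //; split => //.
      by move: h; rewrite -(sumf _ _ ww xw) sw big_mkord.
  apply: (@le_trans _ _ (\int[mu]_(x in R0) \sum_(k <- index_iota 0 n) (f (iter k F0 x))%:E)%E).
    apply: ge0_subset_integral => //.
    - by apply: emeasurable_sum => k; exact: observable_measurable.
    - move=> x Rx; apply: sume_ge0 => k _; rewrite lee_fin; apply: f0.
      by have /repellerP := Rx; exact.
  rewrite ge0_integral_sum//; last 2 first.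
  - by move=> k; exact: observable_measurable.
  - move=> k x Rx; rewrite lee_fin; apply: f0; by have /repellerP := Rx; exact.
  under eq_bigr do rewrite observable_invariant.
  apply: (@le_trans _ _ (\sum_(k <- index_iota 0 n) B'%:E)%E); first exact: lee_sum.
  by rewrite sumEFin lee_fin big_const_nat subn0 iter_addr_0 mulr_natl.
have cov : (1 <= mu (R0 `\` good) + mu good)%E.
  rewrite -mu1; apply: (@le_trans _ _ (mu ((R0 `\` good) `|` good))).
    apply: le_measure; rewrite ?inE//; first exact: measurableU.
    by move=> x Rx; have [gx|gx] := pselect (good x); [right|left].
  exact: measureU2.
have gle : (mu good <= \esum_(w in Y) mu (cyl w))%E.
  apply: (measure_le_esum mu mgood) => // w Yw'; apply: cyl_measurable; exact: Yw.
apply: (le_trans _ gle).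
have fb : mu (R0 `\` good) \is a fin_num by exact: fin_num_measure.
have fg : mu good \is a fin_num by exact: fin_num_measure.
rewrite -(fineK fb) -(fineK fg) -?EFinM -?EFinD !lee_fin in bad_le cov *.
have : fine (mu (R0 `\` good)) <= B' / B.
  rewrite ler_pdivlMr// -(ler_pM2l nR); apply: le_trans bad_le.
  by rewrite mulrCA mulrC.
lra.
Qed.

End Observable.

End Gibbs.

Lemma addr_ge1 (e a c : int) : - e < a -> e <= c -> 1 <= a + c.
Proof. lia. Qed.

Lemma le_absz (z : int) (n : nat) : (`|z| <= n)%N -> z <= n%:Z.
Proof. lia. Qed.

(** * Letters, mean drift and the weight of drifting words *)

Section Letters.
Context {R : realType} (I : set nat) (J : nat -> set R) (F0 : R -> R).
Hypothesis hF0 : base_map I J F0.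
Local Notation words := (words I).
Local Notation D0 := (base_domain I J).
Variable (psi : R -> int).
Hypothesis hpsi : step_function I J psi.
Local Notation S := (word_step J F0 psi).

Let cpsi : constant_on_branches I J psi. Proof. by have [] := hpsi. Qed.

Lemma step_ge x : D0 x -> -1 <= psi x.
Proof.
move=> Dx; have [_ inf_psi _] := hpsi.
have : ((-1)%:E <= ((psi x)%:~R : R)%:E)%E.
  by rewrite -inf_psi; apply: ereal_inf_lbound; exists x.
by rewrite lee_fin -(ler_int R) rmorphN1.
Qed.

Lemma letter_down : exists2 i, I i & psi (cyl_pt J F0 [:: i]) = -1.
Proof.
have [_ inf_psi _] := hpsi.
have : (ereal_inf [set ((psi x)%:~R : R)%:E | x in D0] < 0)%E by rewrite inf_psi lte_fin ltrN10.
move=> /ereal_inf_lt[_ [x [i Ii Jx] <-]]; rewrite lte_fin ltrz0 => px.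
exists i => //; rewrite (letter_step hF0 cpsi Ii Jx).
have := step_ge (branch_dom Ii Jx); lia.
Qed.

Lemma letter_up : exists2 i, I i & 1 <= psi (cyl_pt J F0 [:: i]).
Proof.
have [_ _] := hpsi.
move=> /ereal_sup_gt[_ [x [i Ii Jx] <-]]; rewrite lte_fin ltr0z => px.
by exists i => //; rewrite (letter_step hF0 cpsi Ii Jx).
Qed.

Lemma word_step_nseq n i : S (nseq n i) = psi (cyl_pt J F0 [:: i]) *+ n.
Proof. by rewrite /word_step big_nseq iter_addr_0. Qed.

Lemma word_step_surj (r : int) : exists2 v, words v & S v = r.
Proof.
have [d Id pd] := letter_down; have [u Iu pu] := letter_up.
have [r0|r0] := leP 0 r; last first.
  exists (nseq `|r|%N d); first exact: words_const.
  by rewrite word_step_nseq pd; lia.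
pose p := psi (cyl_pt J F0 [:: u]).
(* With [r] letters of step [p] and [(p - 1) r] letters of step -1 the total is
   [r p - (p - 1) r = r]. *)
exists (nseq (`|p - 1|%N * `|r|%N)%N d ++ nseq `|r|%N u).
  by apply: words_cat; exact: words_const.
rewrite word_step_cat !word_step_nseq pd -/p.
have -> : (-1 : int) *+ (`|p - 1|%N * `|r|%N) = - ((p - 1) * r).
  by rewrite mulNrn natz PoszM !gez0_abs// subr_ge0.
by rewrite -mulr_natr natz gez0_abs//; ring.
Qed.

End Letters.

Section Drift.
Context {R : realType} (I : set nat) (J : nat -> set R) (F0 : R -> R).
Variables (lam K : R).
Hypothesis hF0 : base_map I J F0.
Hypothesis lam1 : 1 < lam.
Hypothesis Hlam : forall x, base_domain I J x -> lam <= `|derive1 F0 x|.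
Hypothesis K1 : 1 <= K.
Hypothesis HK : forall w x y, words I w -> cyl J F0 w x -> cyl J F0 w y ->
  `|deriv_iter F0 (size w) x| <= K * `|deriv_iter F0 (size w) y|.

Local Notation cyl := (cyl J F0).
Local Notation words := (words I).
Local Notation D0 := (base_domain I J).
Local Notation R0 := (repeller D0 F0).
Local Notation weight := (weight J F0).

Variable (psi : R -> int).
Hypothesis hpsi : step_function I J psi.
Local Notation S := (word_step J F0 psi).

Let b0 := weight_gt0 hF0 lam1 Hlam.
Let K0 : 0 < K. Proof. exact: lt_le_trans K1. Qed.

Let cpsi : constant_on_branches I J psi. Proof. by have [] := hpsi. Qed.

Variable (mu : probability (measurableTypeR R) R).
Hypothesis mu1 : mu R0 = 1%E.
Hypothesis mu_inv : forall A : set (measurableTypeR R), measurable A ->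
  mu (F0 @^-1` A `&` R0) = mu A.

Let alpha := (\int[mu]_(x in R0) ((psi x)%:~R)%:E)%E.

Let mR0 : measurable (R0 : set (measurableTypeR R)) := repeller_measurable hF0.

Let pmeas (h : int -> R) : measurable_fun (R0 : set (measurableTypeR R))
  (fun x => (h (psi x))%:E).
Proof.
by apply: (observable_measurable hF0 (f := fun x => h (psi x)) _ 0) => i Ii x y Jx Jy;
   rewrite (cpsi Ii Jx Jy).
Qed.

Let R0_ge x : R0 x -> -1 <= psi x.
Proof. by move=> /repellerP /(_ 0%N); exact: (step_ge hpsi). Qed.

Let R0_geR x : R0 x -> -1 <= (psi x)%:~R :> R.
Proof. by move=> /R0_ge; rewrite -(ler_int R) rmorphN1. Qed.

Let neg_part := (\int[mu]_(x in R0) (Num.max (- (psi x)%:~R) 0)%:E)%E.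
Let pos_part := (\int[mu]_(x in R0) (Num.max ((psi x)%:~R) 0)%:E)%E.
(** As steps are at least -1, [psi + 1] is non-negative and its integral makes sense even when
    infinite; the sign of [alpha] becomes the comparison of this integral with 1. *)
Let shifted := (\int[mu]_(x in R0) ((psi x)%:~R + 1)%:E)%E.

Let alphaE : alpha = (pos_part - neg_part)%E.
Proof.
rewrite /alpha integralE /pos_part /neg_part; congr (_ - _)%E;
  apply: eq_integral => x _.
  by rewrite funeposE -EFin_max.
by rewrite funenegE -EFin_max.
Qed.

Let neg_part_fin : neg_part \is a fin_num.
Proof.
rewrite ge0_fin_numE; last by apply: integral_ge0 => x _; rewrite lee_fin le_max lexx orbT.
apply: (@le_lt_trans _ _ (\int[mu]_(x in R0) (cst 1%E x))%E); last first.
  by rewrite integral_cst// mul1e [X in (X < _)%E]mu1 ltry.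
apply: ge0_le_integral => //.
- exact: (pmeas (fun z => Num.max (- z%:~R) 0)).
- by move=> x /R0_geR h; rewrite lee_fin ge_max ler01 andbT lerNl.
Qed.

Let shiftedE : (shifted + neg_part = pos_part + 1)%E.
Proof.
have one : 1%E = (\int[mu]_(x in R0) (cst 1%E x))%E by rewrite integral_cst// mul1e; exact: esym mu1.
rewrite [X in _ = (_ + X)%E]one /shifted /neg_part /pos_part.
rewrite -!ge0_integralD//.
- apply: eq_integral => x _ /=; rewrite -!EFinD; congr EFin.
  set z := (psi x)%:~R : R.
  have [h|/ltW h] := lerP 0 z.
    by rewrite max_r ?oppr_le0//; lra.
  by rewrite max_l ?oppr_ge0//; lra.
- exact: (pmeas (fun z => Num.max (z%:~R) 0)).
- by move=> x /R0_geR h; rewrite lee_fin -lerBlDr sub0r.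
- exact: (pmeas (fun z => z%:~R + 1)).
- exact: (pmeas (fun z => Num.max (- z%:~R) 0)).
Qed.

Let pos_ge0 : (0 <= pos_part)%E.
Proof. by apply: integral_ge0 => x _; rewrite lee_fin le_max lexx orbT. Qed.

Let shifted_le1 : (0 <= - alpha)%E -> (shifted <= 1)%E.
Proof.
move: shiftedE pos_ge0; rewrite alphaE oppeB; last by rewrite fin_num_adde_defl// fin_numN.
rewrite -(fineK neg_part_fin); case: pos_part => [a| |]; case: shifted => [b| |] //=.
by move=> -[e] _; rewrite !lee_fin; lra.
Qed.

Let shifted_ge1 : (0 <= alpha)%E -> (1 <= shifted)%E.
Proof.
move: shiftedE pos_ge0; rewrite alphaE.
rewrite -(fineK neg_part_fin); case: pos_part => [a| |]; case: shifted => [b| |] //=;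
  rewrite ?leey//.
by move=> -[e] _; rewrite !lee_fin; lra.
Qed.

(** Markov's inequality for upward drift needs a step bounded above. By monotone convergence a
    truncation keeps the mean above [- e], also when [alpha] is infinite. *)
Let trunc_integral (e : R) : 0 < e -> (0 <= alpha)%E -> exists N : nat,
  ((1 - e)%:E <= \int[mu]_(x in R0) (Num.min (psi x)%:~R N%:R + 1)%:E)%E.
Proof.
move=> e0 /shifted_ge1 sh1.
pose g n (x : measurableTypeR R) := (Num.min (psi x)%:~R n%:R + 1 : R)%:E.
have mg n : measurable_fun (R0 : set (measurableTypeR R)) (g n).
  exact: (pmeas (fun z => Num.min z%:~R n%:R + 1)).
have g0 n x : R0 x -> (0 <= g n x)%E.
  move=> /R0_geR h; rewrite lee_fin -lerBlDr sub0r le_min h /=.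
  by apply: (@le_trans _ _ 0) => //; rewrite lerN10.
have ndg x : R0 x -> {homo g^~ x : n m / (n <= m)%N >-> (n <= m)%E}.
  move=> _ n m nm; rewrite lee_fin lerD2r le_min ge_min lexx /= ge_min ler_nat nm orbT.
  by [].
have gl x : limn (g^~ x) = ((psi x)%:~R + 1)%:E.
  apply: lim_near_cst => //.
  exists `|psi x|%N => // n /= hn; rewrite /g min_l// -[n%:R]/(n%:Z%:~R) ler_int.
  exact: le_absz hn.
have cv := @cvg_monotone_convergence _ _ _ mu _ mR0 _ mg g0 ndg.
apply: contrapT => /forallNP nN.
have : (shifted <= (1 - e)%:E)%E.
  rewrite /shifted; under eq_integral do rewrite -gl.
  rewrite -(cvg_lim _ cv)//; apply: lime_le; first by apply/cvg_ex; eexists; exact: cv.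
  by apply: nearW => n; rewrite leNgt; apply/negP => /ltW; exact: nN.
move=> /(le_trans sh1); rewrite lee_fin; lra.
Qed.

Let sum_step (c : R) w : \sum_(i <- w) ((psi (cyl_pt J F0 [:: i]))%:~R + c) =
  (S w)%:~R + (size w)%:R * c.
Proof.
elim: w => [|i w IH]; first by rewrite /word_step !big_nil mul0r addr0.
by rewrite big_cons IH /word_step big_cons rmorphD /= -natr1; ring.
Qed.

(** Upwards, Markov's inequality is applied to the defect [N - min psi N] at level [N + eps], its
    mean being at most [N + eps / 2]; downwards, to [psi + 1] at level [1 + eps], its mean being at
    most 1. *)
Lemma drift_mass (sg : int) : (sg = 1 /\ (0 <= alpha)%E) \/ (sg = -1 /\ (0 <= - alpha)%E) ->
  forall eps : R, 0 < eps -> exists2 kappa : R, 0 < kappa & forall n : nat, (0 < n)%N ->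
  (kappa%:E <= \esum_(w in words `&` [set w | size w = n /\
     (- (eps * n%:R) <= (sg * S w)%:~R)%R]) mu (cyl w))%E.
Proof.
move=> [] [-> al] eps eps0.
- have e2 : 0 < eps / 2 by rewrite divr_gt0.
  have [N HN] := trunc_integral e2 al.
  pose f x : R := N%:R - Num.min (psi x)%:~R N%:R.
  have cf : constant_on_branches I J f by move=> i Ii x y Jx Jy; rewrite /f (cpsi Ii Jx Jy).
  have f0 x : D0 x -> 0 <= f x by move=> _; rewrite subr_ge0 ge_min lexx orbT.
  have N0 : 0 <= (N%:R : R) by [].
  have fint : (\int[mu]_(x in R0) (f x)%:E <= (N%:R + eps / 2)%:E)%E.
    have E : (\int[mu]_(x in R0) (f x)%:E + \int[mu]_(x in R0) (Num.min (psi x)%:~R N%:R + 1 : R)%:E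
        = (N%:R + 1 : R)%:E)%E.
      rewrite -ge0_integralD//.
      - transitivity (\int[mu]_(x in R0) (cst (N%:R + 1 : R)%:E x))%E.
          by apply: eq_integral => x _ /=; rewrite -EFinD; congr EFin; rewrite /f; ring.
        rewrite integral_cst//; transitivity ((N%:R + 1 : R)%:E * 1)%E; last by rewrite mule1.
        by congr (_ * _)%E; exact: mu1.
      - by move=> x /repellerP /(_ 0%N) Dx; rewrite lee_fin f0.
      - exact: (pmeas (fun z => N%:R - Num.min z%:~R N%:R)).
      - move=> x /R0_geR h; rewrite lee_fin -lerBlDr sub0r le_min h /=.
        by apply: (@le_trans _ _ 0) => //; rewrite lerN10.
      - exact: (pmeas (fun z => Num.min z%:~R N%:R + 1)).
    have : (0 <= \int[mu]_(x in R0) (f x)%:E)%E.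
      by apply: integral_ge0 => x /repellerP /(_ 0%N) Dx; rewrite lee_fin f0.
    move: E HN; case: (\int[mu]_(x in R0) (f x)%:E)%E => [a| |];
      case: (\int[mu]_(x in R0) (Num.min _ _ + 1)%:E)%E => [b| |] //=.
    by move=> -[e]; rewrite !lee_fin; lra.
  exists (1 - (N%:R + eps / 2) / (N%:R + eps)).
    by rewrite subr_gt0 ltr_pdivrMr ?mul1r; lra.
  move=> n n0.
  have B0 : 0 <= N%:R + eps / 2 by lra.
  have BB : N%:R + eps / 2 < N%:R + eps by lra.
  apply: (le_trans (markov_words hF0 mu1 mu_inv cf f0 n0 B0 BB fint)).
  apply: esum_le_subset => w [ww [sw hw]]; split => //; split => //.
  have : n%:R * N%:R - (S w)%:~R <= \sum_(i <- w) f (cyl_pt J F0 [:: i]).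
    have := sum_step (- N%:R) w; rewrite sw => hs.
    have -> : n%:R * N%:R - (S w)%:~R = - \sum_(i <- w) ((psi (cyl_pt J F0 [:: i]))%:~R - N%:R) :> R.
      by rewrite hs; ring.
    rewrite -sumrN; apply: ler_sum => i _; rewrite /f opprB lerD2l lerN2.
    by rewrite ge_min lexx.
  by move: hw; rewrite mul1r mulrDr [eps * _]mulrC; lra.
- pose f x : R := (psi x)%:~R + 1.
  have cf : constant_on_branches I J f by move=> i Ii x y Jx Jy; rewrite /f (cpsi Ii Jx Jy).
  have f0 x : D0 x -> 0 <= f x.
    by move=> /(step_ge hpsi) h; rewrite /f -lerBlDr sub0r -[X in - X]/(1%:~R) -rmorphN ler_int.
  exists (1 - 1 / (1 + eps)).
    by rewrite subr_gt0 ltr_pdivrMr ?mul1r; lra.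
  move=> n n0.
  have BB : 1 < 1 + eps by rewrite ltrDl.
  apply: (le_trans (markov_words hF0 mu1 mu_inv cf f0 n0 ler01 BB (shifted_le1 al))).
  apply: esum_le_subset => w [ww [sw hw]]; split => //; split => //.
  move: hw; rewrite sum_step sw mulN1r rmorphN /= mulr1 mulrDr mulr1 [eps * _]mulrC; lra.
Qed.

(* Among the words of length [n] with [sg * S w >= - eps n], of [mu]-mass bounded below,
   the exponent [s < d] gains an exponential factor; appending about [eps n] copies
   of a letter of the right sign costs less than that. *)
Lemma drift_weight (sg : int) (d s C : R) :
  (sg = 1 /\ (0 <= alpha)%E) \/ (sg = -1 /\ (0 <= - alpha)%E) ->
  0 <= s -> s < d -> 0 < C ->
  (forall w, words w -> (0 < size w)%N -> (mu (cyl w) <= (C * weight w `^ d)%:E)%E) ->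
  forall Lam : R, exists n,
    (Lam%:E < wsum weight (words `&` [set w | size w = n /\ (1 <= sg * S w)%R]) s)%E.
Proof.
move=> hsg s0 sd C0 HC Lam.
have [i Ii pi] : exists2 i, I i & 1 <= sg * psi (cyl_pt J F0 [:: i]).
  case: hsg => [[-> _]|[-> _]].
    by have [i Ii h] := letter_up hF0 hpsi; exists i; rewrite // mul1r.
  by have [i Ii h] := letter_down hF0 hpsi; exists i; rewrite // h.
have bcat := weight_cat_ge hF0 lam1 Hlam HK.
have K20 : 0 < K ^+ 2 by rewrite exprn_gt0.
have bi : 0 < weight [:: i] by apply: b0; exact: words1.
pose eta := weight [:: i] / K ^+ 2.
have eta0 : 0 < eta by rewrite divr_gt0.
have eta1 : eta <= 1.
  rewrite ler_pdivrMr// mul1r (le_trans (b_le1 lam1 (weight_le hF0 lam1 Hlam) _))//.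
    exact: words1.
  by rewrite exprn_ege1.
have lnl : 0 < ln lam by rewrite ln_gt0.
pose h := (d - s) * ln lam / 2.
have h0 : 0 < h by rewrite divr_gt0// mulr_gt0// subr_gt0.
have leta : ln eta <= 0 by rewrite -ln1 ler_ln ?posrE.
(* [h] is half of the exponential gain [(d - s) * ln lam]. Appending [eps n] letters costs at most
   [h n] in the exponent, so a factor [expR (h n)] survives; the summand 1 keeps the denominator
   positive. *)
pose eps := h / (1 - s * ln eta).
have den : 0 < 1 - s * ln eta.
  have : s * ln eta <= 0 by rewrite mulr_ge0_le0.
  lra.
have eps0 : 0 < eps by rewrite divr_gt0.
have epsle : - (s * ln eta) * eps <= h.
  by rewrite /eps mulrA ler_pdivrMr// mulrC ler_wpM2l ?(ltW h0)//; lra.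
have [kappa kappa0 Hk] := drift_mass hsg eps0.
have w0 : words [::] by [].
have b00 : weight [::] = 1 by rewrite /weight deriv_iter0 normr1 invr1.
have [n0 Hn0] : exists n : nat,
    (`|Lam| + 1) * (K ^+ 2 / eta) `^ s * C / kappa <= expR h ^+ n.
  by apply: expr_unbounded; rewrite expR_gt1.
(* [m = q + 1] exceeds [eps n] strictly, so the appended letters lift a signed step of at least
   [- eps n] to at least 1. *)
pose n := n0.+1; pose q := Num.truncn (eps * n%:R); pose m := q.+1.
have en0 : 0 <= eps * n%:R by rewrite mulr_ge0// ltW.
have /andP[q1 q2] := truncn_itv en0; rewrite -/q -/m in q1 q2.
have wv : words (nseq m i) by exact: words_const.
exists (n + m)%N; set Tg := words `&` [set w | size w = (n + m)%N /\ _].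
pose Y := words `&` [set w | size w = n /\ - (eps * n%:R) <= (sg * S w)%:~R].
have massY : (kappa%:E <= (C * lam `^ (s - d) ^+ n)%:E * wsum weight Y s)%E.
  apply: (le_trans (Hk n (ltn0Sn _))).
  apply: (esum_le_inj (f := id)) => //.
  - by rewrite mulr_ge0 ?(ltW C0)// exprn_ge0// powR_ge0.
  - move=> w [ww [sw _]]; rewrite -EFinM.
    apply: (le_trans (HC w ww _)); first by rewrite sw.
    rewrite lee_fin -mulrA ler_wpM2l ?(ltW C0)// -sw.
    exact: (b_powR_drop lam1 b0 (weight_le hF0 lam1 Hlam) ww (ltW sd)).
  - by move=> w _; rewrite lee_fin powR_ge0.
have YT : (wsum weight Y s <= ((K ^+ 2 / weight (nseq m i)) `^ s)%:E * wsum weight Tg s)%E.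
  apply: (wsum_cat_le K20 b0 bcat s0 wv); first by move=> w [].
  move=> w [ww [sw hw]]; split; first exact: words_cat.
  split; first by rewrite size_cat size_nseq sw.
  rewrite word_step_cat word_step_nseq mulrDr mulrnAr.
  apply: (@addr_ge1 m%:Z).
    rewrite -(ltr_int R) rmorphN /=; apply: lt_le_trans hw; rewrite ltrN2.
    exact: q2.
  by rewrite -natz lerMn2r pi orbT.
have bv : 0 < weight (nseq m i) by exact: b0.
have lnv : m%:R * ln eta <= ln (weight (nseq m i)).
  have := b_nseq_ge K20 b0 bcat m Ii; rewrite b00 mulr1 -/eta => hm.
  by rewrite mulr_natl -lnXn// ler_ln ?posrE ?exprn_gt0.
clearbody eta.
have factor : lam `^ (s - d) ^+ n * (K ^+ 2 / weight (nseq m i)) `^ s <=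
    (K ^+ 2 / eta) `^ s * expR (- (h * n%:R)).
  have Kv : 0 < K ^+ 2 / weight (nseq m i) by rewrite divr_gt0.
  have Ke : 0 < K ^+ 2 / eta by rewrite divr_gt0.
  rewrite -powR_mulrn ?powR_ge0// -powRrM /powR !gt_eqF ?(lam_gt0 lam1)//.
  rewrite -!expRD ler_expR !ln_div ?posrE//.
  have -> : (s - d) * n%:R * ln lam = - (2 * h * n%:R) by rewrite /h; field.
  have k1 : s * (m%:R * ln eta) <= s * ln (weight (nseq m i)) by rewrite ler_wpM2l.
  have k2 : - (s * ln eta) * q%:R <= h * n%:R.
    apply: (@le_trans _ _ (- (s * ln eta) * (eps * n%:R))).
      by rewrite ler_wpM2l// oppr_ge0 mulr_ge0_le0.
    by rewrite mulrA ler_wpM2r.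
  rewrite /m -natr1 mulrDl mulrDr mul1r in k1.
  have : s * (q%:R * ln eta) = - (- (s * ln eta) * q%:R) by ring.
  move: k1 k2; move: (s * (q%:R * ln eta)) (- (s * ln eta) * q%:R) => u1 u2.
  rewrite !mulrBr; move: (s * ln (K ^+ 2)) (s * ln eta) (s * ln (weight _)) => v1 v2 v3.
  have -> : 2 * h * n%:R = h * n%:R + h * n%:R by ring.
  move: (h * n%:R) => hn; lra.
rewrite ltNge; apply/negP => WLam.
have : (kappa%:E <= (C * (K ^+ 2 / eta) `^ s * expR (- (h * n%:R)) * `|Lam|)%:E)%E.
  apply: (le_trans massY).
  have c1 : 0 <= C * lam `^ (s - d) ^+ n by rewrite mulr_ge0 ?(ltW C0)// exprn_ge0// powR_ge0.
  apply: (le_trans (lee_wpmul2l _ YT)) => //.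
  have WL : (wsum weight Tg s <= `|Lam|%:E)%E.
    by apply: (le_trans WLam); rewrite lee_fin ler_norm.
  rewrite muleA -EFinM; apply: (le_trans (lee_wpmul2l _ WL)).
    by rewrite lee_fin mulr_ge0// powR_ge0.
  rewrite -EFinM lee_fin; apply: ler_wpM2r => //.
  by rewrite -!(mulrA C); apply: ler_wpM2l => //; exact: ltW.
rewrite lee_fin leNgt => /negP; apply.
have en : expR (h * n%:R) * expR (- (h * n%:R)) = 1 by rewrite -expRD subrr expR0.
have ep : 0 < expR (h * n%:R) by exact: expR_gt0.
have Hn : (`|Lam| + 1) * (K ^+ 2 / eta) `^ s * C <= kappa * expR (h * n%:R).
  rewrite -ler_pdivrMl// mulrC; apply: (le_trans Hn0).
  by rewrite expRM_natr ler_eXn2l// expR_gt1.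
have Ap : 0 < (K ^+ 2 / eta) `^ s * C.
  by apply: mulr_gt0 => //; apply: powR_gt0; exact: divr_gt0.
rewrite -(ltr_pM2r ep); apply: lt_le_trans Hn.
have -> : C * (K ^+ 2 / eta) `^ s * expR (- (h * n%:R)) * `|Lam| * expR (h * n%:R) =
    (K ^+ 2 / eta) `^ s * C * `|Lam| * (expR (h * n%:R) * expR (- (h * n%:R))) by ring.
rewrite en mulr1 -[ltRHS]mulrA [ltRHS]mulrC ltr_pM2l//.
by rewrite ltrDl.
Qed.

End Drift.

(** * Skew products *)

Section Divergence.
Context {R : realType}.
Implicit Types u : nat -> R.

Lemma limn_esup_ninftyP u : limn_esup (fun n => (u n)%:E) = -oo%E <->
  forall M : R, exists N : nat, forall n, (N <= n)%N -> u n <= M.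
Proof.
split=> [h M|h].
  have : (limn_esup (fun n => (u n)%:E) < M%:E)%E by rewrite h ltNyr.
  by move=> /limn_esup_lt[N HN]; exists N => n /HN; rewrite lee_fin.
apply/eq_ninfty => M.
have [N HN] := h M; apply: (limn_esup_le (N := N)) => n /HN; by rewrite lee_fin.
Qed.

Lemma limn_einf_pinftyP u : limn_einf (fun n => (u n)%:E) = +oo%E <->
  forall M : R, exists N : nat, forall n, (N <= n)%N -> M <= u n.
Proof.
have E : limn_einf (fun n => (u n)%:E) = (- limn_esup (fun n => (- u n)%:E))%E.
  by rewrite -limn_einfN; congr limn_einf; apply/funext => n /=; rewrite opprK.
rewrite E; split=> [h M|h].
  have h' : limn_esup (fun n => (- u n)%:E) = -oo%E.
    by apply: oppe_inj; rewrite h.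
  have [N HN] := (limn_esup_ninftyP (fun n => - u n)).1 h' (- M).
  by exists N => n /HN; rewrite lerN2.
suff -> : limn_esup (fun n => (- u n)%:E) = -oo%E by [].
apply/limn_esup_ninftyP => M; have [N HN] := h (- M).
by exists N => n /HN; rewrite lerNl.
Qed.

End Divergence.

Section SkewProducts.
Context {R : realType} (I : set nat) (J : nat -> set R) (F0 : R -> R).
Hypothesis hF0 : base_map I J F0.

Local Notation cyl := (cyl J F0).
Local Notation D := (deriv_iter F0).
Local Notation words := (words I).
Local Notation D0 := (base_domain I J).
Local Notation R0 := (repeller D0 F0).
Local Notation S psi := (word_step J F0 psi).

Variables (psi : R -> int) (psi1 : R -> nat).
Hypothesis cpsi : constant_on_branches I J psi.

Local Notation DZ := (domZ I J).
Local Notation DN := (domN I J).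
Local Notation fZ := (FZ F0 psi).
Local Notation fN := (FN F0 psi psi1).
Local Notation path := (path_sum F0 psi).

Lemma domain01 y : D0 y -> 0 < y < 1.
Proof. by move=> [i Ii Jy]; exact: (branch_sub01 hF0 Ii Jy). Qed.

Lemma domain_image01 y : D0 y -> 0 < F0 y < 1.
Proof. by move=> [i Ii Jy]; exact: (branch_onto hF0 Ii Jy). Qed.

Lemma floor01 (y : R) (k : int) : 0 < y < 1 -> Num.floor (y + k%:~R) = k.
Proof.
move=> /andP[y0 y1]; apply/floor_def; rewrite rmorphD /=.
by apply/andP; split; [rewrite lerDr ltW|rewrite addrC ltrD2l].
Qed.

Lemma split01 (y y' : R) (k k' : int) : 0 < y < 1 -> 0 < y' < 1 ->
  y + k%:~R = y' + k'%:~R -> y = y' /\ k = k'.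
Proof.
move=> h h' e; have kk : k = k' by rewrite -(floor01 k h) e floor01.
by split => //; apply: (addIr k%:~R); rewrite e kk.
Qed.

Lemma domZP y k : 0 < y < 1 -> DZ (y + k%:~R) <-> D0 y.
Proof.
move=> y01; split=> [[y' Dy' [k' _ e]]|Dy]; last by exists y => //; exists k.
by have [<-] := split01 (domain01 Dy') y01 e.
Qed.

Lemma fZE y k : D0 y -> fZ (y + k%:~R) = F0 y + (psi y + k)%:~R.
Proof.
by move=> Dy; rewrite /FZ floor01 ?domain01// addrK rmorphD /= addrA.
Qed.

Lemma iter_fZ n y k : (forall j, (j < n)%N -> D0 (iter j F0 y)) ->
  iter n fZ (y + k%:~R) = iter n F0 y + (path n y + k)%:~R.
Proof.
elim: n y k => [|n IH] y k Dy; first by rewrite /path_sum big_ord0 add0r.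
have Dy0 : D0 y := Dy 0%N isT.
rewrite !iterSr fZE// IH; last by move=> j jn; rewrite -iterSr; exact: Dy.
by rewrite path_sumS; congr (_ + _%:~R); ring.
Qed.

Lemma repeller_fZ y k : R0 y -> repeller DZ fZ (y + k%:~R).
Proof.
move=> /repellerP Ry n _ /=; rewrite iter_fZ//.
by apply/domZP => //; exact: domain01.
Qed.

Lemma repeller_fZ_split x : repeller DZ fZ x -> exists y k, R0 y /\ x = y + k%:~R.
Proof.
move=> Rx; have [y Dy [k _ xE]] := Rx 0%N Logic.I; rewrite /= in xE.
exists y, k; split => //; apply/repellerP => n.
suff : forall j, (j <= n)%N -> D0 (iter j F0 y) by apply.
elim: n => [|n IH] j; first by rewrite leqn0 => /eqP ->.
rewrite leq_eqVlt ltnS => /predU1P[->|]; last exact: IH.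
have := Rx n.+1 Logic.I; rewrite /= -iterS -xE iter_fZ//.
by move=> /domZP; apply; exact: domain_image01 (IH n (leqnn n)).
Qed.

Lemma drift_pos y k : drift_set I J F0 psi 1 y <-> transient_pos DZ fZ (y + k%:~R) /\ R0 y.
Proof.
split=> [[Ry h]|[[Rx h] Ry]].
  split => //; split; first exact: repeller_fZ.
  apply/limn_einf_pinftyP => M; have [N HN] := h (Num.ceil M - k).
  exists N => n /HN; rewrite mul1r iter_fZ; last by move=> j _; have /repellerP := Ry; exact.
  move=> hn; apply: (le_trans (ceil_ge M)).
  have /repellerP /(_ n) /domain01 /andP[/ltW y0 _] := Ry.
  by rewrite -[leLHS]add0r lerD// ler_int -lerBlDr.
split => // M; have [N HN] := (limn_einf_pinftyP _).1 h (M + k + 1)%:~R.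
exists N => n /HN; rewrite mul1r iter_fZ; last by move=> j _; have /repellerP := Ry; exact.
have /repellerP /(_ n) /domain01 /andP[_ y1] := Ry.
move=> hn; have : (M + k + 1)%:~R < (path n y + k + 1)%:~R :> R.
  by apply: (le_lt_trans hn); rewrite [ltRHS]rmorphD /= addrC ltrD2l.
by rewrite ltr_int; lia.
Qed.

Lemma drift_neg y k : drift_set I J F0 psi (-1) y <-> transient_neg DZ fZ (y + k%:~R) /\ R0 y.
Proof.
split=> [[Ry h]|[[Rx h] Ry]].
  split => //; split; first exact: repeller_fZ.
  apply/limn_esup_ninftyP => M; have [N HN] := h (- Num.floor M + k + 1).
  exists N => n /HN; rewrite mulN1r iter_fZ; last by move=> j _; have /repellerP := Ry; exact.
  move=> hn; apply: le_trans (floor_le M).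
  have /repellerP /(_ n) /domain01 /andP[_ /ltW y1] := Ry.
  apply: (@le_trans _ _ (1 + (path n y + k)%:~R)); first by rewrite lerD2r.
  rewrite -[1]/(1%:~R) -rmorphD ler_int.
  by move: (path n y) (Num.floor M) hn => u v; lia.
split => // M; have [N HN] := (limn_esup_ninftyP _).1 h (- M + k)%:~R.
exists N => n /HN; rewrite mulN1r iter_fZ; last by move=> j _; have /repellerP := Ry; exact.
have /repellerP /(_ n) /domain01 /andP[y0 _] := Ry.
move=> hn; have : (path n y + k)%:~R < (- M + k)%:~R :> R.
  by apply: lt_le_trans hn; rewrite ltrDr.
by rewrite ltr_int; lia.
Qed.

Lemma dimH_transient_pos : dimH (transient_pos DZ fZ) = dimH (drift_set I J F0 psi 1).
Proof.
apply/eqP; rewrite eq_le; apply/andP; split; apply: dimH_le_translates => x.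
  move=> [Rx h]; have [y [k [Ry xE]]] := repeller_fZ_split Rx.
  exists k => //; exists y => //; apply/(drift_pos y k); rewrite -xE.
  by split.
move=> hx; exists 0 => //; exists x; last by rewrite addr0.
by have [] := (drift_pos x 0).1 hx; rewrite addr0.
Qed.

Lemma dimH_transient_neg : dimH (transient_neg DZ fZ) = dimH (drift_set I J F0 psi (-1)).
Proof.
apply/eqP; rewrite eq_le; apply/andP; split; apply: dimH_le_translates => x.
  move=> [Rx h]; have [y [k [Ry xE]]] := repeller_fZ_split Rx.
  exists k => //; exists y => //; apply/(drift_neg y k); rewrite -xE.
  by split.
move=> hx; exists 0 => //; exists x; last by rewrite addr0.
by have [] := (drift_neg x 0).1 hx; rewrite addr0.
Qed.

Lemma domN_gt0 x : DN x -> 0 < x.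
Proof.
by move=> [y /domain01 /andP[y0 _] [k _ <-]]; rewrite ltr_wpDr.
Qed.

Lemma domN_domZ x : DN x -> DZ x.
Proof. by move=> [y Dy [k _ <-]]; exists y => //; exists k%:Z. Qed.

Lemma fN_ge1 x : 1 <= x -> fN x = fZ x.
Proof. by move=> x1; rewrite /FN ifF//; apply/negbTE; rewrite negb_and -!leNgt x1 orbT. Qed.

Lemma fN_split y k : D0 y -> exists k', fN (y + k%:~R) = F0 y + k'%:~R.
Proof.
move=> Dy; rewrite /FN; case: ifPn => [h|_]; last by exists (psi y + k); exact: fZE.
have [yE kE] := split01 (k' := 0) (domain01 Dy) h (esym (addr0 _)).
by rewrite -yE; exists (psi1 y)%:Z.
Qed.

Lemma repeller_fN_split x : repeller DN fN x ->
  exists y k, [/\ R0 y, x = y + k%:~R & forall n, exists k', iter n fN x = iter n F0 y + k'%:~R].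
Proof.
move=> Rx; have [y Dy [k0 _ xE]] := Rx 0%N Logic.I; rewrite /= in xE.
have H n : D0 (iter n F0 y) /\ exists k', iter n fN x = iter n F0 y + k'%:~R.
  elim: n => [|n [Dn [k' E]]]; first by split => //; exists k0%:Z; rewrite -xE.
  have [k'' E'] := fN_split k' Dn.
  have E2 : iter n.+1 fN x = iter n.+1 F0 y + k''%:~R by rewrite !iterS E E'.
  split; last by exists k''.
  have := domN_domZ (Rx n.+1 Logic.I); rewrite /= -iterS E2.
  by move=> /domZP; apply; exact: domain_image01.
exists y, k0%:Z; split; [|by rewrite -xE|by move=> n; have [] := H n].
by apply/repellerP => n; have [] := H n.
Qed.

Lemma transient_neg_fN : transient_neg DN fN = set0.
Proof.
apply/seteqP; split => // x [Rx /limn_esup_ninftyP /(_ 0)[N /(_ N (leqnn N))]].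
by rewrite leNgt domN_gt0//; exact: Rx.
Qed.

Lemma drift_shift y n sg : R0 y -> drift_set I J F0 psi sg (iter n F0 y) ->
  drift_set I J F0 psi sg y.
Proof.
move=> Ry [_ h]; split => // M; have [N HN] := h (M - sg * path n y).
exists (n + N)%N => m hm; rewrite -(subnKC (leq_trans (leq_addr N n) hm)) path_sumD mulrDr.
by rewrite -lerBlDl; apply: HN; rewrite leq_subRL// (leq_trans (leq_addr N n) hm).
Qed.

(** Such an orbit of [fN] finally stays above 1, where [fN] and [fZ] agree. The integer parts before
    that time may differ, but the fractional parts follow the same orbit of [F0], and drift is a
    property of its tail. *)
Lemma transient_pos_fN_sub : transient_pos DN fN `<=` transient_pos DZ fZ.
Proof.
move=> x [Rx h]; have [y [k [Ry xE HI]]] := repeller_fN_split Rx.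
have hP := (limn_einf_pinftyP _).1 h; have [N HN] := hP 1.
have [kN EN] := HI N.
have same n : iter n fZ (iter N fN x) = iter (n + N) fN x.
  elim: n => // n IH; rewrite iterS IH addSn iterS fN_ge1//.
  by apply: HN; exact: leq_addl.
have dN : drift_set I J F0 psi 1 (iter N F0 y).
  apply/(drift_pos _ kN); rewrite -EN; split; last exact: (repeller_iter N Ry).
  split; first by move=> n _ /=; rewrite same; apply: domN_domZ; exact: Rx.
  apply/limn_einf_pinftyP => M; have [N' HN'] := hP M.
  by exists N' => n hn; rewrite same; apply: HN'; exact: leq_trans hn (leq_addr _ _).
by have [] := (drift_pos y k).1 (drift_shift Ry dN); rewrite xE.
Qed.

Lemma drift_bounded_below y : drift_set I J F0 psi 1 y ->
  exists L : nat, forall n, - L%:Z <= path n y.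
Proof.
move=> [_ /(_ 0)[N HN]].
suff [L HL] : exists L : nat, forall n, (n < N)%N -> - L%:Z <= path n y.
  exists L => n; have [nN|Nn] := ltnP n N; first exact: HL.
  by have := HN n Nn; rewrite mul1r; lia.
elim: N {HN} => [|N [L HL]]; first by exists 0%N.
exists (L + `|path N y|)%N => n; rewrite ltnS leq_eqVlt => /predU1P[->|/HL]; lia.
Qed.

(** The partial sums are bounded below by some [- L], so after a translation by [L + 1] the orbit
    never enters the unit interval and is never reflected. *)
Lemma transient_pos_fN_cover : transient_pos DZ fZ `<=`
  \bigcup_(k in [set: int]) [set x + k%:~R | x in transient_pos DN fN].
Proof.
move=> x [Rx h]; have [y [k [Ry xE]]] := repeller_fZ_split Rx.
have dy : drift_set I J F0 psi 1 y by apply/(drift_pos y k); rewrite -xE; split.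
have [L HL] := drift_bounded_below dy.
have Dy n : D0 (iter n F0 y) by have /repellerP := Ry; exact.
exists (k - L.+1%:Z) => //; exists (y + L.+1%:~R); last first.
  by rewrite xE -addrA -rmorphD; congr (y + _%:~R); rewrite addrC subrK.
have same n : iter n fN (y + L.+1%:~R) = iter n fZ (y + L.+1%:~R).
  elim: n => // n IH; rewrite !iterS IH fN_ge1// iter_fZ//.
  have /andP[y0 _] := domain01 (Dy n).
  rewrite -[leLHS]add0r lerD ?(ltW y0)// -[1]/(1%:~R) ler_int.
  by have := HL n; lia.
have [[_ hT] _] := (drift_pos y L.+1%:Z).1 dy.
split; last by under eq_fun do rewrite same.
move=> n _ /=; rewrite same iter_fZ//; exists (iter n F0 y) => //.
exists (absz (path n y + L.+1%:Z)) => //.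
by rewrite -[_%:R]/(Posz _)%:~R gez0_abs//; have := HL n; lia.
Qed.

Lemma dimH_transient_pos_fN : dimH (transient_pos DN fN) = dimH (transient_pos DZ fZ).
Proof.
apply/eqP; rewrite eq_le; apply/andP; split; apply: dimH_le_translates.
  by move=> x /transient_pos_fN_sub hx; exists 0 => //; exists x; rewrite ?addr0.
exact: transient_pos_fN_cover.
Qed.

End SkewProducts.

(** * Critical exponent of [F_Z] and dimensions of the drift sets *)

Section SkewExponent.
Context {R : realType} (I : set nat) (J : nat -> set R) (F0 : R -> R).
Variables (lam K : R).
Hypothesis hF0 : base_map I J F0.
Hypothesis lam1 : 1 < lam.
Hypothesis Hlam : forall x, base_domain I J x -> lam <= `|derive1 F0 x|.
Hypothesis K1 : 1 <= K.
Hypothesis HK : forall w x y, words I w -> cyl J F0 w x -> cyl J F0 w y ->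
  `|deriv_iter F0 (size w) x| <= K * `|deriv_iter F0 (size w) y|.

Local Notation cyl := (cyl J F0).
Local Notation D := (deriv_iter F0).
Local Notation words := (words I).
Local Notation D0 := (base_domain I J).
Local Notation R0 := (repeller D0 F0).
Local Notation weight := (weight J F0).
Local Notation S psi := (word_step J F0 psi).
Local Notation DZ := (domZ I J).

Variable (psi : R -> int).
Hypothesis hpsi : step_function I J psi.
Local Notation fZ := (FZ F0 psi).
Local Notation path := (path_sum F0 psi).

Let cpsi : constant_on_branches I J psi. Proof. by have [] := hpsi. Qed.
Let Sgen := word_step_surj hF0 hpsi.
Let b0 := weight_gt0 hF0 lam1 Hlam.
Let ble := weight_le hF0 lam1 Hlam.

(** On a neighbourhood of [y + k] the iterate is that of [F0] composed with translations, because
    the path sum is constant on a cylinder. *)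
Lemma derive1_iter_fZ n y (k : int) : R0 y -> derive1 (iter n fZ) (y + k%:~R) = D n y.
Proof.
move=> Ry; have [w [ww sw yw]] := repeller_code hF0 n Ry.
pose A := (fun t : R => t - k%:~R) @^-1` cyl w.
have oA : open A.
  apply: open_comp; last exact: (cyl_open hF0 ww).
  by move=> t _; apply: continuousB; [exact: cvg_id|exact: cst_continuous].
have Ay : A (y + k%:~R) by rewrite /A /= addrK.
have E t : A t -> iter n fZ t = iter n F0 (t - k%:~R) + (S psi w + k)%:~R.
  move=> At; rewrite -{1}(subrK k%:~R t) (iter_fZ hF0).
    by rewrite -(path_sum_cyl hF0 cpsi ww At) sw.
  by move=> j jn; apply: (cyl_base_domain ww _ At); rewrite sw.
rewrite (derive1_open_eq oA Ay E) derive1E.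
have d1 : is_derive (y + k%:~R) 1 (fun t : R => t - k%:~R) 1.
  by apply: is_derive_eq; rewrite subr0.
have d2 : is_derive (y + k%:~R - k%:~R) 1 (iter n F0) (D n y).
  by rewrite addrK -sw; exact: (cyl_is_derive hF0 ww yw).
have d3 := @is_derive1_comp R (iter n F0) (fun t : R => t - k%:~R) _ _ _ d2 d1.
have d4 : is_derive (y + k%:~R) 1 (fun t : R => iter n F0 (t - k%:~R) + (S psi w + k)%:~R) (D n y).
  by apply: is_derive_eq; rewrite addr0 mulr1.
by have [_ ->] := d4.
Qed.

Let level0 : set (seq nat) := words `&` [set w | S psi w = 0].

Variables (iZ : nat) (hZ : int).
Hypothesis IiZ : I iZ.
Local Notation JZ := [set x + hZ%:~R | x in J iZ].

(** Periodic points of [fZ] in the chosen interval, with the integer part removed: closing up in the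
    line forces the path sum to vanish. *)
Let X n : set R := [set y | [/\ R0 y, iter n F0 y = y, path n y = 0 & J iZ y]].

Let X_shift n : periodic_points DZ fZ n `&` JZ = [set y + hZ%:~R | y in X n].
Proof.
apply/seteqP; split => x.
  move=> [[Rx Fx] [y Jy yx]].
  have [y' [k [Ry' xE]]] := repeller_fZ_split hF0 Rx.
  have Dy : D0 y by exists iZ.
  have Dy' : D0 y' by have /repellerP/(_ 0%N) := Ry'.
  have [yy' _] := split01 (domain01 hF0 Dy) (domain01 hF0 Dy') (etrans yx xE).
  rewrite -yy' in Ry'; exists y => //.
  move: Fx; rewrite -yx (iter_fZ hF0); last by move=> j _; have /repellerP := Ry'; exact.
  have Dn : D0 (iter n F0 y) by have /repellerP := Ry'; exact.
  move=> /(split01 (domain01 hF0 Dn) (domain01 hF0 Dy))[Fy p0].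
  by split => //; apply: (addIr hZ); rewrite p0 add0r.
move=> [y [Ry Fy p0 Jy] <-]; split; last by exists y.
split; first exact: (repeller_fZ hF0).
by rewrite (iter_fZ hF0) ?Fy ?p0 ?add0r// => j _; have /repellerP := Ry; exact.
Qed.

Let crit_sum s : (\sum_(1 <= n <oo) \esum_(x in periodic_points DZ fZ n `&` JZ)
     (`|derive1 (iter n fZ) x| `^ (- s))%:E)%E =
  \esum_(n in [set n | (1 <= n)%N]) \esum_(x in X n) (`|D n x| `^ (- s))%:E.
Proof.
rewrite nneseries_from1; last by move=> n; apply: esum_ge0 => x _; rewrite lee_fin powR_ge0.
apply: eq_esum => n _; rewrite X_shift esum_image; last by move=> x y _ _ /addIr.
by apply: eq_esum => y [Ry _ _ _]; rewrite derive1_iter_fZ.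
Qed.

Lemma skew_crit_lt s : (crit_exponent DZ fZ JZ < s%:E)%E ->
  (wsum weight level0 s < +oo)%E.
Proof.
move=> /ereal_inf_lt[_ [s' [s'0 fin] <-]]; rewrite lte_fin => s's.
have [g [a [c [wg a0 c1 gac Sg]]]] := inner_cylinder_head hF0 lam1 Hlam Sgen IiZ.
apply: (@le_lt_trans _ _ (wsum weight level0 s')).
  by apply: (wsum_antimono lam1 b0 ble); [move=> w []|exact: ltW].
rewrite crit_sum in fin.
apply: (@total_ge _ _ _ _ _ _ hF0 lam1 Hlam K1 HK X level0 _ (iZ :: g) s') => //.
  by move=> w [].
move=> w [ww /= Sw]; have [x hx Fx] := periodic_exists hF0 lam1 Hlam wg ww a0 c1 gac.
have wgw := words_cat wg ww.
exists x => //; split => //; last by have [] := hx.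
  exact: (periodic_repeller wgw _ hx Fx).
by rewrite (path_sum_cyl hF0 cpsi wgw hx) word_step_cat Sg Sw.
Qed.

Lemma skew_crit_gt s : 0 <= s -> (s%:E < crit_exponent DZ fZ JZ)%E ->
  ~ (wsum weight level0 s < +oo)%E.
Proof.
move=> s0; rewrite ltNge => /negP; apply: contra_not => fin.
apply: ereal_inf_lbound; exists s => //; split => //; rewrite crit_sum.
apply: (total_le hF0 lam1 Hlam K1 HK (X := X) (Y := level0)) => //; first by move=> w [].
move=> n y n0 [Ry Fy p0 _]; split => //.
have [w [ww sw yw]] := repeller_code hF0 n Ry; exists w; split => //; split => //=.
by rewrite -(path_sum_cyl hF0 cpsi ww yw) sw.
Qed.

Local Notation drift sg := (drift_set I J F0 psi sg).

Lemma dimH_drift_ge (sg : int) (t : \bar R) :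
  (forall s, 0 < s -> (s%:E < t)%E -> forall s', 0 < s' < s -> forall Lam : R, exists n,
    (Lam%:E < wsum weight (words `&` [set w | size w = n /\ (1 <= sg * S psi w)%R]) s')%E) ->
  (t <= dimH (drift sg))%E.
Proof.
move=> h; apply: dimH_ge => s s0 st s' /andP[s'0 s's].
pose u := (s' + s) / 2.
apply: (drift_hausdorff_neq0 hF0 lam1 Hlam K1 HK cpsi Sgen (s := u)) => //.
  by rewrite /u; lra.
by apply: (h s) => //; rewrite /u; apply/andP; split; lra.
Qed.

Lemma skew_dimH_ge (sg : int) : sg = 1 \/ sg = -1 ->
  (crit_exponent DZ fZ JZ <= dimH (drift sg))%E.
Proof.
move=> hsg; apply: dimH_drift_ge => s s0 sd s' /andP[s'0 s's] Lam.
have [i Ii pi] : exists2 i, I i & 1 <= sg * psi (cyl_pt J F0 [:: i]).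
  case: hsg => ->.
    by have [i Ii h] := letter_up hF0 hpsi; exists i; rewrite // mul1r.
  by have [i Ii h] := letter_down hF0 hpsi; exists i; rewrite // h.
have wi := words1 Ii.
have K20 : 0 < K ^+ 2 by rewrite exprn_gt0// (lt_le_trans ltr01).
pose C := (K ^+ 2 / weight [:: i]) `^ s'.
have C0 : 0 < C by rewrite powR_gt0// divr_gt0// b0.
have [|n Hn] := wsum_pinfty_level lam1 b0 ble (X := level0) (C * Lam) s's _ (skew_crit_gt (ltW s0) sd).
  by move=> w [].
exists (n + 1)%N; set Tg := words `&` _.
have : (wsum weight (level0 `&` [set w | size w = n]) s' <= C%:E * wsum weight Tg s')%E.
  apply: (wsum_cat_le K20 b0 (weight_cat_ge hF0 lam1 Hlam HK) (ltW s'0) wi).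
    by move=> w [[]].
  move=> w [[ww /= Sw] /= sw]; split; first exact: words_cat.
  by split; rewrite ?size_cat ?sw// word_step_cat Sw add0r /word_step big_seq1.
move=> /(lt_le_trans Hn); rewrite EFinM lte_pmul2l//.
Qed.

Lemma dimH_drift_le_base i (sg : int) s : I i -> 0 < s ->
  (crit_exponent D0 F0 (J i) < s%:E)%E -> hausdorff_measure s (drift sg) = 0%E.
Proof.
move=> Ii s0 hs; have fin := base_crit_lt hF0 lam1 Hlam K1 HK Sgen Ii hs.
apply: (wsum_lty_hausdorff0 lam1 b0 ble s0 (c := K) _ _ fin (V := cyl)) => //.
- exact: lt_le_trans K1.
- by move=> w ww; exact: (diam_cyl hF0 lam1 Hlam HK ww).
- move=> x [Rx _] N; have [w [ww sw xw]] := repeller_code hF0 N Rx.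
  by exists w => //; rewrite sw.
Qed.

Lemma skew_dimH_le i (sg : int) (d : R) : sg = 1 \/ sg = -1 -> I i ->
  crit_exponent D0 F0 (J i) = d%:E ->
  (forall s, 0 <= s -> s < d -> forall Lam : R, exists n,
    (Lam%:E < wsum weight (words `&` [set w | size w = n /\ (1 <= - sg * S psi w)%R]) s)%E) ->
  (dimH (drift sg) <= crit_exponent DZ fZ JZ)%E.
Proof.
move=> hsg Ii dE opp.
have crit0 : (0 <= crit_exponent DZ fZ JZ)%E.
  by apply: le_ereal_inf_tmp => _ [u [u0 _] <-]; rewrite lee_fin.
apply: dimH_le => s /ereal_between[t zt ts]; rewrite lte_fin in ts.
(* At the exponent [d] itself neither the summability of all words nor the largeness of the opposite
   words is available, so an exponent different from [d] is taken. *)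
have [u [zu us ud]] : exists u, [/\ (crit_exponent DZ fZ JZ < u%:E)%E, u <= s & u != d].
  have [td|td] := eqVneq t d; last by exists t; split; rewrite // ltW.
  exists s; split => //; first by rewrite (lt_trans zt)// lte_fin.
  by rewrite gt_eqF// -td.
have u0 : 0 < u by rewrite -lte_fin (le_lt_trans crit0).
exists u; first by rewrite (ltW u0).
have K0 : 0 < K by exact: lt_le_trans K1.
have K20 : 0 < K ^+ 2 by rewrite exprn_gt0.
move: ud; rewrite neq_lt => /orP[ud|du]; last first.
  by apply: (dimH_drift_le_base sg Ii u0); rewrite dE lte_fin.
have [n /esum_gt[W [uW WP WK]]] := opp u (ltW u0) ud (2 * (K ^+ 2) `^ u).
rewrite sumEFin lte_fin in WK.
(* The sign is normalised so that the words of [W] have positive step; the words with [S' w <= 0]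
   are then those occurring along the drift set. *)
pose S' w := - sg * S psi w.
have sg2 : sg * sg = 1 by case: hsg => ->.
have S'cat w v : S' (w ++ v) = S' w + S' v by rewrite /S' word_step_cat mulrDr.
have S'gen r : exists2 v, words v & S' v = r.
  have [v wv Sv] := Sgen (- sg * r); exists v => //.
  by rewrite /S' Sv mulrA mulrNN sg2 mul1r.
have fin0 : (wsum weight (words `&` [set w | S' w = 0%R]) u < +oo)%E.
  have -> : words `&` [set w | S' w = 0] = level0; last exact: skew_crit_lt.
  apply/seteqP; split => w [ww /= Sw]; split => //=; last by rewrite /S' Sw mulr0.
  by move/eqP: Sw; rewrite mulf_eq0 oppr_eq0; case: hsg => -> /= /eqP.
have fin : (wsum weight (words `&` [set w | (S' w <= 0)%R]) u < +oo)%E.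
  apply: (wsum_nonpos_lty K20 lam1 b0 (weight_cat_ge hF0 lam1 Hlam HK) S'cat S'gen
    (n := n) (W := W) (ltW u0) fin0 uW); last exact: ltW.
  by move=> w /WP[ww [sw Sw]].
apply: (wsum_lty_hausdorff0 lam1 b0 ble u0 K0 _ fin (V := cyl)) => //.
- by move=> w ww; exact: (diam_cyl hF0 lam1 Hlam HK ww).
- move=> x [Rx /(_ 0)[N0 HN0]] N.
  have [w [ww sw xw]] := repeller_code hF0 (maxn N N0) Rx.
  exists w => //; split; last by rewrite sw leq_maxl.
  split => //=; rewrite /S' mulNr oppr_le0 -(path_sum_cyl hF0 cpsi ww xw) sw.
  by apply: HN0; rewrite leq_maxr.
Qed.

End SkewExponent.

Theorem theorem2p5 (R : realType) (I : set nat) (J : nat -> set R)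
    (F0 : R -> R) (psi : R -> int) (psi1 : R -> nat)
    (D0 := base_domain I J) (DZ := domZ I J) (DN := domN I J)
    (fZ := FZ F0 psi) (fN := FN F0 psi psi1)
    (phi := geom_potential F0)
    (hF0 : base_map I J F0)
    (hpsi : step_function I J psi)
    (hpsi1 : reflexion_rule I J psi psi1)
    (htransZ : transitive_on_repeller DZ fZ)
    (htransN : transitive_on_repeller DN fN)
    (* fixed basic intervals for the pressure, for F_0 and for F_Z *)
    (ip i0 iZ : nat) (hZ : int)
    (hip : I ip) (hi0 : I i0) (hiZ : I iZ)
    (delta0 := crit_exponent D0 F0 (J i0))
    (deltaZ := crit_exponent DZ fZ [set x + hZ%:~R | x in J iZ])
    (hreg : strongly_regular I J F0 ip)
    (mu : probability (measurableTypeR R) R)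
    (hmu : gibbs_measure I J F0 ip (fun x => fine delta0 * phi x) mu)
    (hlyap : (\int[mu]_(x in repeller D0 F0) (- phi x)%:E < +oo)%E)
    (alpha_max := (\int[mu]_(x in repeller D0 F0) ((psi x)%:~R)%:E)%E) :
  [/\ dimH (transient_pos DN fN) = dimH (transient_pos DZ fZ),
      dimH (transient_neg DN fN) = 0%E,
      dimH (transient_pos DZ fZ)
        = (if (0 <= alpha_max)%E then delta0 else deltaZ) &
      dimH (transient_neg DZ fZ)
        = (if (0 <= - alpha_max)%E then delta0 else deltaZ)].
Proof.
have [lam lam1 Hlam] := base_expansion_rate hF0.
have [B B0 HB] := base_adler_bound hF0.
have K1 := distortion_ge1 lam1 B0.
have HK := cyl_distortion hF0 lam1 Hlam B0 HB.
have [cpsi _ _] := hpsi.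
have Sgen := word_step_surj hF0 hpsi.
have [s0 s00 Ps0] := hreg; have /andP[_ Pfin] := Ps0.
have d0 : (0 <= delta0)%E by apply: le_ereal_inf_tmp => _ [u [u0 _] <-]; rewrite lee_fin.
have dlt : (delta0 < +oo)%E.
  exact: (base_crit_lty hF0 lam1 Hlam K1 HK Sgen hip (ltW s00) Pfin).
have dE : delta0 = (fine delta0)%:E by rewrite fineK// ge0_fin_numE.
have fd0 : 0 <= fine delta0 by exact: fine_ge0.
have P0 := pressure_ge0 hF0 lam1 Hlam K1 HK Sgen hip hi0 s00 Ps0 dE.
have [C C0 HC] := gibbs_cyl_le hF0 lam1 Hlam K1 HK fd0 P0 hmu.
have [_ mu1 mu_inv _] := hmu.
have weights (sg : int) :
    (sg = 1 /\ (0 <= alpha_max)%E) \/ (sg = -1 /\ (0 <= - alpha_max)%E) ->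
    forall s, 0 <= s -> s < fine delta0 -> forall Lam : R, exists n,
    (Lam%:E < wsum (weight J F0) (words I `&` [set w | size w = n /\
       (1 <= sg * word_step J F0 psi w)%R]) s)%E.
  move=> hsg s s_ge0 sd.
  exact: (drift_weight hF0 lam1 Hlam K1 HK hpsi mu1 mu_inv hsg s_ge0 sd C0 HC).
have full (sg : int) :
    (sg = 1 /\ (0 <= alpha_max)%E) \/ (sg = -1 /\ (0 <= - alpha_max)%E) ->
    dimH (drift_set I J F0 psi sg) = delta0.
  move=> hsg; apply/eqP; rewrite eq_le; apply/andP; split.
    apply: dimH_le => s ds; have s_gt0 : 0 < s by rewrite -lte_fin (le_lt_trans d0).
    exists s; first by rewrite lexx ltW.
    exact: (dimH_drift_le_base hF0 lam1 Hlam K1 HK hpsi sg hi0 s_gt0 ds).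
  apply: (dimH_drift_ge hF0 lam1 Hlam K1 HK hpsi) => s s_gt0 sd s' /andP[s'0 s's].
  apply: (weights sg hsg); first exact: ltW.
  by rewrite dE lte_fin in sd; exact: lt_trans sd.
(* Here the mean drift is opposite to [sg] or zero, so it is the words of opposite step that are
   heavy. At drift 0 both [full] and [skew] apply, and the two exponents agree. *)
have skew (sg : int) :
    (- sg = 1 /\ (0 <= alpha_max)%E) \/ (- sg = -1 /\ (0 <= - alpha_max)%E) ->
    dimH (drift_set I J F0 psi sg) = deltaZ.
  move=> hsg.
  have sg1 : sg = 1 \/ sg = -1.
    by case: hsg => [[e _]|[e _]]; [right|left]; apply: oppr_inj; rewrite e ?opprK.
  apply/eqP; rewrite eq_le; apply/andP; split.
    apply: (skew_dimH_le hF0 lam1 Hlam K1 HK hpsi hZ hiZ sg1 hi0 dE).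
    exact: weights.
  exact: (skew_dimH_ge hF0 lam1 Hlam K1 HK hpsi hZ hiZ sg1).
split.
- exact: (dimH_transient_pos_fN hF0).
- by rewrite /DN /fN (transient_neg_fN hF0); exact: dimH_set0.
- rewrite (dimH_transient_pos hF0); case: ifPn => al; first by apply: full; left.
  apply: skew; right; split => //; rewrite oppe_ge0; apply: ltW; by rewrite ltNge.
- rewrite (dimH_transient_neg hF0); case: ifPn => al; first by apply: full; right.
  apply: skew; left; split; first exact: opprK.
  by apply: ltW; rewrite ltNge -oppe_ge0.
Qed.
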